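(* Let $s\in(\{0\}\cup\mathbb{N})^d$ be given, let $P$ be a probability distribution on $\mathbb{R}^d$ with volume dimension $d_{\mathrm{vol}}=d_{\mathrm{vol}}(P)$ (relative to the fixed set $\mathbb{X}\subset\mathbb{R}^d$), let $X_1,\dots,X_n$ be i.i.d. from $P$, let $(l_n)$ be a sequence of positive numbers and $\delta\in(0,1)$. Let $K:\mathbb{R}^d\to\mathbb{R}$ be a kernel function such that: (i) the partial derivative $D^sK:\mathbb{R}^d\to\mathbb{R}$ exists and $\|D^sK\|_\infty<\infty$; (ii) $\int_0^\infty t^{d_{\mathrm{vol}}-1}\sup_{\|x\|\ge t}(D^sK)^2(x)\,dt<\infty$; (iii) $\|D^sK\|_\infty,\|D^sK\|_2<\infty$ and $\mathcal{F}^s_{K,[l_n,\infty)}=\{D^sK_{x,h}:x\in\mathbb{X},\,h\ge l_n\}$ is a uniformly bounded VC-class with dimension $\nu$, i.e. there exist positive numbers $A$ and $\nu$ such that, for every probability measure $Q$ on $\mathbb{R}^d$ and every $\eta\in(0,\|D^sK\|_\infty)$, $\mathcal{N}(\mathcal{F}^s_{K,[l_n,\infty)},L_2(Q),\eta)\le\left(\frac{A\|D^sK\|_\infty}{\eta}\right)^{\nu}$. Suppose $$\limsup_n\frac{(\log(1/l_n))_++\log(2/\delta)}{n\,l_n^{d_{\mathrm{vol}}-\epsilon}}<\infty$$ for fixed $\epsilon\in(0,d_{\mathrm{vol}})$. Then, with probability at least $1-\delta$, $$\sup_{h\ge l_n,\,x\in\mathbb{X}}|D^s\hat p_h(x)-D^sp_h(x)|\le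 C'\sqrt{\frac{(\log(1/l_n))_++\log(2/\delta)}{n\,l_n^{2d+2|s|-d_{\mathrm{vol}}+\epsilon}}},$$ where $C'$ is a constant depending only on $A$, $\|D^sK\|_\infty$, $d$, $\nu$, $d_{\mathrm{vol}}$, $C_{s,P,K,\epsilon}$, $\epsilon$. Further, if $d_{\mathrm{vol}}=0$, or if $\limsup_{r\to0}\sup_{x\in\mathbb{X}}\frac{P(\mathbb{B}_{\mathbb{R}^d}(x,r))}{r^{d_{\mathrm{vol}}}}<\infty$, then $\epsilon$ can be $0$.
   Context: A subset $\mathbb{X}\subset\mathbb{R}^d$ is fixed. $\|\cdot\|$ is the Euclidean norm and $\mathbb{B}_{\mathbb{R}^d}(x,r)=\{y\in\mathbb{R}^d:\|y-x\|<r\}$. The volume dimension of $P$ is $$d_{\mathrm{vol}}(P)=\sup\left\{\nu\ge0:\ \limsup_{r\to0}\sup_{x\in\mathbb{X}}\frac{P(\mathbb{B}_{\mathbb{R}^d}(x,r))}{r^\nu}<\infty\right\}.$$ For $s=(s_1,\dots,s_d)$, $|s|=s_1+\dots+s_d$ and $D^s=\frac{\partial^{|s|}}{\partial x_1^{s_1}\cdots\partial x_d^{s_d}}$. Kernel density estimator based on $X_1,\dots,X_n$: $\hat p_h(x)=\frac{1}{nh^d}\sum_{i=1}^nK\left(\frac{x-X_i}{h}\right)$, and $p_h(x)=\mathbb{E}[\hat p_h(x)]$. $D^sK_{x,h}(\cdot)$ denotes $(D^sK)\left(\frac{x-\cdot}{h}\right)$. $(a)_+=\max(a,0)$. $\|\cdot\|_\infty$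 and $\|\cdot\|_2$ of a function are the sup norm and the $L_2$ norm. The covering number $\mathcal{N}(\mathcal{F},L_2(Q),\eta)$ is the minimal number of open $L_2(Q)$-balls of radius $\eta$ with centers in $\mathcal{F}$ needed to cover $\mathcal{F}$. $C_{s,P,K,\epsilon}$ denotes a constant, depending only on $s$, $P$, $K$ and $\epsilon$, such that $\mathbb{E}_P\left[\left(D^sK\left(\frac{x-X}{h}\right)\right)^2\right]\le C_{s,P,K,\epsilon}\,h^{d_{\mathrm{vol}}-\epsilon}$ for $x\in\mathbb{X}$, $h>0$, $X\sim P$; such a constant exists under the stated hypotheses.
   Formalization: C' may also depend on the supremum over n of the ratio in the limsup condition; X is assumed Borel and K measurable; d_vol − ε ≤ 2d + 2|s| is assumed; for h ≥ l_n, K((x−·)/h) is assumed P-integrable for every x and the partials of p_h in D^s p_h are assumed to exist. *)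

(* Defs.v *)
From HB Require Import structures.
From mathcomp Require Import all_boot all_order all_algebra.
From mathcomp Require Import all_classical all_reals all_analysis.
Set Implicit Arguments.
Unset Strict Implicit.
Unset Printing Implicit Defensive.
Import Order.TTheory GRing.Theory Num.Theory numFieldNormedType.Exports.
Local Open Scope classical_set_scope.
Local Open Scope ring_scope.

(* R^d is 'rV[R]_d with its Borel sigma-algebra. *)
HB.instance Definition _ (R : realType) (d : nat) :=
  @isMeasurable.Build (sigma_display (@open 'rV[R]_d)) 'rV[R]_d
    <<s @open 'rV[R]_d >> (@sigma_algebra0 _ setT _)
    (@sigma_algebraC _ _) (@sigma_algebra_bigcup _ setT _).

Section euclidean_space.
Context {R : realType} {d : nat}.
Implicit Types (f : 'rV[R]_d -> R) (x y : 'rV[R]_d) (s : 'I_d -> nat).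

(* The library's norm and balls on 'rV[R]_d are those of the sup norm, hence
   the explicit Euclidean versions. *)
Definition enorm x : R := Num.sqrt (\sum_(i < d) x ord0 i ^+ 2).

Definition eball x (r : R) : set 'rV[R]_d := [set y | enorm (y - x) < r].

Definition morder s : nat := \sum_(i < d) s i.

Definition partial (i : 'I_d) f : 'rV[R]_d -> R :=
  fun x => 'D_(delta_mx ord0 i) f x.

(* Iterated partial derivatives; the head of the list is applied last. *)
Fixpoint partials (r : seq 'I_d) f : 'rV[R]_d -> R :=
  if r is i :: r' then partial i (partials r' f) else f.

Fixpoint has_partials (r : seq 'I_d) f : Prop :=
  if r is i :: r' then
    has_partials r' f /\
    forall x, derivable (partials r' f) x (delta_mx ord0 i)
  else True.

Definition directions s : seq 'I_d := flatten [seq nseq (s i) i | i <- enum 'I_d].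

Definition Dmulti s f : 'rV[R]_d -> R := partials (directions s) f.

(* All the successive partial derivatives involved in D^s f exist on R^d. *)
Definition has_Dmulti s f : Prop := has_partials (directions s) f.

Definition supnorm f : \bar R := ereal_sup (range (fun x => `|f x|%:E)).

Definition tail_sup f (t : R) : \bar R :=
  ereal_sup [set (f x)%:E | x in [set x | t <= enorm x]].

End euclidean_space.

(* Lebesgue integral over R^d of a nonnegative Borel function, as an iterated
   integral (Tonelli). *)
Fixpoint lebesgue_rV (R : realType) (d : nat) :
    ('rV[R]_d -> \bar R) -> \bar R :=
  match d return ('rV[R]_d -> \bar R) -> \bar R with
  | 0 => fun f => f 0
  | d'.+1 => fun f =>
      (\int[lebesgue_measure]_(t in [set: R])
         lebesgue_rV (fun y : 'rV[R]_d' =>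
           f (row_mx (const_mx t : 'rV[R]_1) y)))%E
  end.

Definition L2norm (R : realType) (d : nat) (f : 'rV[R]_d -> R) : \bar R :=
  (lebesgue_rV (fun x => (f x ^+ 2)%:E) `^ (2^-1))%E.

Section volume_dimension.
Context {R : realType} {d : nat}.
Variables (P : probability 'rV[R]_d R) (X : set 'rV[R]_d).
Local Open Scope ereal_scope.

Definition ball_growth (nu : R) : \bar R :=
  limf_esup
    (fun r : R => ereal_sup [set P (eball x r) * ((r `^ nu)^-1)%:E | x in X])
    0^'+.

Definition vol_dim : \bar R :=
  ereal_sup [set nu%:E | nu in [set nu : R | (0 <= nu)%R /\ ball_growth nu < +oo]].

End volume_dimension.

Section covering.
Context {R : realType} {d : nat}.
Implicit Types (F : set ('rV[R]_d -> R)) (Q : probability 'rV[R]_d R).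

Definition L2dist Q (f g : 'rV[R]_d -> R) : \bar R :=
  Lnorm Q 2%:E (fun y => (f y - g y)%:E).

(* It is +oo when no finite cover exists. *)
Definition covering_number F Q (eta : R) : \bar R :=
  ereal_inf [set m%:R%:E | m in [set m : nat |
    exists c : 'I_m -> ('rV[R]_d -> R),
      (forall i, F (c i)) /\
      (forall f, F f -> exists i, (L2dist Q f (c i) < eta%:E)%E)]].

Definition VC_class F (b A nu : R) : Prop :=
  [/\ 0 < A, 0 < nu &
   forall Q (eta : R), 0 < eta < b ->
     (covering_number F Q eta <= ((A * b / eta) `^ nu)%:E)%E].

Definition kernel_class (f : 'rV[R]_d -> R) (X : set 'rV[R]_d) (l : R) :
    set ('rV[R]_d -> R) :=
  [set g | exists x h, [/\ X x, l <= h & g = fun y => f (h^-1 *: (x - y))]].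

End covering.

Section sampling.
Context {R : realType} {d : nat}.

Definition iid (disp : measure_display) (Omega : measurableType disp)
    (Pr : probability Omega R) (P : probability 'rV[R]_d R) (n : nat)
    (X : 'I_n -> Omega -> 'rV[R]_d) : Prop :=
  [/\ forall i, measurable_fun [set: Omega] (X i),
      forall i B, measurable B -> Pr (X i @^-1` B) = P B &
      forall B : 'I_n -> set 'rV[R]_d, (forall i, measurable (B i)) ->
        Pr (\bigcap_i (X i @^-1` B i)) = (\prod_(i < n) Pr (X i @^-1` B i))%E].

Definition kde (K : 'rV[R]_d -> R) (h : R) (n : nat) (z : 'I_n -> 'rV[R]_d) :
    'rV[R]_d -> R :=
  fun x => (n%:R * h ^+ d)^-1 * \sum_(i < n) K (h^-1 *: (x - z i)).

Definition mean_kde (disp : measure_display) (Omega : measurableType disp)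
    (Pr : probability Omega R) (n : nat) (X : 'I_n -> Omega -> 'rV[R]_d)
    (K : 'rV[R]_d -> R) (h : R) : 'rV[R]_d -> R :=
  fun x => fine ('E_Pr[fun w => kde K h (fun i => X i w) x])%E.

Definition sup_deviation (s : 'I_d -> nat) (K : 'rV[R]_d -> R)
    (X : set 'rV[R]_d) (l : R) (disp : measure_display)
    (Omega : measurableType disp) (Pr : probability Omega R) (n : nat)
    (Xs : 'I_n -> Omega -> 'rV[R]_d) (w : Omega) : \bar R :=
  ereal_sup [set r | exists h x, [/\ l <= h, X x &
    r = `|Dmulti s (kde K h (fun i => Xs i w)) x
          - Dmulti s (mean_kde Pr Xs K h) x|%:E]].

(* Lower bound on the probability of an event that is not known to be
   measurable. *)
Definition prob_ge (disp : measure_display) (Omega : measurableType disp)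
    (Pr : probability Omega R) (E : set Omega) (q : R) : Prop :=
  exists E' : set Omega, [/\ measurable E', E' `<=` E & (q%:E <= Pr E')%E].

(* Bound with constant C on the second moments of f ((x - X) / h), X ~ P. *)
Definition second_moment_bound (P : probability 'rV[R]_d R)
    (X : set 'rV[R]_d) (f : 'rV[R]_d -> R) (a C : R) : Prop :=
  forall x h, X x -> 0 < h ->
    (\int[P]_y (f (h^-1 *: (x - y)) ^+ 2)%:E <= (C * h `^ a)%:E)%E.

End sampling.

Section rate.
Context {R : realType}.

(* (log (1 / l))_+ + log (2 / delta) *)
Definition log_term (l delta : R) : R :=
  Num.max (ln (l^-1)) 0 + ln (2 / delta).

Definition rate_seq (l : nat -> R) (delta a : R) (n : nat) : R :=
  log_term (l n) delta / (n%:R * l n `^ a).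

End rate.

(* Main.v *)
(* Write f = D^s K and a = d_vol - eps.  For h >= l the error
   D^s phat_h(x) - D^s p_h(x) equals h^-(d + |s|) (P_n - P) f((x - .) / h).  Multiplied
   by (l / h)^(d + |s|), these functions f((x - .) / h) form a class with envelope
   |f|_oo and polynomial uniform covering numbers, whose variance is at most a constant
   times l^a because a <= 2 (d + |s|); the second moments themselves come from the
   growth of balls by decomposing into dyadic shells.

   The empirical process over this class is controlled without Talagrand's inequality:
   a ghost sample and random swaps reduce the question to Rademacher averages over a
   double sample, which Hoeffding's inequality and chaining along nets in the empirical
   L_2 distance bound.  A first pass bounds the empirical second moments by a multiple
   of the variance, so that a second pass may chain starting from that radius.

   The events involved are unions over the uncountable set of pairs (x, h), that is
   projections of measurable sets.  They are results of Suslin's operation, and a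
   capacity argument makes them measurable up to null sets. *)

(* The limsup condition enters only as [lam <= L * (n * l^a)], with [L] the supremum of the rate
   sequence, hence the last argument of [C']. The variance proxy is deliberately inflated:
   [sigma^2 = M * l^a], with [M] large enough for three separate tasks. It bounds the second
   moments; it keeps [b / sigma] below [l^(-a/2)], so that the logarithm of the size of a net of
   radius [4 * sigma / 2^k] is at most a multiple of [lam * (k + 1)]; and it makes [n * sigma^2]
   exceed [b^2] times the entropy, which the first pass needs to absorb its union bound. The
   inflation costs only a constant, because the squared target is of order [l^a * lam / n].

   Swaps preserve the law of the double sample, so a probability becomes, for each fixed double
   sample, a proportion of the [2^n] sign patterns. The exponential inequalities are therefore
   counting statements on a finite type, and a net may depend on the sample as long as the bound on
   its cardinality does not. *)
Require Import Defs.
From HB Require Import structures.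
From mathcomp Require Import all_boot all_order all_algebra.
From mathcomp Require Import all_classical all_reals all_analysis.
From mathcomp Require Import measurable_realfun ring lra.
Import Order.TTheory GRing.Theory Num.Theory numFieldNormedType.Exports.
Local Open Scope classical_set_scope.
Local Open Scope ring_scope.

(** * Measurability of projections up to null sets *)

Section outer_measure_hull.
Context {disp : measure_display} {Y : measurableType disp} {R : realType}.
Variable mu : probability Y R.
Local Open Scope ereal_scope.

Definition outer (E : set Y) : \bar R :=
  ereal_inf [set mu M | M in [set M | measurable M /\ E `<=` M]].

Lemma outer_le E M : measurable M -> E `<=` M -> outer E <= mu M.
Proof. by move=> mM EM; apply: ereal_inf_lbound; exists M. Qed.

Lemma outer_ge0 E : 0 <= outer E.
Proof. by apply: le_ereal_inf_tmp => _ [M _ <-]. Qed.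

Lemma outer_subset E F : E `<=` F -> outer E <= outer F.
Proof.
move=> EF; apply: le_ereal_inf_tmp => _ [M [mM FM] <-].
by apply: outer_le => // y /EF /FM.
Qed.

Lemma outer_fin E : outer E \is a fin_num.
Proof.
rewrite ge0_fin_numE ?outer_ge0//; apply: (@le_lt_trans _ _ (mu setT)).
  exact: outer_le.
by rewrite probability_setT ltry.
Qed.

(** A countable intersection of nearly optimal measurable supersets attains the infimum. *)
Lemma outer_hull E : exists M, [/\ measurable M, E `<=` M & mu M = outer E].
Proof.
have /choice[f fP] : forall n : nat, exists M, [/\ measurable M, E `<=` M &
    mu M < outer E + (n.+1%:R^-1)%:E].
  move=> n.
  have : outer E < outer E + (n.+1%:R^-1)%:E.
    by rewrite lteDl ?outer_fin// lte_fin invr_gt0.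
  by case/ereal_inf_lt => _ [M [mM EM] <-] lt; exists M.
exists (\bigcap_n f n); split.
- by apply: bigcapT_measurable => n; have [] := fP n.
- by move=> y Ey n _; have [_ + _] := fP n; exact.
apply/eqP; rewrite eq_le; apply/andP; split; last first.
  apply: outer_le; first by apply: bigcapT_measurable => n; have [] := fP n.
  by move=> y Ey n _; have [_ + _] := fP n; exact.
apply/lee_addgt0Pr => e e0.
have [n ne] := ltr_add_invr e0.
have [mf _ fn] := fP n.
apply: (@le_trans _ _ (mu (f n))).
  apply: le_measure; rewrite ?inE//.
    by apply: bigcapT_measurable => k; have [] := fP k.
  exact: bigcap_inf.
by apply/ltW/(lt_trans fn); rewrite lteD2lE ?outer_fin// lte_fin -[ltLHS]add0r.
Qed.

(** Continuity from below holds for arbitrary increasing sets: the intersection of the hulls of all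
    [E j] with [j >= n] still contains [E n], has at most its outer measure, and increases with [n].
    This is the capacity property behind the greedy choice in [suslin_capacity]. *)
Lemma outer_bigcup (E : (set Y)^nat) (b : \bar R) :
  (forall m n, (m <= n)%N -> E m `<=` E n) ->
  b < outer (\bigcup_n E n) -> exists n, b < outer (E n).
Proof.
move=> ndE bE; apply: contrapT => /forallNP Eb.
have {}Eb n : outer (E n) <= b by rewrite leNgt; apply/negP/Eb.
have /choice[M MP] n : exists M, [/\ measurable M, E n `<=` M & mu M = outer (E n)].
  exact: outer_hull.
pose M' n := \bigcap_(j in [set j | (n <= j)%N]) M j.
have mM' n : measurable (M' n).
  by apply: bigcap_measurable => [|k _]; [exists n => /=|have [] := MP k].
have ndM' : nondecreasing_seq M'.
  move=> m n mn; apply/subsetPset => y My j /= nj.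
  by apply: My => /=; exact: leq_trans nj.
have mM'U : measurable (\bigcup_n M' n) by exact: bigcupT_measurable.
move: bE; apply/negP; rewrite -leNgt.
apply: (@le_trans _ _ (mu (\bigcup_n M' n))).
  apply: outer_le => // y [n _ Eny]; exists n => // j /= nj.
  by have [_ + _] := MP j; apply; exact: ndE Eny.
have /cvg_lim <- // := @nondecreasing_cvg_mu _ _ _ mu _ mM' mM'U ndM'.
apply: lime_le; first by apply/cvg_ex; eexists; exact: nondecreasing_cvg_mu.
apply: nearW => n /=; apply: le_trans (Eb n).
have [mM _ <-] := MP n.
by apply: le_measure; rewrite ?inE//; apply: bigcap_inf => /=.
Qed.

End outer_measure_hull.

(** * Suslin schemes of rectangles *)

Section suslin.
Context {disp : measure_display} {Y : measurableType disp} {T : ptopologicalType}.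

(** The alternative [C = setT] admits cylinders over measurable sets, whose second factor is not
    compact. Closedness alone would not support the cluster point argument. *)
Definition compact_rect (B : set (Y * T)) := exists A C,
  [/\ measurable A, closed C, compact C \/ C = setT & B = A `*` C].

(* Suslin's operation: the union over [u] of the intersections of the [G n u], where
   [G n u] depends on the first [N n] terms of [u] only. *)
Definition suslin (F : set (Y * T)) := exists (N : nat -> nat)
  (G : nat -> (nat -> nat) -> set (Y * T)),
  [/\ forall n u, compact_rect (G n u),
      forall n u v, (forall i, (i < N n)%N -> u i = v i) -> G n u = G n v &
      F = [set yt | exists u, forall n, G n u yt]].

Lemma compact_rectT : compact_rect setT.
Proof.
exists setT, setT; split => //; [by right|by rewrite setXTT].
Qed.

Lemma suslin_rect B : compact_rect B -> suslin B.
Proof.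
move=> cB; exists (fun=> 0%N), (fun _ _ => B); split => //.
by apply/seteqP; split => [x Bx|x [_ /(_ 0%N)]//]; exists (fun=> 0%N).
Qed.

(** The first term of [u] names the member of the union and the remaining terms feed its scheme; the
    indices of the other members impose no condition. *)
Lemma suslin_bigcup (F : (set (Y * T))^nat) :
  (forall k, suslin (F k)) -> suslin (\bigcup_k F k).
Proof.
move=> /choice[N] /choice[G FG].
(* Numbers that code no pair are sent to [(0, 0)] and merely repeat a condition already present. *)
pose dec n : nat * nat := odflt (0%N, 0%N) (unpickle n).
exists (fun n => (N (dec n).1 (dec n).2).+1).
exists (fun n u => if u 0%N == (dec n).1 then
  G (dec n).1 (dec n).2 (u \o succn) else setT).
split.
- move=> n u; case: ifPn => _; last exact: compact_rectT.
  by have [cG _ _] := FG (dec n).1; exact: cG.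
- move=> n u v uv; rewrite uv//; case: ifPn => // _.
  have [_ locG _] := FG (dec n).1.
  by apply: locG => i iN; apply: uv.
apply/seteqP; split => [x [k _]|x [u Gu]].
  have [_ _ ->] := FG k => -[u Gu].
  exists (fun i => if i is j.+1 then u j else k) => n /=.
  by case: ifPn => // /eqP <-; exact: Gu.
exists (u 0%N) => //; have [_ _ ->] := FG (u 0%N).
exists (u \o succn) => n; have := Gu (pickle (u 0%N, n)).
by rewrite /dec pickleK/= eqxx.
Qed.

(** One sequence carries a sequence for each [F k], its terms being spread over the codes of the
    pairs [(k, j)]. *)
Lemma suslin_bigcap (F : (set (Y * T))^nat) :
  (forall k, suslin (F k)) -> suslin (\bigcap_k F k).
Proof.
move=> /choice[N] /choice[G FG].
pose dec n : nat * nat := odflt (0%N, 0%N) (unpickle n).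
pose coord (u : nat -> nat) (k : nat) : nat -> nat := fun j => u (pickle (k, j)).
(* The terms of the subsequence that matter sit at scattered positions, so the locality bound is one
   more than the largest of their codes. *)
exists (fun n => (\max_(j < N (dec n).1 (dec n).2) pickle ((dec n).1, nat_of_ord j)).+1).
exists (fun n u => G (dec n).1 (dec n).2 (coord u (dec n).1)).
split.
- by move=> n u; have [cG _ _] := FG (dec n).1; exact: cG.
- move=> n u v uv; have [_ locG _] := FG (dec n).1.
  apply: locG => i iN; apply: uv; rewrite ltnS.
  exact: (leq_bigmax (F := fun j : 'I__ => pickle ((dec n).1, nat_of_ord j)) (Ordinal iN)).
apply/seteqP; split => [x Fx|x [u Gu] k _]; last first.
  have [_ _ ->] := FG k; exists (coord u k) => n.
  by have := Gu (pickle (k, n)); rewrite /dec pickleK.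
have /choice[w wP] k : exists u, forall n, G k n u x.
  by have := Fx k Logic.I; have [_ _ ->] := FG k.
exists (fun i => w (dec i).1 (dec i).2) => n.
have -> : coord (fun i => w (dec i).1 (dec i).2) (dec n).1 = w (dec n).1.
  by apply/funext => j; rewrite /coord /dec pickleK.
exact: wP.
Qed.

(** Rectangles decouple the two variables: a [t] lying in all second factors serves every [y], and
    without such a [t] the projection is empty. *)
Lemma projection_rects_measurable (D : set nat) (B : nat -> set (Y * T)) :
  (forall n, compact_rect (B n)) ->
  measurable [set y | exists t, forall n, D n -> B n (y, t)].
Proof.
move=> /choice[A] /choice[C BP].
have [[t Ct]|noC] := pselect (exists t, forall n, D n -> C n t).
  rewrite (_ : mkset _ = \bigcap_(n in D) A n).
    have [[n Dn]|D0] := pselect (D !=set0).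
      by apply: bigcap_measurable; [exists n|move=> k _; have [] := BP k].
    by have -> : D = set0; [apply/seteqP; split => // n Dn; case: D0; exists n|
      rewrite bigcap_set0].
  apply/seteqP; split => [y [t' Bt'] n Dn|y Ay].
    by have [_ _ _ E] := BP n; have := Bt' n Dn; rewrite E => -[].
  by exists t => n Dn; have [_ _ _ ->] := BP n; split; [exact: Ay|exact: Ct].
rewrite (_ : mkset _ = set0)//; apply/seteqP; split => // y [t Bt].
by apply: noC; exists t => n Dn; have [_ _ _ E] := BP n; have := Bt n Dn; rewrite E => -[].
Qed.

(** The ultrafilter selects one of finitely many level sets. *)
Lemma ultra_bounded (U : set_system nat) (f : nat -> nat) (m : nat) :
  UltraFilter U -> U [set k | (f k <= m)%N] -> exists2 v, (v <= m)%N & U [set k | f k = v].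
Proof.
move=> UU; elim: m => [|m IH] Um.
  by exists 0%N => //; apply: filterS Um => k /=; rewrite leqn0 => /eqP.
have [Ue|Un] := in_ultra_setVsetC [set k | f k = m.+1] UU.
  by exists m.+1.
have [|v vm Uv] := IH; last by exists v => //; exact: leqW.
apply: filterS2 Um Un => k /=; rewrite leq_eqVlt => /orP[/eqP//|].
by rewrite ltnS.
Qed.

(* Koenig's lemma and compactness at once: along an ultrafilter the bounded index
   sequences stabilize and the points [t k] of the compact factor cluster. *)
Lemma suslin_compactness (N : nat -> nat) (G : nat -> (nat -> nat) -> set (Y * T))
    (m : nat -> nat) (y : Y) (u : nat -> nat -> nat) (t : nat -> T) :
  (forall n u, compact_rect (G n u)) ->
  (forall n u v, (forall i, (i < N n)%N -> u i = v i) -> G n u = G n v) ->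
  (forall k i, (i < k)%N -> (u k i <= m i)%N) ->
  (forall k n, (n < k)%N -> (N n <= k)%N -> G n (u k) (y, t k)) ->
  exists v s, forall n, G n v (y, s).
Proof.
move=> cG locG um Gt.
have [U [UU Uoo]] := @ultraFilterLemma nat \oo _.
have Uge p : U [set k | (p <= k)%N] by apply: Uoo; exists p.
have /choice[v vP] i : exists v, U [set k | u k i = v].
  have [|v _ Uv] := @ultra_bounded U (fun k => u k i) (m i) UU; last by exists v.
  by apply: filterS (Uge i.+1) => k /= /um.
have UG n : U [set k | G n v (y, t k)].
  have Ufin p : U [set k | forall i, (i < p)%N -> u k i = v i].
    elim: p => [|p IH]; first by apply: filterS (Uge 0%N) => k.
    apply: filterS2 IH (vP p) => k /= IH up i; rewrite ltnS leq_eqVlt.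
    by case/orP => [/eqP->//|/IH].
  apply: filterS3 (Ufin (N n)) (Uge n.+1) (Uge (N n)) => k /= uv nk Nk.
  by rewrite -(locG n (u k))//; exact: Gt.
exists v.
have [A] := choice (cG ^~ v); case/choice => C BP.
have UC n : U [set k | C n (t k)].
  by apply: filterS (UG n) => k /=; have [_ _ _ ->] := BP n; case.
have Ay n : A n y.
  have [k] := @filter_ex _ _ _ _ (UG n).
  by rewrite /mkset; have [_ _ _ ->] := BP n; case.
(* With no compact factor every second factor is the whole space and any point will do; otherwise a
   single compact factor already provides the cluster point for all of them. *)
have [allT|] := pselect (forall n, C n = setT).
  by exists (t 0%N) => n; have [_ _ _ ->] := BP n; rewrite allT; split; first exact: Ay.
case/existsNP => n0 Cn0.
have : compact (C n0) by have [_ _ []] := BP n0.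
move=> /(_ (t @ U) _ (UC n0))[s [_ ts]].
exists s => n; have [_ clC _ ->] := BP n; split; first exact: Ay.
by apply: clC => B sB; apply: ts => //; exact: UC.
Qed.

End suslin.

Section projection.
Context {disp : measure_display} {Y : measurableType disp} {T : ptopologicalType}
  {R : realType}.
Variable mu : probability Y R.

Definition proj (F : set (Y * T)) : set Y := [set y | exists t, F (y, t)].

(* Restricting to sequences bounded by a well chosen [m], one greedy bound per term,
   loses no more than the excess over [b], and by compactness the remaining set is a
   decreasing intersection of measurable sets. *)
Lemma suslin_capacity (F : set (Y * T)) (b : \bar R) :
  suslin F -> (b < outer mu (proj F))%E ->
  exists D, [/\ measurable D, D `<=` proj F & (b <= mu D)%E].
Proof.
move=> [N [G [cG locG ->]]] bF.
pose B (m : seq nat) := [set y | exists u t,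
  (forall i, (i < size m)%N -> (u i <= nth 0%N m i)%N) /\
  (forall n, G n u (y, t))].
have Bstep m : (b < outer mu (B m))%E ->
    exists j, (b < outer mu (B (rcons m j)))%E.
  move=> bm; apply: outer_bigcup.
    move=> j j' jj' y [u [t [um Gu]]]; exists u, t; split => // i.
    rewrite size_rcons ltnS => im; have := um i.
    rewrite size_rcons ltnS im => /(_ isT).
    rewrite !nth_rcons; case: ltnP => // mi.
    rewrite eqn_leq im mi/= => uj; exact: leq_trans jj'.
  apply: lt_le_trans bm _; apply: outer_subset => y [u [t [um Gu]]].
  exists (u (size m)) => //; exists u, t; split => // i.
  rewrite size_rcons ltnS nth_rcons; case: ltnP => [im _|mi im]; first exact: um.
  by have /eqP -> : i == size m; rewrite ?eqxx// eqn_leq im mi.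
have /choice[f fP] m : exists j, (b < outer mu (B m))%E ->
    (b < outer mu (B (rcons m j)))%E.
  have [/Bstep[j bj]|nb] := pselect (b < outer mu (B m))%E; first by exists j.
  by exists 0%N.
pose M := fix M k := if k is k'.+1 then rcons (M k') (f (M k')) else [::].
pose m i := f (M i).
have ME k : M k = mkseq m k.
  by elim: k => // k /= {1}->; rewrite -[in RHS]addn1 /mkseq iotaD map_cat/= cats1.
have bM k : (b < outer mu (B (M k)))%E.
  elim: k => [|k IH] /=; last exact: fP.
  apply: lt_le_trans bF _; apply: outer_subset => y [t [u Gu]].
  by exists u, t.
(* [D k] keeps only finitely many conditions, all decided by the first [k] terms, so it is a
   countable union over finite sequences of projections of rectangles, hence measurable. *)
pose D k := [set y | exists u t, (forall i, (i < k)%N -> (u i <= m i)%N) /\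
  (forall n, (n < k)%N -> (N n <= k)%N -> G n u (y, t))].
have mD k : measurable (D k).
  pose E (s : seq nat) := [set y | exists t, forall n, (n < k)%N && (N n <= k)%N ->
    G n (nth 0%N s) (y, t)].
  pose S := [set s : seq nat | forall i, (i < k)%N -> (nth 0%N s i <= m i)%N].
  rewrite (_ : D k = \bigcup_(s in S) E s).
    rewrite bigcup_mkcond; apply: countable_bigcupT_measurable => // s.
    case: ifP => // _; apply: (@projection_rects_measurable _ _ _ [set n | (n < k)%N && (N n <= k)%N]
      (fun n => G n (nth 0%N s))).
    by move=> n; exact: cG.
  apply/seteqP; split => [y [u [t [um Gu]]]|y [s sm [t Gs]]]; last first.
    by exists (nth 0%N s), t; split => // n nk Nk; apply: Gs; rewrite nk.
  exists (mkseq u k); first by move=> i ik; rewrite nth_mkseq//; exact: um.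
  exists t => n /andP[nk Nk]; rewrite -(locG n u); first exact: Gu.
  by move=> i iN; rewrite nth_mkseq//; exact: leq_trans Nk.
have BD k : B (M k) `<=` D k.
  move=> y [u [t [um Gu]]]; exists u, t; split => // i ik.
  by have := um i; rewrite ME size_mkseq nth_mkseq//; exact.
exists (\bigcap_k D k); split.
- exact: bigcapT_measurable.
- move=> y Dy; have /choice[u] k := Dy k Logic.I.
  case/choice => t utP.
  have [||v [s Gv]] := @suslin_compactness _ _ _ N G m y u t cG locG.
  + by move=> k i; have [+ _] := utP k; exact.
  + by move=> k n; have [_ +] := utP k; exact.
  + by exists s, v.
have niD : nonincreasing_seq D.
  move=> p q pq; apply/subsetPset => y [u [t [um Gu]]]; exists u, t; split.
    by move=> i ip; apply: um; exact: leq_trans pq.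
  by move=> n np Np; apply: Gu; [exact: leq_trans pq|exact: leq_trans pq].
have D0 : (mu (D 0%N) < +oo)%E.
  by rewrite -ge0_fin_numE// fin_num_measure.
have mDI : measurable (\bigcap_k D k) by exact: bigcapT_measurable.
have cD := @nonincreasing_cvg_mu _ _ _ mu _ D0 mD mDI niD.
rewrite -(cvg_lim _ cD)//; apply: lime_ge; first by apply/cvg_ex; eexists; exact: cD.
apply: nearW => k /=; apply/ltW/(lt_le_trans (bM k)).
by apply: outer_le.
Qed.

(** Suslin's operation is not stable under complements; carrying the complement along turns the
    class into a sigma-algebra. *)
Definition bisuslin (F : set (Y * T)) := suslin F /\ suslin (~` F).

Lemma suslin0 : suslin (set0 : set (Y * T)).
Proof.
apply: suslin_rect; exists set0, setT; split => //; last by rewrite set0X.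
by right.
Qed.

Lemma suslinT : suslin (setT : set (Y * T)).
Proof. exact/suslin_rect/compact_rectT. Qed.

Lemma bisuslin_sigma_algebra : sigma_algebra setT bisuslin.
Proof.
split.
- by split; [exact: suslin0|rewrite setC0; exact: suslinT].
- by move=> F [sF sCF]; rewrite setTD; split => //; rewrite setCK.
- move=> F sF; split; first by apply: suslin_bigcup => k; have [] := sF k.
  by rewrite setC_bigcup; apply: suslin_bigcap => k; have [] := sF k.
Qed.

End projection.

Section projection_theorem.
Context {disp : measure_display} {Y : measurableType disp} {R : realType} {p : nat}.
Variable mu : probability Y R.

Lemma closed_sigma_compact (C : set 'rV[R]_p) : closed C ->
  exists K : nat -> set 'rV[R]_p, (forall k, compact (K k) /\ closed (K k)) /\
    C = \bigcup_k K k.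
Proof.
move=> cC; pose B k : set 'rV[R]_p := [set x | forall i, x ord0 i \in `[- (k%:R : R), k%:R]].
have cB k : compact (B k).
  by apply: (@rV_compact _ _ (fun=> `[- (k%:R : R), k%:R]%classic)) => _; exact: segment_compact.
have clB k : closed (B k) by apply: compact_closed => //; exact: norm_hausdorff.
exists (fun k => C `&` B k); split.
  move=> k; split; last exact: closedI.
  by apply: subclosed_compact (cB k) _ => //; exact: closedI.
apply/seteqP; split => [x Cx|x [k _ []]//].
exists (Num.truncn (\sum_(i < p) `|x ord0 i|)).+1 => //; split => // i.
rewrite in_itv/= -ler_norml.
apply: (@le_trans _ _ (\sum_(i < p) `|x ord0 i|)).
  by rewrite (bigD1 i)//= lerDl sumr_ge0.
by apply/ltW/truncnS_gt.
Qed.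

Lemma open_sigma_closed (U : set 'rV[R]_p) : open U ->
  exists C : nat -> set 'rV[R]_p, (forall k, closed (C k)) /\ U = \bigcup_k C k.
Proof.
move=> oU.
pose C k : set 'rV[R]_p := ~` \bigcup_(y in ~` U) (ball y k.+1%:R^-1).
exists C; split.
  move=> k; apply: open_closedC; apply: bigcup_open => y _; exact: ball_open.
apply/seteqP; split => [x Ux|x [k _ Cx]]; last first.
  by apply: contrapT => nUx; apply: Cx; exists x => //; exact: ballxx.
have /nbhs_ballP[e /= e0 eU] : nbhs x U by exact: open_nbhs_nbhs.
have [k] := ltr_add_invr e0; rewrite add0r => ke.
exists k => // -[y nUy yx]; apply: nUy; apply: eU.
by apply/ball_sym; apply: le_ball yx; exact: ltW.
Qed.

(** Only the generating cylinders need a check: closed sets are countable unions of compact ones,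
    and open sets countable unions of closed ones. *)
Lemma measurable_suslin (F : set (Y * 'rV[R]_p)) : measurable F -> suslin F.
Proof.
move=> mF.
suff : measurable `<=` bisuslin (Y := Y) (T := 'rV[R]_p) by move=> /(_ F mF)[].
apply: smallest_sub; first exact: bisuslin_sigma_algebra.
move=> _ [[A mA <-]|[B mB <-]]; rewrite setTI.
  split; apply: suslin_rect.
    exists A, setT; split => //; first by right.
    by apply/seteqP; split => x //= [].
  exists (~` A), setT; split => //; [exact: measurableC|by right|].
  by apply/seteqP; split => x //= [].
have sTC (C : set 'rV[R]_p) : closed C -> suslin ((setT : set Y) `*` C).
  move=> /closed_sigma_compact[K [cK ->]].
  rewrite (_ : _ `*` _ = \bigcup_k (setT `*` K k)); last first.
    by apply/seteqP; split => [x [_ [k _ Kx]]|x [k _ [_ Kx]]]; [exists k|split => //; exists k].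
  apply: suslin_bigcup => k; apply: suslin_rect; exists setT, (K k).
  by have [? ?] := cK k; split => //; left.
suff : @measurable _ 'rV[R]_p `<=` [set B | bisuslin ((snd : Y * 'rV[R]_p -> _) @^-1` B)].
  by move=> /(_ B mB).
apply: smallest_sub.
  have [h0 hC hU] := @bisuslin_sigma_algebra _ Y 'rV[R]_p; split => /=.
  - by rewrite preimage_set0.
  - by move=> A /hC; rewrite !setTD preimage_setC.
  - by move=> A /hU; rewrite preimage_bigcup.
move=> U oU /=; split.
  have [C [cC UE]] := open_sigma_closed U oU.
  rewrite (_ : _ @^-1` _ = \bigcup_k (setT `*` C k)).
    by apply: suslin_bigcup => k; exact: sTC.
  by rewrite UE preimage_bigcup; apply: eq_bigcup => // k _; rewrite setTX.
have := sTC (~` U) (open_closedC oU).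
by rewrite setTX preimage_setC.
Qed.

(** The outer set is a hull; the inner one is the union of the sets that the capacity lemma yields
    for levels increasing to the outer measure. *)
Lemma projection_measurable (F : set (Y * 'rV[R]_p)) : measurable F ->
  exists E1 E2, [/\ measurable E1, measurable E2, E1 `<=` proj F, proj F `<=` E2 &
    mu E1 = mu E2].
Proof.
move=> /measurable_suslin sF.
have [E2 [mE2 FE2 E2E]] := outer_hull mu (proj F).
have fo := outer_fin mu (proj F).
have /choice[D DP] (n : nat) : exists D, [/\ measurable D, D `<=` proj F &
    (outer mu (proj F) - (n.+1%:R^-1)%:E <= mu D)%E].
  by apply: suslin_capacity => //; rewrite lteBlDr// lteDl// lte_fin.
have mD : measurable (\bigcup_n D n).
  by apply: bigcupT_measurable => n; have [] := DP n.
have DF : \bigcup_n D n `<=` proj F.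
  by apply: bigcup_sub => n _; have [] := DP n.
exists (\bigcup_n D n), E2; split => //.
apply/eqP; rewrite eq_le; apply/andP; split.
  by apply: le_measure; rewrite ?inE//; exact: subset_trans FE2.
rewrite E2E; apply/lee_addgt0Pr => e e0.
have [n] := ltr_add_invr e0; rewrite add0r => ne.
have [mDn _ Dn] := DP n.
rewrite -leeBlDr//; apply: le_trans (le_trans _ Dn) _.
  by rewrite leeB// lee_fin ltW.
by apply: le_measure; rewrite ?inE//; exact: bigcup_sup.
Qed.

End projection_theorem.

(** * Chaining and symmetrization *)

Section hoeffding.
Context {R : realType}.

(** The constant 2 in the exponent, instead of the optimal 1/2, lets elementary bounds suffice:
    [1 - y <= expR (- y)] gives [expR y <= 1 + y + 2 * y^2] for [|y| < 1/2], and beyond that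
    [|x| <= 2 * x^2]. *)
Lemma expRDN_le (x : R) : expR x + expR (- x) <= 2 * expR (2 * x ^+ 2).
Proof.
have h1 (y : R) : y <= 2^-1 -> expR y <= 1 + y + 2 * y ^+ 2 \/ 2^-1 <= - y.
  move=> y2; have [ny|ny] := leP (2^-1) (- y); [by right|left].
  have e1 : 1 - y <= expR (- y) by rewrite expR_ge1Dx.
  have : expR y * (1 - y) <= 1.
    rewrite -[leRHS](expRxMexpNx_1 y) ler_pM2l ?expR_gt0//.
  have e0 := expR_gt0 y; nra.
have h2 (y : R) : 2^-1 <= `|y| -> expR y <= expR (2 * y ^+ 2).
  move=> y2; rewrite ler_expR; have := real_ler_norm (num_real y).
  have := real_normK (num_real y); have := normr_ge0 y; nra.
have [x2|x2] := leP (2^-1) `|x|.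
  have := h2 x x2; have := h2 (- x); rewrite normrN sqrrN => /(_ x2); lra.
have := expR_ge1Dx (2 * x ^+ 2).
move: x2; rewrite ltr_norml => /andP[x2 x2'].
have [|hx|hx] := h1 x; [lra| |lra].
have [|hy|hy] := h1 (- x); [lra| |lra].
by move: hy; rewrite sqrrN; lra.
Qed.

(** The exponential factorizes over coordinates, so the sum over sign patterns is a product of
    two-term sums. *)
Lemma sum_expR_signs n (a : 'I_n -> R) (c : R) :
  \sum_(e : {ffun 'I_n -> bool}) expR (c * \sum_(i < n) (-1) ^+ e i * a i) <=
  2 ^+ n * expR (2 * c ^+ 2 * \sum_(i < n) a i ^+ 2).
Proof.
have -> : \sum_(e : {ffun 'I_n -> bool}) expR (c * \sum_(i < n) (-1) ^+ e i * a i) =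
    \prod_(i < n) \sum_(b : bool) expR (c * ((-1) ^+ b * a i)).
  rewrite bigA_distr_bigA; apply: eq_bigr => e _.
  by rewrite mulr_sumr expR_sum.
rewrite mulr_sumr expR_sum -[X in 2 ^+ X]card_ord -prodr_const -big_split/=.
apply: ler_prod => i _; rewrite big_bool/= expr1 expr0 !mulN1r mul1r mulrN addrC.
by rewrite addr_ge0 ?expR_ge0//= -mulrA -exprMn expRDN_le.
Qed.

Lemma card_signs n : (#|{: {ffun 'I_n -> bool}}|)%:R = 2 ^+ n :> R.
Proof. by rewrite card_ffun card_bool card_ord natrX. Qed.

Lemma hoeffding_signs n (a : 'I_n -> R) (u V : R) : 0 <= u -> 0 < V ->
  \sum_(i < n) a i ^+ 2 <= V ->
  #|[pred e : {ffun 'I_n -> bool} | u < \sum_(i < n) (-1) ^+ e i * a i]|%:R <=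
    2 ^+ n * expR (- (u ^+ 2 / (8 * V))).
Proof.
(* This [c] minimizes the Chernoff exponent [2 * c^2 * V - c * u]. *)
move=> u0 V0 aV; pose c := u / (4 * V).
have c0 : 0 <= c by rewrite divr_ge0// mulr_ge0// ltW.
have -> : - (u ^+ 2 / (8 * V)) = 2 * c ^+ 2 * V - c * u by rewrite /c; field; lra.
rewrite expRD mulrA -ler_pdivrMr ?expR_gt0// -expRN opprK.
apply: (@le_trans _ _ (2 ^+ n * expR (2 * c ^+ 2 * \sum_(i < n) a i ^+ 2))); last first.
  by rewrite ler_pM2l ?exprn_gt0// ler_expR ler_wpM2l// mulr_ge0// sqr_ge0.
apply: le_trans (sum_expR_signs _ _ _).
rewrite -sum1_card natr_sum mulr_suml [leRHS](bigID (fun e : {ffun 'I_n -> bool} => u < \sum_(i < n) (-1) ^+ e i * a i))/=.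
rewrite ler_wpDr//; first by rewrite sumr_ge0// => e _; exact: expR_ge0.
apply: ler_sum => e; rewrite inE mul1r ler_expR => ue.
by rewrite ler_wpM2l// ltW.
Qed.

End hoeffding.

(** * Chaining for sign averages on a finite sample *)

Section chaining.
Context {R : realType} {n : nat}.
Hypothesis n_gt0 : (0 < n)%N.
Implicit Types (v c : {ffun 'I_n -> R}) (e : {ffun 'I_n -> bool}).

Definition sq_mean v : R := n%:R^-1 * \sum_(i < n) v i ^+ 2.

Definition sign_mean e v : R := n%:R^-1 * \sum_(i < n) (-1) ^+ e i * v i.

Let n0 : @Order.lt _ R 0 n%:R. Proof. by rewrite ltr0n. Qed.

Lemma sign_meanD e v c : sign_mean e (v + c) = sign_mean e v + sign_mean e c.
Proof.
rewrite /sign_mean -mulrDr -big_split/=; congr (_ * _).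
by apply: eq_bigr => i _; rewrite ffunE mulrDr.
Qed.

Lemma sign_mean0 e : sign_mean e 0 = 0.
Proof. by rewrite /sign_mean big1 ?mulr0// => i _; rewrite ffunE mulr0. Qed.

(** The empirical variance of the signed entries is nonnegative. *)
Lemma sign_mean_sqr_le e v : sign_mean e v ^+ 2 <= sq_mean v.
Proof.
set m := sign_mean e v.
have : 0 <= n%:R^-1 * \sum_(i < n) ((-1) ^+ e i * v i - m) ^+ 2.
  by rewrite mulr_ge0 ?invr_ge0 ?(ltW n0)// sumr_ge0// => i _; exact: sqr_ge0.
have -> : \sum_(i < n) ((-1) ^+ e i * v i - m) ^+ 2 =
    \sum_(i < n) v i ^+ 2 + (- (2 * m)) * (\sum_(i < n) (-1) ^+ e i * v i) + n%:R * m ^+ 2.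
  transitivity (\sum_(i < n) (v i ^+ 2 + - (2 * m) * ((-1) ^+ e i * v i) + m ^+ 2)).
    apply: eq_bigr => i _.
    by rewrite sqrrB exprMn sqrr_sign mul1r; ring.
  by rewrite !big_split/= -mulr_sumr sumr_const card_ord -[m ^+ 2 *+ n]mulr_natl.
have -> : \sum_(i < n) v i ^+ 2 = n%:R * sq_mean v by rewrite mulVKf// gt_eqF.
have -> : \sum_(i < n) (-1) ^+ e i * v i = n%:R * m by rewrite mulVKf// gt_eqF.
have -> : n%:R^-1 * (n%:R * sq_mean v + - (2 * m) * (n%:R * m) + n%:R * m ^+ 2) =
  sq_mean v - m ^+ 2 by field; rewrite gt_eqF.
by rewrite subr_ge0.
Qed.

(** The weights 3 and 3/2 have reciprocals summing to 1 and satisfy [3 * 1 + (3/2) * 4 = 9], so the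
    triangle inequality is obtained without square roots. *)
Lemma sq_mean_triangle v p q (eta : R) : sq_mean (v - p) <= eta ^+ 2 ->
  sq_mean (v - q) <= (2 * eta) ^+ 2 -> sq_mean (p - q) <= (3 * eta) ^+ 2.
Proof.
move=> vp vq.
have : sq_mean (p - q) <= 3 * sq_mean (v - p) + 3 / 2 * sq_mean (v - q).
  rewrite /sq_mean mulrCA (mulrCA (3 / 2)) -mulrDr ler_wpM2l ?invr_ge0 ?(ltW n0)//.
  rewrite !mulr_sumr -big_split/=; apply: ler_sum => i _; rewrite !ffunE.
  have := sqr_ge0 (2 * (v i - p i) + (v i - q i)); nra.
nra.
Qed.

Lemma card_sign_mean_gt v (s V : R) : 0 <= s -> 0 < V -> sq_mean v <= V ->
  #|[pred e | s < `|sign_mean e v| ]|%:R <= 2 ^+ n * (2 * expR (- (n%:R * s ^+ 2 / (8 * V)))).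
Proof.
move=> s0 V0 vV.
pose v' (i : 'I_n) := - v i.
have hV (w : 'I_n -> R) : (forall i, w i ^+ 2 = v i ^+ 2) ->
    \sum_(i < n) w i ^+ 2 <= n%:R * V.
  by move=> wv; rewrite (eq_bigr _ (fun i _ => wv i)) -ler_pdivrMl.
have nV : 0 < n%:R * V by rewrite mulr_gt0.
have ns : 0 <= n%:R * s by rewrite mulr_ge0// ltW.
pose S1 := [pred e : {ffun 'I_n -> bool} | n%:R * s < \sum_(i < n) (-1) ^+ e i * v i].
pose S2 := [pred e : {ffun 'I_n -> bool} | n%:R * s < \sum_(i < n) (-1) ^+ e i * v' i].
have h1 : #|S1|%:R <= _ := hoeffding_signs n v _ _ ns nV (hV _ (fun i => erefl)).
have h2 : #|S2|%:R <= _ := hoeffding_signs n v' _ _ ns nV (hV _ (fun i => sqrrN _)).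
have E : (n%:R * s) ^+ 2 / (8 * (n%:R * V)) = n%:R * s ^+ 2 / (8 * V).
  by field; rewrite !gt_eqF.
rewrite E in h1 h2.
have h3 : #|[pred e | s < `|sign_mean e v|]|%:R <= #|[predU S1 & S2]|%:R :> R.
  rewrite ler_nat; apply/subset_leq_card/fintype.subsetP => e; rewrite !inE.
  have -> : \sum_(i < n) (-1) ^+ e i * v' i = - \sum_(i < n) (-1) ^+ e i * v i.
    by rewrite -sumrN; apply: eq_bigr => i _; rewrite mulrN.
  by rewrite -!ltr_pdivlMl// mulrN -/(sign_mean e v) lter_normr.
have h4 : #|[predU S1 & S2]|%:R <= #|S1|%:R + #|S2|%:R :> R.
  by rewrite -natrD ler_nat -cardUI leq_addr.
lra.
Qed.

Lemma card_bigcup_seq (T : eqType) (F : finType) (r : seq T) (A : T -> {set F}) (q : R) :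
  (forall t, t \in r -> #|A t|%:R <= q) ->
  #|\bigcup_(t <- r) A t|%:R <= (size r)%:R * q.
Proof.
elim: r => [|t r IH] Aq; first by rewrite big_nil cards0 mul0r.
rewrite big_cons/= -natr1 mulrDl mul1r addrC.
apply: (@le_trans _ R (#|A t|%:R + #|\bigcup_(j <- r) A j|%:R)).
  by rewrite -natrD ler_nat leq_card_setU.
by apply: lerD; [apply: Aq; rewrite mem_head|apply: IH => u ur; apply: Aq; rewrite inE ur orbT].
Qed.

Lemma mem_bigcup_seq (T : eqType) (F : finType) (r : seq T) (A : T -> {set F}) t x :
  t \in r -> x \in A t -> x \in (\bigcup_(i <- r) A i)%SET.
Proof.
elim: r => // a r IH; rewrite inE big_cons finset.inE => /orP[/eqP<- ->//|tr xt].
by rewrite IH ?orbT.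
Qed.

Variables (V : set {ffun 'I_n -> R}) (rho H u : R) (net : nat -> seq {ffun 'I_n -> R}).
Hypotheses (rho_gt0 : 0 < rho) (H_ge1 : 1 <= H) (u_ge0 : 0 <= u).
Hypothesis V_rho : forall v, V v -> sq_mean v <= rho ^+ 2.
Hypothesis net_card : forall k, (size (net k))%:R <= expR (H * k.+1%:R).
Hypothesis net_cover : forall k v, V v ->
  exists2 c, c \in net k & sq_mean (v - c) <= (rho / 2 ^+ k) ^+ 2.

(** In the exponent, [2 * H] pays for pairs of points of consecutive nets, [u] for the confidence
    level and 1 for summability over the levels. *)
Let h := 2 * H + u + 1.
Let eta k : R := rho / 2 ^+ k.
(** The coarsest net is the origin alone, admissible because every element of [V] has radius at most
    [rho]. *)
Let link k : seq {ffun 'I_n -> R} := if k is 0 then [:: 0] else net k.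
(** Links have squared length at most [9 * eta^2], and Hoeffding's exponent divides by 8 times that,
    whence 72. *)
Let s : R := Num.sqrt (72 * h / n%:R).
Let th k := eta k * k.+1%:R * s.
Let bad k := (\bigcup_(pq <- [seq (p, q) | p <- link k.+1, q <- link k])
  [set e | (sq_mean (pq.1 - pq.2) <= (3 * eta k.+1) ^+ 2)%R &&
    (th k.+1 < `|sign_mean e (pq.1 - pq.2)|)%R])%SET.

Let h0 : 0 < h. Proof. by move: H_ge1 u_ge0; rewrite /h; lra. Qed.

Let eta0 k : 0 < eta k. Proof. by rewrite divr_gt0// exprn_gt0. Qed.

Let link_card k : (size (link k))%:R <= expR (H * k.+1%:R).
Proof.
case: k => [|k]; last exact: net_card.
by rewrite mulr1 /= (le_trans _ (expR_ge1Dx H))//; move: H_ge1; lra.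
Qed.

Let link_cover k v : V v -> exists2 c, c \in link k & sq_mean (v - c) <= eta k ^+ 2.
Proof.
move=> Vv; case: k => [|k]; last exact: net_cover.
by exists 0; rewrite ?mem_head// subr0 /eta expr0 divr1; exact: V_rho.
Qed.

(** The at most [expR (2 * H * (k + 2))] links are beaten by the Hoeffding bound
    [2 * expR (- h * (k + 2)^2)], of which one factor [k + 2] suffices. *)
Let bad_card k : #|bad k|%:R <= 2 ^+ n * (2 * expR (- u) * (2^-1 ^+ k.+2)) :> R.
Proof.
have th0 : 0 <= th k.+1 by rewrite !mulr_ge0 ?sqrtr_ge0// ltW// eta0.
apply: le_trans (card_bigcup_seq _ _ _ _ (2 ^+ n * (2 * expR (- (h * k.+2%:R)))) _) _.
  move=> [p q] _ /=.
  rewrite cardsE; have [small|big] := leP (sq_mean (p - q)) ((3 * eta k.+1) ^+ 2); last first.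
    rewrite eq_card0; last by move=> e; rewrite !inE/=.
    by rewrite !mulr_ge0 ?expR_ge0// exprn_ge0.
  have V0 : 0 < (3 * eta k.+1) ^+ 2 by rewrite exprn_gt0// mulr_gt0.
  apply: (le_trans (card_sign_mean_gt _ _ _ th0 V0 small)).
  rewrite !ler_pM2l ?exprn_gt0// ler_expR lerN2.
  have -> : n%:R * th k.+1 ^+ 2 / (8 * (3 * eta k.+1) ^+ 2) = h * k.+2%:R * k.+2%:R.
    rewrite /th /s !exprMn sqr_sqrtr; last by rewrite divr_ge0 ?(ltW n0)// mulr_ge0 ?ltW.
    have := eta0 k.+1; set x := eta _ => x0.
    by field; rewrite ?gt_eqF.
  by rewrite ler_peMr ?mulr_ge0 ?(ltW h0)// ler1n.
rewrite size_allpairs natrM mulrCA ler_pM2l ?exprn_gt0//.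
apply: (@le_trans _ _ (expR (H * k.+2%:R) * expR (H * k.+2%:R) * (2 * expR (- (h * k.+2%:R))))).
  apply: ler_wpM2r; first by rewrite mulr_ge0 ?expR_ge0.
  apply: (ler_pM (ler0n _ _) (ler0n _ _) (link_card k.+1)).
  apply: le_trans (link_card k) _; rewrite ler_expR ler_wpM2l ?ler_nat//; move: H_ge1; lra.
rewrite mulrCA -mulrA ler_pM2l// -!expRD.
have -> : H * k.+2%:R + H * k.+2%:R - h * k.+2%:R = - (u * k.+2%:R) - k.+2%:R.
  by rewrite /h; ring.
rewrite expRD ler_pM ?expR_ge0// ?ler_expR ?lerN2; first by rewrite ler_peMr// ler1n.
have -> : - k.+2%:R = -1 * k.+2%:R :> R by rewrite mulN1r.
rewrite expRM_natr.
rewrite ler_pXn2r ?nnegrE ?expR_ge0 ?invr_ge0//.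
rewrite expRN lef_pV2 ?posrE ?expR_gt0//; have := expR_ge1Dx (1 : R); lra.
Qed.

(** Telescoping from the origin to the approximation of [v] at level [K]; the remainder is
    controlled by its size alone, whatever the signs. *)
Let chain K e v : (forall k, (k < K)%N -> e \notin bad k) -> V v ->
  `|sign_mean e v| <= \sum_(k < K) th k.+1 + eta K.
Proof.
move=> ebad Vv.
have /choice[c cP] k : exists c, c \in link k /\ sq_mean (v - c) <= eta k ^+ 2.
  by have [c] := link_cover k _ Vv; exists c.
have c0 : c 0%N = 0 by have [] := cP 0%N; rewrite inE => /eqP.
have tele k : (k <= K)%N -> `|sign_mean e (c k)| <= \sum_(j < k) th j.+1.
  elim: k => [|k IH] kK; first by rewrite c0 sign_mean0 normr0 big_ord0.
  rewrite -(subrK (c k) (c k.+1)) sign_meanD big_ord_recr/=.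
  apply: le_trans (ler_normD _ _) _; rewrite addrC; apply: lerD; last exact: IH (ltnW kK).
  have := ebad k kK; move=> /negP nb; rewrite leNgt; apply/negP => lt.
  apply: nb; apply: (mem_bigcup_seq _ _ _ _ (c k.+1, c k)).
    by apply/allpairsP; exists (c k.+1, c k); split => //; [have [] := cP k.+1|have [] := cP k].
  rewrite inE lt andbT; apply: (@sq_mean_triangle v).
    by have [] := cP k.+1.
  have [_] := cP k; congr (_ <= _ ^+ 2); rewrite /eta exprS; field.
  by rewrite expf_neq0.
rewrite -(subrK (c K) v) sign_meanD.
apply: le_trans (ler_normD _ _) _; rewrite addrC; apply: lerD; first exact: tele.
rewrite -ler_sqr ?nnegrE ?(ltW (eta0 _))// real_normK ?num_real//.
by apply: le_trans (sign_mean_sqr_le _ _) _; have [] := cP K.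
Qed.

(** The factor 27 is 26 from the links plus 1 from the remainder: the series of
    [(k + 2) / 2^(k + 1)] sums to 3, and [72 <= (26 / 3)^2]. *)
Lemma card_chaining :
  #|[pred e | `[< exists2 v, V v & 27 * rho * Num.sqrt (h / n%:R) < `|sign_mean e v| >] ]|%:R <=
  2 ^+ n * expR (- u).
Proof.
(* Depth [n] is enough because [2^-n <= n^(-1/2)]. *)
pose K := n.
have sub : [pred e | `[< exists2 v, V v & 27 * rho * Num.sqrt (h / n%:R) < `|sign_mean e v| >] ]
    \subset (\bigcup_(k < K) bad k)%SET.
  apply/fintype.subsetP => e /asboolP[v Vv lt].
  apply/negPn/negP => nb.
  suff : `|sign_mean e v| <= 27 * rho * Num.sqrt (h / n%:R) by rewrite leNgt lt.
  apply: le_trans (chain K e _ _ Vv) _.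
    by move=> k kK; apply/negP => ek; move/negP: nb; apply; apply/finset.bigcupP; exists (Ordinal kK).
  set r := Num.sqrt (h / n%:R).
  have r0 : 0 <= r by exact: sqrtr_ge0.
  have sr : s <= 26 / 3 * r.
    rewrite -ler_sqr ?nnegrE ?sqrtr_ge0//; last by rewrite mulr_ge0.
    rewrite exprMn !sqr_sqrtr; last first.
    - by rewrite divr_ge0 ?(ltW n0)// mulr_ge0 ?ltW.
    - by rewrite divr_ge0 ?(ltW n0)// ltW.
    have : 0 <= h / n%:R by rewrite divr_ge0 ?(ltW n0)// ltW.
    rewrite -mulrA; lra.
  have sumE : \sum_(k < K) th k.+1 <= 3 * rho * s.
    have -> : \sum_(k < K) th k.+1 = rho * s * (3 - (K.+3)%:R / 2 ^+ K).
      elim: (K) => [|k IH]; first by rewrite big_ord0 expr0 divr1 subrr mulr0.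
      rewrite big_ord_recr/= IH /th /eta exprS -!natr1; field.
      by rewrite expf_neq0.
    rewrite [leRHS]mulrAC -[leRHS]mulrAC (mulrC 3) -!mulrA ler_wpM2l ?(ltW rho_gt0)//.
    rewrite [leRHS]mulrC ler_wpM2l ?sqrtr_ge0// gerBl divr_ge0// exprn_ge0//.
  have etaK : eta K <= rho * r.
    rewrite /eta ler_wpM2l ?(ltW rho_gt0)// -ler_sqr ?nnegrE ?invr_ge0 ?exprn_ge0//.
    rewrite sqr_sqrtr ?divr_ge0 ?(ltW n0) ?(ltW h0)//.
    apply: (@le_trans _ _ n%:R^-1); last by rewrite -[leLHS]mul1r ler_wpM2r ?invr_ge0 ?(ltW n0)// /h; move: H_ge1 u_ge0; lra.
    rewrite -exprVn -exprM mulnC exprM exprVn -natrX.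
    rewrite exprVn lef_pV2 ?posrE// ?exprn_gt0 ?ltr0n//.
    by rewrite -natrX ler_nat ltnW// ltn_expl.
  apply: le_trans (lerD sumE etaK) _.
  have : 3 * rho * s <= 3 * rho * (26 / 3 * r) by rewrite ler_wpM2l ?mulr_ge0 ?(ltW rho_gt0).
  lra.
apply: (@le_trans _ R (#|(\bigcup_(k < K) bad k)%SET|%:R)); first by rewrite ler_nat subset_leq_card.
apply: (@le_trans _ _ (\sum_(k < K) #|bad k|%:R)).
  rewrite -natr_sum ler_nat; elim/big_ind2: _ => //; first by rewrite cards0.
  by move=> A a B b Aa Bb; apply: leq_trans (leq_card_setU _ _) (leq_add Aa Bb).
apply: (@le_trans _ _ (\sum_(k < K) 2 ^+ n * (2 * expR (- u) * (2^-1 ^+ k.+2)))).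
  by apply: ler_sum => k _; exact: bad_card.
rewrite -mulr_sumr -mulr_sumr ler_pM2l ?exprn_gt0//.
have -> : \sum_(k < K) (2 : R)^-1 ^+ k.+2 = 2^-1 - 2^-1 ^+ K.+1.
  elim: (K) => [|k IH]; first by rewrite big_ord0 expr1 subrr.
  by rewrite big_ord_recr/= IH !exprS; field.
have := expR_ge0 (- u); have : 0 <= (2 : R)^-1 ^+ K.+1 by rewrite exprn_ge0.
nra.
Qed.

End chaining.

(** * Symmetrization by a ghost sample *)

Section symmetrization.
Context {dT : measure_display} {T : measurableType dT} {R : realType}
  {dO : measure_display} {Omega : measurableType dO}.
Variables (P : probability T R) (Pr : probability Omega R) (n : nat).
Variable X : 'I_n -> Omega -> T.
Hypothesis mX : forall i, measurable_fun setT (X i).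
Hypothesis iidX : forall B : 'I_n -> set T, (forall i, measurable (B i)) ->
  Pr (\bigcap_i (X i @^-1` B i)) = (\prod_(i < n) P (B i))%E.

Definition pairs (w : Omega * Omega) : n.-tuple (T * T) :=
  [tuple (X i w.1, X i w.2) | i < n].

Lemma measurable_pairs : measurable_fun setT pairs.
Proof.
apply/measurable_fun_tnthP => i.
rewrite (_ : _ \o _ = fun w => (X i w.1, X i w.2)); last first.
  by apply/funext => w /=; rewrite tnth_mktuple.
by apply: measurable_fun_pair; apply: measurableT_comp.
Qed.

HB.instance Definition _ := isMeasurableFun.Build _ _ _ _ pairs measurable_pairs.

Definition swap_pairs (e : {ffun 'I_n -> bool}) (z : n.-tuple (T * T)) :
    n.-tuple (T * T) :=
  [tuple if e i then ((tnth z i).2, (tnth z i).1) else tnth z i | i < n].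

Lemma measurable_swap_pairs e : measurable_fun setT (swap_pairs e).
Proof.
apply/measurable_fun_tnthP => i.
rewrite (_ : _ \o _ = fun z => if e i then ((tnth z i).2, (tnth z i).1) else tnth z i); last first.
  by apply/funext => z /=; rewrite tnth_mktuple.
case: (e i); last exact: measurable_tnth.
by apply: measurable_fun_pair; apply: measurableT_comp => //; exact: measurable_tnth.
Qed.

Definition box (A B : 'I_n -> set T) : set (n.-tuple (T * T)) :=
  [set z | forall i, A i (tnth z i).1 /\ B i (tnth z i).2].

Definition boxes : set (set (n.-tuple (T * T))) :=
  [set S | exists A B, [/\ forall i, measurable (A i), forall i, measurable (B i) & S = box A B]].

Lemma boxesI : setI_closed boxes.
Proof.
move=> _ _ [A [B [mA mB ->]]] [A' [B' [mA' mB' ->]]].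
exists (fun i => A i `&` A' i), (fun i => B i `&` B' i); split.
- by move=> i; exact: measurableI.
- by move=> i; exact: measurableI.
apply/seteqP; split => [z [h h'] i|z h].
  by have [? ?] := h i; have [? ?] := h' i.
by split => i; have [[? ?] [? ?]] := h i.
Qed.

(** Boxes form the pi-system on which the laws of the double sample before and after a swap are
    compared. *)
Lemma measurable_boxes : measurable = <<s boxes >>.
Proof.
apply/seteqP; split.
  apply: smallest_sub; first exact: smallest_sigma_algebra.
  move=> S; rewrite -bigcup_seq => -[i _ [M mM <-]]; rewrite setTI.
  suff : @measurable _ (T * T)%type `<=`
      [set M | <<s boxes >> ((@tnth n _ ^~ i) @^-1` M)] by exact.
  have [s0 sC sU] := smallest_sigma_algebra [set: n.-tuple (T * T)] boxes.
  apply: smallest_sub; first split => /=.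
  - by rewrite preimage_set0.
  - by move=> A /sC; rewrite !setTD preimage_setC.
  - by move=> F /sU; rewrite preimage_bigcup.
  move=> _ [[A mA <-]|[A mA <-]]; rewrite setTI; apply: sub_sigma_algebra.
    exists (fun j => if j == i then A else setT), (fun=> setT); split => //.
      by move=> j; case: ifP.
    apply/seteqP; split => [z Az j|z /(_ i)]; last by rewrite eqxx => -[].
    by split => //; case: eqP => // ->.
  exists (fun=> setT), (fun j => if j == i then A else setT); split => //.
    by move=> j; case: ifP.
  apply/seteqP; split => [z Az j|z /(_ i)]; last by rewrite eqxx => -[].
  by split => //; case: eqP => // ->.
apply: smallest_sub; first exact: sigma_algebra_measurable.
move=> _ [A [B [mA mB ->]]].
rewrite (_ : box A B = \bigcap_(i in [set: 'I_n])
    ((@tnth n _ ^~ i) @^-1` (A i `*` B i))).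
  apply: fin_bigcap_measurable => // i _.
  rewrite -[X in measurable X]setTI; apply: measurable_tnth => //.
  exact: measurableX.
by apply/seteqP; split => [z h i _|z h i]; [exact: h|exact: (h i)].
Qed.

Let nu : probability (n.-tuple (T * T)) R :=
  distribution (Pr \x Pr)%E (pairs : {mfun _ >-> _}).

Lemma distribution_box A B : (forall i, measurable (A i)) -> (forall i, measurable (B i)) ->
  nu (box A B) = (\prod_(i < n) (P (A i) * P (B i)))%E.
Proof.
move=> mA mB; rewrite /nu /distribution /pushforward /=.
have -> : pairs @^-1` box A B =
    (\bigcap_i (X i @^-1` A i)) `*` (\bigcap_i (X i @^-1` B i)).
  apply/seteqP; split => [w h|w [h h'] i].
    by split => i _; have /= := h i; rewrite tnth_mktuple => -[].
  by rewrite tnth_mktuple; split; [exact: h|exact: h'].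
have mI (C : 'I_n -> set T) : (forall i, measurable (C i)) ->
    measurable (\bigcap_i (X i @^-1` C i)).
  move=> mC; apply: fin_bigcap_measurable => // i _.
  by rewrite -[X in measurable X]setTI; exact: mX.
rewrite product_measure1E; [|exact: mI|exact: mI].
by rewrite big_split; congr (_ * _)%E; exact: iidX.
Qed.

(** A swap exchanges [A i] and [B i] at the swapped indices of a box, and [P (A i) * P (B i)] is
    symmetric; boxes determine the measure. *)
Lemma swap_pairs_invariant e S : measurable S -> nu (swap_pairs e @^-1` S) = nu S.
Proof.
pose nu' : {measure set _ -> \bar R} := pushforward nu (swap_pairs e).
move=> mS; apply: (@measure_unique _ _ _ boxes (fun=> setT) _ _ _ _ (nu' (measurable_swap_pairs e)) nu) => //.
- exact: measurable_boxes.
- exact: boxesI.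
- by move=> i; exists (fun=> setT), (fun=> setT); split => //; apply/seteqP; split.
- by apply/seteqP; split => // z _; exists 0%N.
- move=> _ [A [B [mA mB ->]]] /=; rewrite /pushforward.
  rewrite (_ : _ @^-1` _ = box (fun i => if e i then B i else A i)
      (fun i => if e i then A i else B i)).
    rewrite distribution_box//; [|by move=> i; case: ifP|by move=> i; case: ifP].
    apply: etrans; last by apply: esym; exact: (distribution_box A B mA mB).
    by apply: eq_bigr => i _; case: (e i); rewrite // muleC.
  apply/seteqP; split => z /= h i; have /= := h i; rewrite tnth_mktuple;
    by case: (e i) => //= -[].
- move=> _; apply: (le_lt_trans _ (ltry 1)).
  by rewrite /nu' /= /pushforward preimage_setT; exact: probability_le1.
Qed.

(** By invariance [2^n * nu F] is the integral of the number of [e] that send [z] into [F], which is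
    bounded pointwise. *)
Lemma swap_average (F : set (n.-tuple (T * T))) (q : R) : measurable F ->
  (forall z, #|[pred e : {ffun 'I_n -> bool} | `[< F (swap_pairs e z) >]]|%:R <= 2 ^+ n * q) ->
  (nu F <= q%:E)%E.
Proof.
move=> mF Fq.
have mE e : measurable (swap_pairs e @^-1` F).
  by rewrite -[X in measurable X]setTI; exact: measurable_swap_pairs.
have : ((2 ^+ n)%:E * nu F <= (2 ^+ n * q)%:E)%E.
  have -> : ((2 ^+ n)%:E * nu F = \sum_(e : {ffun 'I_n -> bool}) nu (swap_pairs e @^-1` F))%E.
    rewrite (eq_bigr (fun=> nu F)); last by move=> e _; rewrite swap_pairs_invariant.
    have <- : (fine (nu F))%:E = nu F by rewrite fineK// fin_num_measure.
    by rewrite sumEFin sumr_const -[_ *+ #|_|]mulr_natl card_signs EFinM.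
  have -> : (\sum_(e : {ffun 'I_n -> bool}) nu (swap_pairs e @^-1` F) =
      \int[nu]_z \sum_(e : {ffun 'I_n -> bool}) (\1_(swap_pairs e @^-1` F) z)%:E)%E.
    rewrite ge0_integral_sum//.
      by apply: eq_bigr => e _; rewrite integral_indic// setIT.
    by move=> e; apply/measurable_EFinP; exact: measurable_indic.
  rewrite -[leRHS]mule1 -[X in (_ <= _ * X)%E](probability_setT nu) -integral_cst//.
  apply: ge0_le_integral => //.
  - by move=> z _; apply: sume_ge0 => e _; rewrite lee_fin.
  - by apply: emeasurable_sum => e; apply/measurable_EFinP; exact: measurable_indic.
  move=> z _; rewrite sumEFin lee_fin; apply: le_trans (Fq z).
  rewrite -sum1_card natr_sum [leRHS]big_mkcond/=; apply: ler_sum => e _.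
  rewrite inE indicE; case: asboolP => [Fz|nFz]; first by rewrite mem_set.
  by rewrite memNset.
have /fineK <- : nu F \is a fin_num by rewrite fin_num_measure.
by rewrite -EFinM !lee_fin ler_pM2l// exprn_gt0.
Qed.

Context {p : nat}.

(** A first sample in [proj A1] has a witness [t] depending on it alone, so an independent ghost
    sample lands in [A2] at the same [t] with probability at least 1/2; Fubini then loses a factor
    2. The inner set [E1] supplies witnesses, the outer set [F2] receives the pairs, and the inner
    set [F1] is what the sign count bounds. *)
Lemma symmetrization (A1 : set (Omega * 'rV[R]_p)) (A2 : set (n.-tuple (T * T) * 'rV[R]_p))
    (q : R) : measurable A1 -> measurable A2 ->
  (forall w t, A1 (w, t) -> exists M, [/\ measurable M,
    M `<=` [set w' | A2 (pairs (w, w'), t)] & (2^-1%:E <= Pr M)%E]) ->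
  (forall z, #|[pred e : {ffun 'I_n -> bool} | `[< proj A2 (swap_pairs e z) >]]|%:R <=
    2 ^+ n * q) ->
  exists E, [/\ measurable E, proj A1 `<=` E & (Pr E <= (2 * q)%:E)%E].
Proof.
move=> mA1 mA2 A12 A2q.
have [E1 [E2 [mE1 mE2 E1A AE2 E12]]] := projection_measurable Pr _ mA1.
have [F1 [F2 [mF1 mF2 F1A AF2 F12]]] := projection_measurable nu _ mA2.
exists E2; split => //; rewrite -E12.
have : (2^-1%:E * Pr E1 <= q%:E)%E.
  apply: (@le_trans _ _ (nu F2)); last first.
    rewrite -F12; apply: swap_average => // z; apply: le_trans (A2q z).
    rewrite ler_nat; apply/subset_leq_card/fintype.subsetP => e.
    by move=> /asboolP Fz; apply/asboolP; exact: F1A.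
  have mF : measurable (pairs @^-1` F2).
    by rewrite -[X in measurable X]setTI; exact: measurable_pairs.
  rewrite /nu /distribution /pushforward /= /product_measure1/=.
  have -> : (2^-1%:E * Pr E1 = \int[Pr]_w (2^-1 * \1_E1 w)%:E)%E.
    by under eq_integral do rewrite EFinM; rewrite ge0_integralZl_EFin// ?integral_indic ?setIT//;
       apply/measurable_EFinP; exact: measurable_indic.
  apply: ge0_le_integral => //.
  - by apply/measurable_EFinP; apply: measurable_funM => //; exact: measurable_indic.
  - exact: measurable_fun_xsection.
  move=> w _; rewrite indicE; case: (boolP (w \in E1)) => [/set_mem wE1|_]; last by rewrite mulr0.
  have [t At] := E1A _ wE1.
  have [M [mM MA PM]] := A12 w t At.
  rewrite mulr1; apply: le_trans PM _.
  have mx : measurable (xsection (pairs @^-1` F2) w) by exact: measurable_xsection.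
  apply: le_measure; rewrite ?inE// => w' /MA A2w.
  by apply/xsectionP; apply: AF2; exists t.
have /fineK <- : Pr E1 \is a fin_num by rewrite fin_num_measure.
by rewrite -EFinM !lee_fin; lra.
Qed.

End symmetrization.

(** * Borel sets and the Euclidean norm on R^d *)

Section borel_rV.
Context {R : realType} {d : nat}.

Lemma open_measurable_rV (U : set 'rV[R]_d) : open U -> measurable U.
Proof. by move=> oU; exact: sub_sigma_algebra. Qed.

Lemma measurable_coord (i : 'I_d) : measurable_fun setT (fun x : 'rV[R]_d => x ord0 i).
Proof.
apply: (measurability _ (RGenOInfty.measurableE R)) => _ [_ [a ->] <-].
rewrite setTI; apply: open_measurable_rV.
have := @coord_continuous R 1 d ord0 i => /continuousP; apply.
exact: rray_open.
Qed.

(** The sigma-algebra is generated by open sets, not by coordinates; an open set is the union of the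
    countably many cubes with rational centre and radius [1 / (k + 1)] that it contains. *)
Lemma measurable_rV {disp} {Y : measurableType disp} (f : Y -> 'rV[R]_d) :
  (forall i, measurable_fun setT (fun y => f y ord0 i)) -> measurable_fun setT f.
Proof.
move=> mf.
pose box (qk : 'rV[rat]_d * nat) : set 'rV[R]_d :=
  [set x | forall i, `|x ord0 i - ratr (qk.1 ord0 i)| < qk.2.+1%:R^-1].
apply: (@measurability _ _ _ _ setT f (@open 'rV[R]_d) erefl) => _ [U oU <-].
rewrite setTI.
rewrite (_ : U = \bigcup_(qk in [set qk | box qk `<=` U]) box qk).
  rewrite preimage_bigcup bigcup_mkcond; apply: countable_bigcupT_measurable => // qk.
  case: ifP => // _.
  rewrite (_ : _ @^-1` _ = \bigcap_(i in [set: 'I_d])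
      [set y | `|f y ord0 i - ratr (qk.1 ord0 i)| < qk.2.+1%:R^-1]).
    apply: fin_bigcap_measurable => // i _.
    rewrite (_ : mkset _ = (fun y => `|f y ord0 i - ratr (qk.1 ord0 i)|) @^-1`
        `]-oo, (qk.2.+1%:R^-1)[).
      rewrite -[X in measurable X]setTI.
      apply: (_ : measurable_fun setT _) => //.
      by apply: measurableT_comp => //; exact: measurable_funB.
    by apply/seteqP; split => y /=; rewrite in_itv.
  by apply/seteqP; split => [y h i _|y h i]; [exact: h|exact: (h i)].
apply/seteqP; split => [x Ux|x [qk qkU qkx]]; last exact: qkU.
have /nbhs_ballP[e /= e0 eU] : nbhs x U by exact: open_nbhs_nbhs.
have e20 : 0 < e / 2 by rewrite divr_gt0.
have [k] := ltr_add_invr e20; rewrite add0r => ke.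
have k0 : 0 < k.+1%:R^-1 :> R by rewrite invr_gt0.
have /choice[q qP] i : exists q : rat, `|x ord0 i - ratr q| < k.+1%:R^-1.
  have [q] : exists q : rat, ratr q \in `]x ord0 i - k.+1%:R^-1, x ord0 i + k.+1%:R^-1[.
    by apply: rat_in_itvoo; rewrite ltrBlDr -addrA ltrDl addr_gt0.
  rewrite in_itv/= => /andP[q1 q2]; exists q.
  by rewrite distrC ltr_distl q1.
exists (\row_i q i, k); last by move=> i /=; rewrite mxE.
move=> y yq; apply: eU; split => // i j; rewrite ord1.
rewrite /ball/= ; have := yq j; have := qP j; rewrite /= mxE => xq {}yq.
have := ler_distD (ratr (q j)) (x ord0 j) (y ord0 j).
rewrite (distrC (ratr _)) => /le_lt_trans; apply.
by rewrite (splitr e) ltrD// (lt_trans _ ke).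
Qed.

Lemma measurable_affine {disp} {Y : measurableType disp} (c : Y -> R) (f g : Y -> 'rV[R]_d) :
  measurable_fun setT c -> measurable_fun setT f -> measurable_fun setT g ->
  measurable_fun setT (fun y => c y *: (f y - g y)).
Proof.
move=> mc mf mg; apply: measurable_rV => i.
under eq_fun do rewrite !mxE.
apply: measurable_funM => //.
by apply: measurable_funB; apply: (measurableT_comp (measurable_coord i)).
Qed.

Lemma enorm_ge0 (x : 'rV[R]_d) : 0 <= enorm x.
Proof. exact: sqrtr_ge0. Qed.

Lemma enormZ (a : R) (x : 'rV[R]_d) : 0 <= a -> enorm (a *: x) = a * enorm x.
Proof.
move=> a0; rewrite /enorm -[X in X * _](ger0_norm a0) -sqrtr_sqr -sqrtrM ?sqr_ge0//.
rewrite mulr_sumr.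
by congr Num.sqrt; apply: eq_bigr => i _; rewrite mxE exprMn.
Qed.

Lemma enormN (x : 'rV[R]_d) : enorm (- x) = enorm x.
Proof. by congr Num.sqrt; apply: eq_bigr => i _; rewrite mxE sqrrN. Qed.

Lemma measurable_enorm : measurable_fun setT (fun x : 'rV[R]_d => enorm x).
Proof.
apply: (measurableT_comp (f := @Num.sqrt R)).
  by apply: continuous_measurable_fun; exact: sqrt_continuous.
by apply: measurable_sum => i; apply: measurable_funX; exact: measurable_coord.
Qed.

Lemma measurable_eball (x : 'rV[R]_d) r : measurable (eball x r).
Proof.
rewrite (_ : eball x r = (fun y => enorm (1 *: (y - x))) @^-1` `]-oo, r[).
  rewrite -[X in measurable X]setTI; apply: (_ : measurable_fun setT _) => //.
  apply: (measurableT_comp measurable_enorm).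
  exact: measurable_affine.
by apply/seteqP; split => y /=; rewrite /eball /= in_itv/= scale1r.
Qed.

End borel_rV.

(** * Markov's inequality and bounded measurable functions *)

Section level_sets.
Context {d : measure_display} {Y : measurableType d} {R : realType}.

Lemma measurable_gt_cst (f : Y -> R) (a : R) :
  measurable_fun setT f -> measurable [set x | a < f x].
Proof.
move=> mf; rewrite (_ : mkset _ = f @^-1` `]a, +oo[%classic).
  by rewrite -[X in measurable X]setTI; exact: mf.
by apply/seteqP; split => x /=; rewrite in_itv/= andbT.
Qed.

Lemma measurable_le_cst (f : Y -> R) (a : R) :
  measurable_fun setT f -> measurable [set x | f x <= a].
Proof.
move=> mf; rewrite (_ : mkset _ = ~` [set x | a < f x]).
  exact/measurableC/measurable_gt_cst.
by apply/seteqP; split => x /=; rewrite leNgt => /negP.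
Qed.

Lemma markov_half (Pr : probability Y R) (f : Y -> R) (c : R) :
  measurable_fun setT f -> (forall x, 0 <= f x) -> 0 < c ->
  (\int[Pr]_x (f x)%:E <= (c / 2)%:E)%E ->
  (2^-1%:E <= Pr [set x | (f x <= c)%R])%E.
Proof.
move=> mf f0 c0 fc.
have mgt : measurable [set x | c < f x] by exact: measurable_gt_cst.
have : (c%:E * Pr [set x | (c < f x)%R] <= (c / 2)%:E)%E.
  apply: le_trans fc.
  have -> : (c%:E * Pr [set x | (c < f x)%R] = \int[Pr]_x (c * \1_[set x | (c < f x)%R] x)%:E)%E.
    under eq_integral do rewrite EFinM.
    rewrite ge0_integralZl_EFin ?integral_indic ?setIT// ?ltW//.
    by apply/measurable_EFinP; exact: measurable_indic.
  apply: ge0_le_integral => //.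
  - by move=> x _; rewrite lee_fin mulr_ge0// ltW.
  - by apply/measurable_EFinP; apply: measurable_funM => //; exact: measurable_indic.
  - exact/measurable_EFinP.
  move=> x _; rewrite lee_fin indicE.
  by case: (boolP (x \in _)) => [/set_mem/ltW|_]; rewrite ?mulr1 ?mulr0.
have -> : [set x | f x <= c] = ~` [set x | c < f x].
  by apply/seteqP; split => x /=; rewrite leNgt => /negP.
rewrite probability_setC//.
have /fineK <- : Pr [set x | c < f x] \is a fin_num by rewrite fin_num_measure.
by rewrite -EFinM -EFinB !lee_fin ler_pM2l//; lra.
Qed.

Definition bounded_measurable (h : Y -> R) :=
  measurable_fun setT h /\ exists M, forall y, `|h y| <= M.

Lemma bounded_measurable_cst a : bounded_measurable (fun=> a).
Proof. by split => //; exists `|a|. Qed.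

Lemma bounded_measurableD h k : bounded_measurable h -> bounded_measurable k ->
  bounded_measurable (fun y => h y + k y).
Proof.
move=> [mh [M hM]] [mk [N kN]]; split; first exact: measurable_funD.
exists (M + N) => y; apply: le_trans (ler_normD _ _) _; exact: lerD.
Qed.

Lemma bounded_measurableM h k : bounded_measurable h -> bounded_measurable k ->
  bounded_measurable (fun y => h y * k y).
Proof.
move=> [mh [M hM]] [mk [N kN]]; split; first exact: measurable_funM.
by exists (M * N) => y; rewrite normrM ler_pM.
Qed.

Lemma bounded_measurableB h k : bounded_measurable h -> bounded_measurable k ->
  bounded_measurable (fun y => h y - k y).
Proof.
move=> [mh [M hM]] [mk [N kN]]; split; first exact: measurable_funB.
exists (M + N) => y; apply: le_trans (ler_normB _ _) _; exact: lerD.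
Qed.

Lemma bounded_measurable_sum (I : Type) (r : seq I) (h : I -> Y -> R) :
  (forall i, bounded_measurable (h i)) -> bounded_measurable (fun y => \sum_(i <- r) h i y).
Proof.
move=> bh; elim: r => [|i r IH].
  by under [X in bounded_measurable X]eq_fun do rewrite big_nil; exact: bounded_measurable_cst.
under [X in bounded_measurable X]eq_fun do rewrite big_cons; exact: bounded_measurableD.
Qed.

Lemma bounded_integrable (Q : probability Y R) h : bounded_measurable h ->
  Q.-integrable setT (EFin \o h).
Proof.
move=> [mh [M hM]]; apply: measurable_bounded_integrable => //.
  exact: le_lt_trans (probability_le1 Q measurableT) (ltry 1).
by exists M; split; rewrite ?num_real// => x Mx y _ /=; apply: le_trans (hM y) (ltW Mx).
Qed.

Lemma Rintegral_cst_probability (Q : probability Y R) (a : R) : \int[Q]_y a = a.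
Proof.
rewrite Rintegral_cst// -[RHS]mulr1; congr (_ * _).
exact: (congr1 (@fine R) (probability_setT Q)).
Qed.

Lemma Rintegral_sum (Q : probability Y R) (I : Type) (r : seq I) (h : I -> Y -> R) :
  (forall i, bounded_measurable (h i)) ->
  \int[Q]_y (\sum_(i <- r) h i y) = \sum_(i <- r) \int[Q]_y h i y.
Proof.
move=> bh; elim: r => [|i r IH].
  by under eq_Rintegral do rewrite big_nil; rewrite Rintegral_cst_probability big_nil.
under eq_Rintegral do rewrite big_cons.
rewrite RintegralD//; [|exact: bounded_integrable|].
  by rewrite IH big_cons.
exact/bounded_integrable/bounded_measurable_sum.
Qed.

Lemma Rintegral_EFin (Q : probability Y R) h : bounded_measurable h ->
  (\int[Q]_y (h y)%:E)%E = (\int[Q]_y h y)%:E.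
Proof.
move=> bh; rewrite /Rintegral fineK//; exact/integrable_fin_num/bounded_integrable.
Qed.

End level_sets.

(** * Moments of averages of an i.i.d. sample *)

Section iid_moments.
Context {dT : measure_display} {T : measurableType dT} {R : realType}
  {dO : measure_display} {Omega : measurableType dO}.
Variables (P : probability T R) (Pr : probability Omega R) (n : nat).
Hypothesis n_gt0 : (0 < n)%N.
Variable X : 'I_n -> Omega -> T.
Hypothesis mX : forall i, measurable_fun setT (X i).
Hypothesis iidX : forall B : 'I_n -> set T, (forall i, measurable (B i)) ->
  Pr (\bigcap_i (X i @^-1` B i)) = (\prod_(i < n) P (B i))%E.

Lemma iid_marginal i B : measurable B -> Pr (X i @^-1` B) = P B.
Proof.
move=> mB; pose C j := if j == i then B else setT.
have := iidX C; rewrite (bigD1 i)//= /C eqxx big1 ?mule1; last first.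
  by move=> j /negbTE ->; exact: probability_setT.
move=> <-; last by move=> j; case: ifP.
congr (Pr _); apply/seteqP; split => [w Bw j _|w /(_ i Logic.I)] /=.
  by case: eqP => // ->.
by rewrite eqxx.
Qed.

Lemma iid_marginal2 i j A B : i != j -> measurable A -> measurable B ->
  Pr (X i @^-1` A `&` X j @^-1` B) = (P A * P B)%E.
Proof.
move=> ij mA mB; pose C k := if k == i then A else if k == j then B else setT.
have ji : (j == i) = false by rewrite eq_sym (negbTE ij).
have := iidX C; rewrite (bigD1 i)//= (bigD1 j)/= ?ji// /C !eqxx big1 ?mule1; last first.
  by move=> k /andP[/negbTE -> /negbTE ->]; exact: probability_setT.
rewrite ji => <-; last by move=> k; case: ifP => // _; case: ifP.
congr (Pr _); apply/seteqP; split => [w [Aw Bw] k _|w h] /=.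
  by case: eqP => [->//|_]; case: eqP => // ->.
split; first by have /= := h i Logic.I; rewrite eqxx.
by have /= := h j Logic.I; rewrite ji eqxx.
Qed.

Lemma iid_integral_ge0 i (f : T -> \bar R) : measurable_fun setT f ->
  (forall y, 0 <= f y)%E -> (\int[Pr]_w f (X i w) = \int[P]_y f y)%E.
Proof.
move=> mf f0.
have <- := @ge0_integral_pushforward _ _ _ _ _ _ (mX i) Pr _ f measurableT.
- apply: eq_measure_integral => A mA _; rewrite /pushforward; exact: iid_marginal.
- exact: mf.
- by move=> y _.
Qed.

Lemma iid_Rintegral i (f : T -> R) : bounded_measurable f ->
  \int[Pr]_w f (X i w) = \int[P]_y f y.
Proof.
move=> bf; have [mf [M fM]] := bf; rewrite /Rintegral; congr fine.
have := @integral_pushforward _ _ _ _ _ _ (mX i) Pr setT (EFin \o f).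
rewrite preimage_setT => <- //.
- by apply: eq_measure_integral => A mA _; rewrite /pushforward; exact: iid_marginal.
- exact/measurable_EFinP.
- apply: (@bounded_integrable _ _ _ Pr (fun w => f (X i w))); split; last by exists M.
  exact: measurableT_comp.
Qed.

(** Two distinct coordinates have joint law [P \x P] by uniqueness of the product measure; Fubini
    does the rest. *)
Lemma iid_Rintegral_prod i j (f : T -> R) : i != j -> bounded_measurable f ->
  \int[Pr]_w (f (X i w) * f (X j w)) = (\int[P]_y f y) ^+ 2.
Proof.
move=> ij bf; have [mf [M fM]] := bf.
pose Z w := (X i w, X j w).
have mZ : measurable_fun setT Z by exact: measurable_fun_pair.
pose ff (y : T * T) := f y.1 * f y.2.
have bff : bounded_measurable ff.
  split; first by apply: measurable_funM; exact: measurableT_comp.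
  by exists (M * M) => y; rewrite normrM ler_pM.
have -> : \int[Pr]_w (f (X i w) * f (X j w)) = \int[(P \x P)%E]_y ff y.
  rewrite /Rintegral; congr fine.
  have := @integral_pushforward _ _ _ _ _ _ mZ Pr setT (EFin \o ff).
  rewrite preimage_setT => <- //; last 2 first.
  - by apply/measurable_EFinP; case: bff.
  - apply: (@bounded_integrable _ _ _ Pr (ff \o Z)).
    by case: bff => mff [N ffN]; split; [exact: measurableT_comp|exists N => w; exact: ffN].
  pose m : {measure set (T * T) -> \bar R} := pushforward Pr Z.
  apply: eq_measure_integral => A mA _.
  apply/esym/(@product_measure_unique _ _ _ _ _ P P (m mZ)) => //.
  by move=> B C mB mC; rewrite /m /pushforward /= -(iid_marginal2 _ _ _ _ ij mB mC).
have iff : (P \x P)%E.-integrable setT (EFin \o ff) by exact: bounded_integrable.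
rewrite /Rintegral -(integral12_prod_meas1 iff) /fubini_F /=.
under eq_integral => y _.
  rewrite (@Rintegral_EFin _ _ _ P (fun z => f y * f z)); last first.
    by apply: bounded_measurableM => //; exact: bounded_measurable_cst.
  rewrite RintegralZl//; last exact: bounded_integrable.
  over.
rewrite -/(Rintegral P setT (fun y => f y * Rintegral P setT f)) RintegralZr//.
exact: bounded_integrable.
Qed.

(** Off-diagonal terms of the centred double sum vanish, and centring does not increase the second
    moment. *)
Lemma iid_variance (f : T -> R) (v : R) : bounded_measurable f ->
  \int[P]_y (f y ^+ 2) <= v ->
  \int[Pr]_w ((n%:R^-1 * \sum_(i < n) f (X i w) - \int[P]_y f y) ^+ 2) <= v / n%:R.
Proof.
move=> bf fv; have n0 : n%:R != 0 :> R by rewrite pnatr_eq0 -lt0n.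
set m := \int[P]_y f y.
pose k y := f y - m.
have bm : bounded_measurable (fun _ : T => m) by exact: bounded_measurable_cst.
have bk : bounded_measurable k by exact: bounded_measurableB.
have k0 : \int[P]_y k y = 0.
  rewrite RintegralB//; [|exact: bounded_integrable|exact: bounded_integrable].
  by rewrite Rintegral_cst_probability subrr.
have kv : \int[P]_y (k y ^+ 2) <= v.
  apply: le_trans fv; have -> : (fun y => f y ^+ 2) = (fun y => (k y * k y + 2 * m * k y) + m ^+ 2).
    by apply/funext => y; rewrite /k; ring.
  have b1 : bounded_measurable (fun y => k y * k y) by exact: bounded_measurableM.
  have b2 : bounded_measurable (fun y => 2 * m * k y).
    by apply: bounded_measurableM => //; exact: bounded_measurable_cst.
  rewrite RintegralD//; [|exact/bounded_integrable/bounded_measurableD|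
    exact/bounded_integrable/bounded_measurable_cst].
  rewrite RintegralD//; [|exact: bounded_integrable|exact: bounded_integrable].
  rewrite RintegralZl//; last exact: bounded_integrable.
  rewrite k0 mulr0 addr0 Rintegral_cst_probability lerDl.
  exact: sqr_ge0.
have bkX i : bounded_measurable (fun w => k (X i w)).
  by have [mk [M kM]] := bk; split; [exact: measurableT_comp|exists M].
have -> : (fun w => (n%:R^-1 * \sum_(i < n) f (X i w) - m) ^+ 2) =
    (fun w => n%:R^-1 ^+ 2 * \sum_(i < n) \sum_(j < n) k (X i w) * k (X j w)).
  apply/funext => w.
  rewrite [in RHS](eq_bigr (fun i => k (X i w) * \sum_(j < n) k (X j w))); last first.
    by move=> i _; rewrite mulr_sumr.
  rewrite -mulr_suml -expr2 -exprMn; congr (_ ^+ 2).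
  by rewrite sumrB sumr_const card_ord mulrBr -[m *+ n]mulr_natl mulKf.
have bs i : bounded_measurable (fun w => \sum_(j < n) k (X i w) * k (X j w)).
  by apply: bounded_measurable_sum => j; exact: bounded_measurableM.
rewrite RintegralZl//; last exact/bounded_integrable/bounded_measurable_sum.
rewrite Rintegral_sum//.
have -> : \sum_(i < n) \int[Pr]_w (\sum_(j < n) k (X i w) * k (X j w)) =
    n%:R * \int[P]_y (k y ^+ 2).
  rewrite mulr_natl -[X in _ *+ X]card_ord -sumr_const; apply: eq_bigr => i _.
  rewrite Rintegral_sum; last by move=> j; exact: bounded_measurableM.
  rewrite (bigD1 i)//= big1 ?addr0; last first.
    by move=> j ji; rewrite iid_Rintegral_prod// ?k0 ?expr0n// eq_sym.
  by rewrite -(@iid_Rintegral i (fun y => k y ^+ 2))//; exact: bounded_measurableM.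
have -> : n%:R^-1 ^+ 2 * (n%:R * \int[P]_y (k y ^+ 2)) = (\int[P]_y (k y ^+ 2)) / n%:R by field.
by rewrite ler_wpM2r// invr_ge0.
Qed.

End iid_moments.

Lemma card_bigcup_ord {R : realType} (F : finType) m (A : 'I_m -> {set F}) (q : R) :
  (forall j, #|A j|%:R <= q) -> #|(\bigcup_(j < m) A j)%SET|%:R <= m%:R * q.
Proof.
move=> Aq; have := @card_bigcup_seq R _ F (enum 'I_m) A q (fun j _ => Aq j).
by rewrite size_enum_ord big_enum.
Qed.

(** * Two-pass deviation bound for a parametrized class *)

Section deviation.
Context {dT : measure_display} {T : measurableType dT} {R : realType}
  {dO : measure_display} {Omega : measurableType dO} {p : nat}.
Variables (P : probability T R) (Pr : probability Omega R) (n : nat).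
Hypothesis n_gt0 : (0 < n)%N.
Variable X : 'I_n -> Omega -> T.
Hypothesis mX : forall i, measurable_fun setT (X i).
Hypothesis iidX : forall B : 'I_n -> set T, (forall i, measurable (B i)) ->
  Pr (\bigcap_i (X i @^-1` B i)) = (\prod_(i < n) P (B i))%E.
Variables (D : set 'rV[R]_p) (g : 'rV[R]_p -> T -> R) (b sigma H u : R).
Hypothesis mD : measurable D.
Hypothesis mg : measurable_fun setT (fun ty : 'rV[R]_p * T => g ty.1 ty.2).
Hypothesis b_gt0 : 0 < b.
Hypothesis sigma_gt0 : 0 < sigma.
Hypothesis H_ge1 : 1 <= H.
Hypothesis u_ge0 : 0 <= u.
Hypothesis g_le : forall t y, `|g t y| <= b.
Hypothesis g_var : forall t, D t -> \int[P]_y (g t y ^+ 2) <= sigma ^+ 2.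
(** The sum runs over [2 * n] values but is divided by [n], hence the factor 2 before the squared
    radius. *)
Hypothesis g_net : forall k (z : n.-tuple (T * T)), exists m (c : 'I_m -> T -> R),
  [/\ m%:R <= expR (H * k.+1%:R), forall j y, `|c j y| <= b &
      forall t, D t -> exists j, n%:R^-1 * \sum_(i < n)
        ((g t (tnth z i).1 - c j (tnth z i).1) ^+ 2 +
         (g t (tnth z i).2 - c j (tnth z i).2) ^+ 2) <= 2 * (4 * sigma / 2 ^+ k) ^+ 2].
(** Makes the Hoeffding exponent [n * sigma^2 / (16 * b^2)] beat the level-4 net, of at most
    [expR (5 * H)] points, with [u] to spare. *)
Hypothesis n_large : 16 * b ^+ 2 * (5 * H + u) <= n%:R * sigma ^+ 2.

Let n0 : @Order.lt _ R 0 n%:R. Proof. by rewrite ltr0n. Qed.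

Definition emp (f : T -> R) (z : 'I_n -> T) : R := n%:R^-1 * \sum_(i < n) f (z i).

Let pr1 (z : n.-tuple (T * T)) i := (tnth z i).1.
Let pr2 (z : n.-tuple (T * T)) i := (tnth z i).2.

Let sq t y := g t y ^+ 2.

Lemma emp_ge0 f z : (forall y, 0 <= f y) -> 0 <= emp f z.
Proof. by move=> f0; rewrite mulr_ge0 ?invr_ge0 ?(ltW n0)// sumr_ge0. Qed.

Let bmg t : bounded_measurable (g t).
Proof.
split; last by exists b => y; exact: g_le.
apply: (measurableT_comp mg (_ : measurable_fun setT (fun y => (t, y)))).
exact: measurable_fun_pair.
Qed.

Let bmsq t : bounded_measurable (sq t).
Proof. by apply: bounded_measurableM; exact: bmg. Qed.

Lemma measurable_emp {d} {Y : measurableType d} (f : 'rV[R]_p -> T -> R)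
    (z : Y -> 'I_n -> T) (t : Y -> 'rV[R]_p) :
  measurable_fun setT (fun ty : 'rV[R]_p * T => f ty.1 ty.2) ->
  measurable_fun setT t -> (forall i, measurable_fun setT (fun y => z y i)) ->
  measurable_fun setT (fun y => emp (f (t y)) (z y)).
Proof.
move=> mf mt mz; apply: measurable_funM => //.
apply: measurable_sum => i.
exact: (measurableT_comp mf (measurable_fun_pair mt (mz i))).
Qed.

Let msq : measurable_fun setT (fun ty : 'rV[R]_p * T => sq ty.1 ty.2).
Proof. exact: measurable_funX. Qed.

Let mXw i : measurable_fun setT (fun wt : Omega * 'rV[R]_p => X i wt.1).
Proof. exact: measurableT_comp. Qed.

Let mpr1 i : measurable_fun setT (fun zt : n.-tuple (T * T) * 'rV[R]_p => pr1 zt.1 i).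
Proof.
apply: measurableT_comp => //.
exact: (measurableT_comp (measurable_tnth i) measurable_fst).
Qed.

Let mpr2 i : measurable_fun setT (fun zt : n.-tuple (T * T) * 'rV[R]_p => pr2 zt.1 i).
Proof.
apply: measurableT_comp => //.
exact: (measurableT_comp (measurable_tnth i) measurable_fst).
Qed.

Let mDY {d} {Y : measurableType d} : measurable [set yt : Y * 'rV[R]_p | D yt.2].
Proof. by rewrite -[X in measurable X]setTI; exact: measurable_snd. Qed.

Lemma emp_marginal w w' : pr1 (pairs n X (w, w')) = X^~ w /\ pr2 (pairs n X (w, w')) = X^~ w'.
Proof. by split; apply/funext => i; rewrite /pr1 /pr2 tnth_mktuple. Qed.

Lemma measurable_empX f : bounded_measurable f -> bounded_measurable (fun w => emp f (X^~ w)).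
Proof.
move=> bf; apply: bounded_measurableM; first exact: bounded_measurable_cst.
apply: bounded_measurable_sum => i.
by have [mf [M fM]] := bf; split; [exact: measurableT_comp|exists M].
Qed.

Lemma Rintegral_emp f : bounded_measurable f ->
  \int[Pr]_w emp f (X^~ w) = \int[P]_y f y.
Proof.
move=> bf; have bfX i : bounded_measurable (fun w => f (X i w)).
  by have [mf [M fM]] := bf; split; [exact: measurableT_comp|exists M].
rewrite RintegralZl//; last exact/bounded_integrable/bounded_measurable_sum.
rewrite Rintegral_sum//.
rewrite (eq_bigr (fun=> \int[P]_y f y)); last first.
  by move=> i _; exact: (iid_Rintegral P Pr n X mX iidX).
by rewrite sumr_const card_ord -[X in _ * X]mulr_natl mulKf// gt_eqF.
Qed.

Let iid_sq_le t c : D t -> sigma ^+ 2 <= c / 2 -> 0 < c ->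
  (2^-1%:E <= Pr [set w | (emp (sq t) (X^~ w) <= c)%R])%E.
Proof.
move=> Dt sc c0; have be := measurable_empX _ (bmsq t).
apply: markov_half => //; first by case: be.
  by move=> w; apply: emp_ge0 => y; exact: sqr_ge0.
rewrite Rintegral_EFin// lee_fin Rintegral_emp//.
exact: le_trans (g_var t Dt) sc.
Qed.

(* If the first half of the double sample has empirical second moment more than
   [16 sigma^2] and the other half at most [2 sigma^2], then so do, up to
   constants, the nearest elements of the net. *)
Let net_gap (c1 c2 d1 d2 s2 G1 G2 : R) : 0 < s2 -> 16 * s2 < G1 -> G2 <= 2 * s2 ->
  d1 + d2 <= s2 / 8 -> 0 <= d1 -> 0 <= d2 -> 0 <= c2 -> G1 <= 2 * c1 + 2 * d1 -> c2 <= 2 * G2 + 2 * d2 ->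
  s2 * ((c1 + c2) / 2) < (c1 - c2) ^+ 2 /\ 0 < c1 - c2.
Proof.
move=> s0 hG1 hG2 hd hd1 hd2 hc2 h1 h2.
have e1 : 36 / 10 * s2 < c1 - c2 by lra.
have e2 : (c1 + c2) / 2 < 36 / 10 * (c1 - c2) by lra.
split; last by lra.
nra.
Qed.

Let emp_sqD (f h : T -> R) z : emp (fun y => f y ^+ 2) z <=
  2 * emp (fun y => h y ^+ 2) z + 2 * emp (fun y => (f y - h y) ^+ 2) z.
Proof.
rewrite /emp (mulrCA 2) (mulrCA 2) -mulrDr ler_pM2l ?invr_gt0// !mulr_sumr -big_split/=.
apply: ler_sum => i _.
have := sqr_ge0 (f (z i) - 2 * h (z i)); nra.
Qed.

Let sign_swap (f : T -> R) (e : {ffun 'I_n -> bool}) z :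
  emp f (pr1 (swap_pairs n e z)) - emp f (pr2 (swap_pairs n e z)) =
  n%:R^-1 * \sum_(i < n) (-1) ^+ e i * (f (pr1 z i) - f (pr2 z i)).
Proof.
rewrite /emp -mulrBr -sumrB; congr (_ * _); apply: eq_bigr => i _.
rewrite /pr1 /pr2 tnth_mktuple; case: (e i) => /=.
  by rewrite expr1 mulN1r opprB.
by rewrite expr0 mul1r.
Qed.

Let sum_swap (f : T -> R) (e : {ffun 'I_n -> bool}) z :
  emp f (pr1 (swap_pairs n e z)) + emp f (pr2 (swap_pairs n e z)) =
  emp f (pr1 z) + emp f (pr2 z).
Proof.
rewrite /emp -!mulrDr -!big_split/=; congr (_ * _); apply: eq_bigr => i _.
by rewrite /pr1 /pr2 tnth_mktuple; case: (e i) => //=; rewrite addrC.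
Qed.

(** The threshold is self-normalized. The sum [S j] of the second moments of both halves is
    unchanged by swaps, while their difference is a sign average whose squared entries are at most
    [b^2] times the sum of the two squared values. Comparing it with [sigma * sqrt (S j / 2)] makes
    [S j] cancel in Hoeffding's exponent. *)
Let card_variance z :
  #|[pred e : {ffun 'I_n -> bool} | `[< proj
     [set zt | [/\ D zt.2, 16 * sigma ^+ 2 < emp (sq zt.2) (pr1 zt.1) &
                   emp (sq zt.2) (pr2 zt.1) <= 2 * sigma ^+ 2]] (swap_pairs n e z) >]]|%:R <=
  2 ^+ n * expR (- u).
Proof.
(* At level 4 the error is [2 * (sigma / 4)^2 = sigma^2 / 8], as [net_gap] requires. *)
have [m [c [mH cb cnet]]] := g_net 4 z.
pose c2 j y := c j y ^+ 2.
pose a j i := c2 j (pr1 z i) - c2 j (pr2 z i).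
pose S j := emp (c2 j) (pr1 z) + emp (c2 j) (pr2 z).
pose B j := [set e : {ffun 'I_n -> bool} | (0 < S j)%R &&
  (n%:R * (sigma * Num.sqrt (S j / 2)) < \sum_(i < n) (-1) ^+ e i * a j i)%R]%SET.
have Bq j : #|B j|%:R <= 2 ^+ n * expR (- (5 * H + u)).
  rewrite cardsE; have [S0|S0] := leP (S j) 0.
    rewrite eq_card0 ?mulr_ge0 ?expR_ge0 ?exprn_ge0//.
  have V0 : 0 < b ^+ 2 * (n%:R * S j) by rewrite !mulr_gt0// exprn_gt0.
  have u0 : 0 <= n%:R * (sigma * Num.sqrt (S j / 2)).
    by rewrite !mulr_ge0 ?sqrtr_ge0// ltW.
  apply: (le_trans (hoeffding_signs n (a j) _ _ u0 V0 _)).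
    rewrite /S /emp -mulrDr mulVKf ?gt_eqF// -big_split/= mulr_sumr.
    apply: ler_sum => i _; rewrite /a /c2.
    have sb y : c j y ^+ 2 <= b ^+ 2.
      by rewrite -real_normK ?num_real// ler_pXn2r ?nnegrE ?(ltW b_gt0)//; exact: cb.
    have := sb (pr1 z i); have := sb (pr2 z i).
    have := sqr_ge0 (c j (pr1 z i)); have := sqr_ge0 (c j (pr2 z i)).
    set x := c j _ ^+ 2; set y := c j _ ^+ 2; nra.
  rewrite ler_pM2l ?exprn_gt0// ler_expR lerN2.
  have -> : (n%:R * (sigma * Num.sqrt (S j / 2))) ^+ 2 / (8 * (b ^+ 2 * (n%:R * S j))) =
      n%:R * sigma ^+ 2 / (16 * b ^+ 2).
    rewrite !exprMn sqr_sqrtr; last by rewrite divr_ge0 ?ltW.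
    by field; rewrite !gt_eqF.
  by rewrite ler_pdivlMr ?mulr_gt0 ?exprn_gt0// mulrC.
apply: (@le_trans _ R (#|(\bigcup_(j < m) B j)%SET|%:R)); last first.
  apply: le_trans (card_bigcup_ord _ _ _ _ Bq) _.
  rewrite mulrCA ler_pM2l ?exprn_gt0// -ler_pdivlMr ?expR_gt0// -expRN opprK -expRD.
  by apply: le_trans mH _; rewrite ler_expR; lra.
rewrite ler_nat; apply/subset_leq_card/fintype.subsetP => e /asboolP[t [/= Dt G1 G2]].
have [j jt] := cnet t Dt; apply/finset.bigcupP; exists j => //.
set ze := swap_pairs n e z in G1 G2.
pose dd y := (g t y - c j y) ^+ 2.
have d12 : emp dd (pr1 ze) + emp dd (pr2 ze) <= sigma ^+ 2 / 8.
  rewrite sum_swap /emp -mulrDr -big_split/=; apply: le_trans jt _.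
  by rewrite le_eqVlt; apply/orP; left; apply/eqP; field.
have dd0 y : 0 <= dd y by exact: sqr_ge0.
have [] := @net_gap (emp (c2 j) (pr1 ze)) (emp (c2 j) (pr2 ze)) _ _ _ _ _ _ G1 G2 d12.
- by rewrite exprn_gt0.
- exact: emp_ge0.
- exact: emp_ge0.
- by apply: emp_ge0 => y; exact: sqr_ge0.
- exact: emp_sqD.
- apply: le_trans (emp_sqD (c j) (g t) _) _; rewrite lerD2l ler_pM2l//.
  by rewrite /emp ler_pM2l ?invr_gt0//; apply: ler_sum => i _; rewrite /dd -sqrrN opprB.
rewrite sum_swap -/(S j) sign_swap => gap pos.
rewrite finset.inE; apply/andP; split.
  have : 0 <= emp (c2 j) (pr2 ze) by apply: emp_ge0 => y; exact: sqr_ge0.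
  have := sum_swap (c2 j) e z; rewrite -/(S j) => <-.
  by move: pos; rewrite -sign_swap -/ze; lra.
have S0 : 0 <= S j / 2.
  by rewrite divr_ge0// addr_ge0//; apply: emp_ge0 => y; exact: sqr_ge0.
rewrite -ltr_pdivlMl// -ltr_sqr ?nnegrE ?(ltW pos)//; last first.
  by rewrite mulr_ge0 ?sqrtr_ge0// ltW.
by rewrite exprMn sqr_sqrtr.
Qed.

(** By Markov's inequality the ghost half keeps its second moment below [2 * sigma^2] with
    probability at least 1/2. *)
Lemma variance_control : exists E, [/\ measurable E,
  forall w t, D t -> 16 * sigma ^+ 2 < emp (sq t) (X^~ w) -> E w &
  (Pr E <= (2 * expR (- u))%:E)%E].
Proof.
have s2 : 0 < 2 * sigma ^+ 2 by rewrite mulr_gt0// exprn_gt0.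
pose A1 := [set wt : Omega * 'rV[R]_p | D wt.2 /\ 16 * sigma ^+ 2 < emp (sq wt.2) (X^~ wt.1)].
have [|||E [mE AE PE]] := @symmetrization _ _ _ _ _ P Pr n X mX iidX p A1 _ (expR (- u)) _ _ _ card_variance.
- apply: measurableI; first exact: mDY.
  by apply: measurable_gt_cst; apply: measurable_emp.
- rewrite (_ : mkset _ = [set zt | D zt.2] `&`
    ([set zt | 16 * sigma ^+ 2 < emp (sq zt.2) (pr1 zt.1)] `&`
     [set zt | emp (sq zt.2) (pr2 zt.1) <= 2 * sigma ^+ 2])).
    apply: measurableI; first exact: mDY.
    apply: measurableI.
      by apply: measurable_gt_cst; apply: measurable_emp.
    by apply: measurable_le_cst; apply: measurable_emp.
  by apply/seteqP; split => zt [] // ? [].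
- move=> w t [/= Dt At]; exists [set w' | emp (sq t) (X^~ w') <= 2 * sigma ^+ 2]; split.
  + by apply: measurable_le_cst; case: (measurable_empX _ (bmsq t)).
  + by move=> w' /= vw; have [-> ->] := emp_marginal w w'.
  + by apply: iid_sq_le => //; lra.
by exists E; split => // w t Dt At; apply: AE; exists t.
Qed.

Let h := 2 * H + u + 1.
(** Half of [tau] is the chaining threshold for radius [8 * sigma]: when both halves have second
    moment at most [16 * sigma^2], the differences have at most [2 * (16 + 16) * sigma^2]. *)
Let tau := 16 * 27 * sigma * Num.sqrt (h / n%:R).

Let h_gt0 : 0 < h. Proof. by move: H_ge1 u_ge0; rewrite /h; lra. Qed.

Let tau_gt0 : 0 < tau.
Proof. by rewrite !mulr_gt0// sqrtr_gt0 divr_gt0. Qed.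

Let tau_sqr : tau ^+ 2 = (16 * 27) ^+ 2 * sigma ^+ 2 * (h / n%:R).
Proof. by rewrite !exprMn sqr_sqrtr// divr_ge0 ?ltW. Qed.

(** Chaining acts on the vector of differences within pairs, whose sign average is the difference of
    the two means after a swap. Passing to differences doubles the net radius from [4 * sigma / 2^k]
    to [8 * sigma / 2^k]. *)
Let card_deviation z :
  #|[pred e : {ffun 'I_n -> bool} | `[< proj
     [set zt | [/\ D zt.2, tau / 2 < `|emp (g zt.2) (pr1 zt.1) - emp (g zt.2) (pr2 zt.1)|,
        emp (sq zt.2) (pr1 zt.1) <= 16 * sigma ^+ 2 &
        emp (sq zt.2) (pr2 zt.1) <= 16 * sigma ^+ 2]] (swap_pairs n e z) >]]|%:R <=
  2 ^+ n * expR (- u).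
Proof.
pose vec (f : T -> R) : {ffun 'I_n -> R} := [ffun i => f (pr1 z i) - f (pr2 z i)].
have vecle f f' : sq_mean (vec f - vec f') <= 2 * (n%:R^-1 * \sum_(i < n)
    ((f (pr1 z i) - f' (pr1 z i)) ^+ 2 + (f (pr2 z i) - f' (pr2 z i)) ^+ 2)).
  rewrite /sq_mean mulrCA ler_pM2l ?invr_gt0// mulr_sumr; apply: ler_sum => i _.
  rewrite !ffunE.
  have := sqr_ge0 ((f (pr1 z i) - f' (pr1 z i)) + (f (pr2 z i) - f' (pr2 z i))); nra.
pose V := [set v | exists2 t, D t & v = vec (g t) /\ sq_mean v <= (8 * sigma) ^+ 2].
have /choice[net netP] k : exists r : seq {ffun 'I_n -> R}, (size r)%:R <= expR (H * k.+1%:R) /\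
    forall v, V v -> exists2 c, c \in r & sq_mean (v - c) <= (8 * sigma / 2 ^+ k) ^+ 2.
  have [m [c [mH _ cnet]]] := g_net k z.
  exists [seq vec (c j) | j <- enum 'I_m]; split; first by rewrite size_map size_enum_ord.
  move=> _ [t Dt [-> _]]; have [j jt] := cnet t Dt.
  exists (vec (c j)); first by apply: map_f; rewrite mem_enum.
  apply: le_trans (vecle _ _) _; move: jt; rewrite -/(pr1 z _).
  set x := n%:R^-1 * _; set y := _ / _.
  have -> : 8 * sigma / 2 ^+ k = 2 * y by rewrite /y; field; rewrite expf_neq0.
  by move: x y => x y; lra.
have rho0 : 0 < 8 * sigma by rewrite mulr_gt0.
apply: (le_trans _ (@card_chaining R n n_gt0 V (8 * sigma) H u net rho0 H_ge1 u_ge0 _ _ _)).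
- rewrite ler_nat; apply/subset_leq_card/fintype.subsetP => e /asboolP[t [/= Dt dev s1 s2]].
  apply/asboolP; exists (vec (g t)).
    exists t => //; split => //.
    have := vecle (g t) (fun=> 0); have -> : vec (g t) - vec (fun=> 0) = vec (g t).
      by apply/ffunP => i; rewrite !ffunE !subr0.
    move=> /le_trans; apply.
    under eq_bigr do rewrite !subr0.
    rewrite big_split/= mulrDr -/(emp (sq t) (pr1 z)) -/(emp (sq t) (pr2 z)).
    by rewrite -(sum_swap _ e); move: s1 s2; lra.
  move: dev; rewrite sign_swap /sign_mean -/h.
  have -> : 27 * (8 * sigma) * Num.sqrt (h / n%:R) = tau / 2 by rewrite /tau; field.
  by under [X in _ -> _ < `|_ * X|]eq_bigr do rewrite ffunE.
- by move=> v [t _ []].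
- by move=> k; have [] := netP k.
- by move=> k; have [] := netP k.
Qed.

Let measurable_dev_le t : measurable [set w' |
    `|emp (g t) (X^~ w') - \int[P]_y g t y| <= tau / 2 /\
    emp (sq t) (X^~ w') <= 16 * sigma ^+ 2].
Proof.
apply: measurableI; apply: measurable_le_cst; last by case: (measurable_empX _ (bmsq t)).
apply: measurableT_comp => //.
by apply: measurable_funB => //; case: (measurable_empX _ (bmg t)).
Qed.

Let iid_dev_le t : D t -> (2^-1%:E <= Pr [set w' |
    (`|emp (g t) (X^~ w') - \int[P]_y g t y| <= tau / 2)%R /\
    (emp (sq t) (X^~ w') <= 16 * sigma ^+ 2)%R])%E.
Proof.
move=> Dt; set m := \int[P]_y g t y.
have s2 : 0 < sigma ^+ 2 by rewrite exprn_gt0.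
have bv : bounded_measurable (fun w' => (emp (g t) (X^~ w') - m) ^+ 2).
  have bd : bounded_measurable (fun w' => emp (g t) (X^~ w') - m).
    by apply: bounded_measurableB; [exact: measurable_empX|exact: bounded_measurable_cst].
  exact: bounded_measurableM.
have bs := measurable_empX _ (bmsq t).
(* A Chebyshev term and a Markov term are added so that one application of Markov's inequality
   yields both conditions; the mean is at most [4 / 432^2 + 1 / 16]. *)
pose F w' := (4 / tau ^+ 2) * (emp (g t) (X^~ w') - m) ^+ 2 +
  (16 * sigma ^+ 2)^-1 * emp (sq t) (X^~ w').
have c1 : 0 < 4 / tau ^+ 2 by rewrite divr_gt0// exprn_gt0.
have c2 : 0 < (16 * sigma ^+ 2)^-1 by rewrite invr_gt0 mulr_gt0.
have e0 w' : 0 <= emp (sq t) (X^~ w') by apply: emp_ge0 => y; exact: sqr_ge0.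
have bF : bounded_measurable F.
  by apply: bounded_measurableD; apply: bounded_measurableM => //; exact: bounded_measurable_cst.
have FE : (\int[Pr]_w' (F w')%:E <= (1 / 2)%:E)%E.
  rewrite Rintegral_EFin// lee_fin /F RintegralD//.
  - rewrite RintegralZl//; last exact: bounded_integrable.
    rewrite RintegralZl//; last exact: bounded_integrable.
    rewrite Rintegral_emp//.
    have hv := @iid_variance _ _ _ _ _ P Pr n n_gt0 X mX iidX _ _ (bmg t) (g_var t Dt).
    apply: le_trans (lerD (ler_wpM2l (ltW c1) hv) (ler_wpM2l (ltW c2) (g_var t Dt))) _.
    have -> : (16 * sigma ^+ 2)^-1 * sigma ^+ 2 = 1 / 16 by field; rewrite gt_eqF.
    have -> : 4 / tau ^+ 2 * (sigma ^+ 2 / n%:R) = (4 / (16 * 27) ^+ 2) / h.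
      by rewrite tau_sqr; field; rewrite !gt_eqF.
    have : (4 / (16 * 27) ^+ 2) / h <= 4 / (16 * 27) ^+ 2.
      rewrite ler_pdivrMr// ler_peMr//; move: H_ge1 u_ge0; rewrite /h; lra.
    lra.
  - by apply: bounded_integrable; apply: bounded_measurableM => //; exact: bounded_measurable_cst.
  - by apply: bounded_integrable; apply: bounded_measurableM => //; exact: bounded_measurable_cst.
have F0 w' : 0 <= F w'.
  by rewrite addr_ge0// mulr_ge0 ?(ltW c1) ?(ltW c2)// ?sqr_ge0.
apply: le_trans (markov_half Pr F 1 _ F0 ltr01 FE) _; first by case: bF.
have mleF : measurable [set w' | F w' <= 1] by apply: measurable_le_cst; case: bF.
apply: le_measure; [exact/mem_set|exact/mem_set/measurable_dev_le|].
move=> w' /= Fw'; split.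
  rewrite -ler_sqr ?nnegrE ?divr_ge0 ?(ltW tau_gt0)// real_normK ?num_real//.
  have : 4 / tau ^+ 2 * (emp (g t) (X^~ w') - m) ^+ 2 <= 1.
    by apply: le_trans Fw'; rewrite lerDl mulr_ge0// ltW.
  rewrite mulrAC ler_pdivrMr ?exprn_gt0// expr_div_n; lra.
have : (16 * sigma ^+ 2)^-1 * emp (sq t) (X^~ w') <= 1.
  by apply: le_trans Fw'; rewrite lerDr mulr_ge0 ?sqr_ge0// ltW.
by rewrite ler_pdivrMl ?mulr1// mulr_gt0.
Qed.

(** Adding [b] makes the integrand nonnegative, so that Tonelli's measurability applies. *)
Lemma measurable_mean : measurable_fun setT (fun t => \int[P]_y g t y).
Proof.
have b0 t y : 0 <= g t y + b.
  by have := g_le t y; rewrite ler_norml => /andP[+ _]; lra.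
have -> : (fun t => \int[P]_y g t y) = (fun t => \int[P]_y (g t y + b) - b).
  apply/funext => t; rewrite RintegralD ?Rintegral_cst_probability ?addrK//.
    exact/bounded_integrable/bmg.
  exact/bounded_integrable/bounded_measurable_cst.
apply: measurable_funB => //.
have bgb t : bounded_measurable (fun y => g t y + b).
  by apply: bounded_measurableD => //; exact: bounded_measurable_cst.
apply/measurable_EFinP.
rewrite (_ : _ \o _ = fubini_F P (fun ty : 'rV[R]_p * T => (g ty.1 ty.2 + b)%:E)).
  apply: measurable_fun_fubini_tonelli_F => [|ty]; last by rewrite lee_fin.
  by apply/measurable_EFinP; exact: measurable_funD.
by apply/funext => t /=; rewrite /fubini_F /= Rintegral_EFin.
Qed.

(** The exceptional set is the union of those of the two passes, each of probability at most
    [2 * expR (- u)]. *)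
Lemma deviation : exists E, [/\ measurable E,
  forall w t, D t -> 16 * 27 * sigma * Num.sqrt ((2 * H + u + 1) / n%:R) <
    `|emp (g t) (X^~ w) - \int[P]_y g t y| -> E w &
  (Pr E <= (4 * expR (- u))%:E)%E].
Proof.
have [E1 [mE1 AE1 PE1]] := variance_control.
pose A1 := [set wt : Omega * 'rV[R]_p | [/\ D wt.2,
  tau < `|emp (g wt.2) (X^~ wt.1) - \int[P]_y g wt.2 y| &
  emp (sq wt.2) (X^~ wt.1) <= 16 * sigma ^+ 2]].
have [|||E2 [mE2 AE2 PE2]] := @symmetrization _ _ _ _ _ P Pr n X mX iidX p A1 _ (expR (- u)) _ _ _ card_deviation.
- rewrite (_ : A1 = [set wt | D wt.2] `&`
    ([set wt | tau < `|emp (g wt.2) (X^~ wt.1) - \int[P]_y g wt.2 y| ] `&`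
     [set wt | emp (sq wt.2) (X^~ wt.1) <= 16 * sigma ^+ 2])).
    apply: measurableI; first exact: mDY.
    apply: measurableI; last by apply: measurable_le_cst; apply: measurable_emp.
    apply: measurable_gt_cst; apply: measurableT_comp => //.
    apply: measurable_funB; first exact: measurable_emp.
    exact: (measurableT_comp measurable_mean).
  by apply/seteqP; split => zt [] // ? [].
- rewrite (_ : mkset _ = [set zt | D zt.2] `&`
    ([set zt | tau / 2 < `|emp (g zt.2) (pr1 zt.1) - emp (g zt.2) (pr2 zt.1)| ] `&`
    ([set zt | emp (sq zt.2) (pr1 zt.1) <= 16 * sigma ^+ 2] `&`
     [set zt | emp (sq zt.2) (pr2 zt.1) <= 16 * sigma ^+ 2]))).
    apply: measurableI; first exact: mDY.
    apply: measurableI.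
      apply: measurable_gt_cst; apply: measurableT_comp => //.
      by apply: measurable_funB; exact: measurable_emp.
    by apply: measurableI; apply: measurable_le_cst; apply: measurable_emp.
  by apply/seteqP; split => zt; [case|case=> ? [? []]].
- move=> w t [/= Dt dev vw].
  exists [set w' | `|emp (g t) (X^~ w') - \int[P]_y g t y| <= tau / 2 /\
    emp (sq t) (X^~ w') <= 16 * sigma ^+ 2]; split; last exact: iid_dev_le.
    exact: measurable_dev_le.
  move=> w' [/= d1 d2]; have [-> ->] := emp_marginal w w'; split => //.
  have := ler_distD (emp (g t) (X^~ w')) (emp (g t) (X^~ w)) (\int[P]_y g t y).
  by move: dev d1; lra.
exists (E1 `|` E2); split; first exact: measurableU.
  move=> w t Dt dev; have [vw|vw] := leP (emp (sq t) (X^~ w)) (16 * sigma ^+ 2).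
    by right; apply: AE2; exists t.
  by left; exact: AE1 vw.
apply: le_trans (measureU2 _ mE1 mE2) _.
apply: le_trans (leeD PE1 PE2) _.
by rewrite -EFinD lee_fin; lra.
Qed.

End deviation.

(** * Iterated partial derivatives of averages *)

Section directional.
Context {R : realType} {d : nat}.
Implicit Types (f g : 'rV[R]_d -> R) (x v w : 'rV[R]_d) (r : seq 'I_d).

Let quotient f x v := fun h : R => h^-1 *: ((f \o shift x) (h *: v) - f x).

Lemma derivable_seq f x v (u : R^nat) : derivable f x v -> u @ \oo --> 0 ->
  (forall n, u n != 0) -> (u n)^-1 * (f (u n *: v + x) - f x) @[n --> \oo] --> 'D_v f x.
Proof.
move=> df u0 un0.
have dq : quotient f x v @ 0^' --> 'D_v f x by exact: df.
have cu : u n @[n --> \oo] --> (0 : R)^'.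
  move=> A /= [e e0 eA].
  have ue : \forall n \near \oo, `|0 - u n| < e by move/cvgrPdist_lt : u0; exact.
  by apply: filterS ue => n /= un; exact: eA.
exact: (cvg_comp _ _ cu dq).
Qed.

Lemma quotient_shift f x v w :
  quotient (fun y => f (y + w)) x v = quotient f (x + w) v.
Proof. by apply/funext => h; rewrite /quotient /= addrA. Qed.

Lemma derivable_shift f x v w :
  derivable f (x + w) v -> derivable (fun y : 'rV[R]_d => f (y + w)) x v.
Proof. by rewrite /derivable -/(quotient _ x v) quotient_shift. Qed.

Lemma derive_shift f x v w : 'D_v (fun y : 'rV[R]_d => f (y + w)) x = 'D_v f (x + w).
Proof. by rewrite /derive -/(quotient _ x v) quotient_shift. Qed.

Lemma is_derive_scale f x v (c : R) : c != 0 -> derivable f (c *: x) v ->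
  is_derive x v (fun y => f (c *: y)) (c * 'D_v f (c *: x)).
Proof.
move=> c0 df.
have cq : quotient (fun y => f (c *: y)) x v @ 0^' --> c * 'D_v f (c *: x).
  have -> : quotient (fun y => f (c *: y)) x v = fun h => c * quotient f (c *: x) v (c * h).
    apply/funext => h; rewrite /quotient /shift /=.
    rewrite [c *: (_ + _)]scalerDr [c *: (h *: v)]scalerA invfM.
    by set X := f _ - f _; rewrite /GRing.scale/= !mulrA mulfV// mul1r.
  apply: cvgM; first exact: cvg_cst.
  have : quotient f (c *: x) v @ 0^' --> 'D_v f (c *: x) by exact: df.
  apply: cvg_comp => A /= [e e0 eA].
  have ce : 0 < e / `|c| by rewrite divr_gt0// normr_gt0.
  exists (e / `|c|) => //= h /=; rewrite sub0r normrN => hc h0; apply: eA => /=.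
    by rewrite sub0r normrN normrM -ltr_pdivlMl ?normr_gt0// mulrC.
  by rewrite mulf_neq0.
apply: DeriveDef; last exact: cvg_lim cq.
by apply/cvg_ex; eexists; exact: cq.
Qed.

(** Mean value theorem along the line through [x] in direction [v]; a negative [a] is reduced to a
    positive one by exchanging the endpoints. *)
Lemma derivable_lipschitz f v (M : R) : (forall x, derivable f x v) ->
  (forall x, `|'D_v f x| <= M) -> forall x a, `|f (a *: v + x) - f x| <= M * `|a|.
Proof.
move=> df fM.
have pos x a : 0 < a -> `|f (a *: v + x) - f x| <= M * `|a|.
  move=> a0; pose phi t := f (t *: v + x).
  have dphi (t : R) : is_derive t (1 : R) phi ('D_v f (t *: v + x)).
    have E : (fun h => h^-1 *: ((phi \o shift t) (h *: 1) - phi t)) = quotient f (t *: v + x) v.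
      apply/funext => h; rewrite /quotient /phi /= /shift /=; congr (_ *: (f _ - _)).
      by rewrite -[h%:A]/(h * 1) mulr1 scalerDl addrA.
    apply: DeriveDef; first by rewrite /derivable E; exact: df.
    by rewrite /derive E.
  have [|c _ phic] := @MVT R phi (fun t => 'D_v f (t *: v + x)) 0 a a0 (fun t _ => dphi t).
    by apply: derivable_within_continuous => t _; have [] := dphi t.
  have := phic; rewrite /phi scale0r add0r subr0 => ->.
  by rewrite normrM ler_wpM2r.
move=> x a; have [a0|a0|->] := ltgtP a 0; last first.
- by rewrite scale0r add0r subrr !normr0 mulr0.
- exact: pos.
have := pos (a *: v + x) (- a); rewrite oppr_gt0 normrN => /(_ a0).
by rewrite addrA scaleNr addNr add0r distrC.
Qed.

Lemma has_partials_shift r f w : has_partials r f -> has_partials r (fun y => f (y + w)) /\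
  partials r (fun y => f (y + w)) = fun y => partials r f (y + w).
Proof.
elim: r => [//|i r IH] /= [/IH[hr Er] dr]; split.
  by split => // x; rewrite Er; exact: derivable_shift.
by rewrite Er; apply/funext => y; exact: derive_shift.
Qed.

Lemma has_partialsD r f g : has_partials r f -> has_partials r g ->
  has_partials r (fun y => f y + g y) /\
  partials r (fun y => f y + g y) = fun y => partials r f y + partials r g y.
Proof.
elim: r => [//|i r IH] /= [hf df] [hg dg]; have [h E] := IH hf hg; split.
  by split => // x; rewrite E; exact: derivableD.
by rewrite E; apply/funext => y; exact: deriveD.
Qed.

Lemma has_partialsZ r f a : has_partials r f -> has_partials r (fun y => a * f y) /\
  partials r (fun y => a * f y) = fun y => a * partials r f y.
Proof.
elim: r => [//|i r IH] /= [/IH[h E] df]; split.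
  by split => // x; rewrite E; exact: derivableZ.
by rewrite E; apply/funext => y; exact: deriveZ.
Qed.

Lemma has_partials_scale r f c : c != 0 -> has_partials r f ->
  has_partials r (fun y => f (c *: y)) /\
  partials r (fun y => f (c *: y)) = fun y => c ^+ size r * partials r f (c *: y).
Proof.
move=> c0; elim: r => [|i r IH] /=; first by split => //; apply/funext => y; rewrite mul1r.
move=> [/IH[h E] df].
have D x := is_derive_scale (partials r f) x (delta_mx ord0 i) c c0 (df _).
split; first by split => // x; rewrite E; apply: derivableZ; have [] := D x.
rewrite E; apply/funext => y; rewrite /partial.
rewrite (deriveZ (f := fun y => partials r f (c *: y))); last by have [] := D y.
by have [_ ->] := D y; rewrite /GRing.scale/= exprSr mulrA.
Qed.

Lemma has_partials_sum (I : Type) (s : seq I) r (f : I -> 'rV[R]_d -> R) :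
  (forall i, has_partials r (f i)) -> has_partials r (fun y => \sum_(i <- s) f i y) /\
  partials r (fun y => \sum_(i <- s) f i y) = fun y => \sum_(i <- s) partials r (f i) y.
Proof.
move=> hf.
have h0 : has_partials r (fun=> 0 : R) /\ partials r (fun=> 0 : R) = (fun=> 0).
  elim: r {hf} => [//|i r /= [h E]]; split.
    by split => // x; rewrite E; exact: derivable_cst.
  by rewrite E; apply/funext => y; exact: derive_cst.
elim: s => [|i s [h E]].
  by rewrite (_ : (fun y => _) = (fun=> 0)); [have [? ->] := h0; split => //|];
    apply/funext => y; rewrite big_nil.
rewrite (_ : (fun y => _) = (fun y => f i y + \sum_(j <- s) f j y)); last first.
  by apply/funext => y; rewrite big_cons.
have [h' ->] := has_partialsD r _ _ (hf i) h; split => //.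
by rewrite E; apply/funext => y; rewrite big_cons.
Qed.

Lemma measurable_translation (x : 'rV[R]_d) (f : 'rV[R]_d -> R) : measurable_fun setT f ->
  measurable_fun setT (fun y : 'rV[R]_d => f (y + x)).
Proof.
move=> mf; rewrite (_ : (fun y => _) = f \o (fun y => 1 *: (y - (- x)))).
  by apply: measurableT_comp => //; exact: measurable_affine.
by apply/funext => y /=; rewrite scale1r opprK.
Qed.

Lemma measurable_reflection (x : 'rV[R]_d) (f : 'rV[R]_d -> R) : measurable_fun setT f ->
  measurable_fun setT (fun y : 'rV[R]_d => f (x - y)).
Proof.
move=> mf; rewrite (_ : (fun y => _) = f \o (fun y => 1 *: (x - y))).
  by apply: measurableT_comp => //; exact: measurable_affine.
by apply/funext => y /=; rewrite scale1r.
Qed.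

Let inv_cvg0 : (fun n : nat => n.+1%:R^-1 : R) @ \oo --> 0.
Proof. exact: cvg_harmonic. Qed.

(** Each further partial derivative is a pointwise limit of difference quotients with step
    [1 / (n + 1)]. *)
Lemma measurable_partials r f : measurable_fun setT f -> has_partials r f ->
  measurable_fun setT (partials r f).
Proof.
move=> mf; elim: r => [//|i r IH] /= [/IH mr dr].
apply: (measurable_fun_cvg (h := fun n (y : 'rV[R]_d) => (n.+1%:R^-1)^-1 *
    (partials r f (n.+1%:R^-1 *: delta_mx ord0 i + y) - partials r f y))).
  move=> n; apply: measurable_funM => //; apply: measurable_funB => //.
  under eq_fun do rewrite addrC; exact: measurable_translation.
by move=> x _; apply: derivable_seq.
Qed.

Variable P : probability 'rV[R]_d R.

(* The innermost partial derivatives of [f] need not be integrable, so one cannot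
   differentiate under the integral from the inside out.  Instead the outermost
   derivative is replaced by a difference quotient of [f], whose partial
   derivative along [r] is bounded by the mean value theorem. *)
Lemma partials_mean r f F (M : R) : measurable_fun setT f ->
  has_partials r f -> has_partials r F ->
  (forall x, P.-integrable setT (fun y => (f (x - y))%:E)) ->
  (forall x, F x = \int[P]_y f (x - y)) -> (forall x, `|partials r f x| <= M) ->
  forall x, partials r F x = \int[P]_y partials r f (x - y).
Proof.
elim: r f F M => [//|i r IH] f F M mf /= [hf df] [hF dF] intf FE fM x.
pose e : 'rV[R]_d := delta_mx ord0 i.
pose diff g a y : R := g (y + a *: e) + (-1) * g y.
have hdiff g a : has_partials r g -> has_partials r (diff g a) /\
    partials r (diff g a) = fun y => partials r g (a *: e + y) - partials r g y.
  move=> hg; have [h1 E1] := has_partials_shift r g (a *: e) hg.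
  have [h2 E2] := has_partialsZ r g (-1) hg.
  have [h3 E3] := has_partialsD r _ _ h1 h2; split; first exact: h3.
  by rewrite E3 E1 E2; apply/funext => y; rewrite mulN1r addrC (addrC y) addrC.
have step a : a != 0 -> partials r F (a *: e + x) - partials r F x =
    \int[P]_y (partials r f (a *: e + (x - y)) - partials r f (x - y)).
  move=> a0; have [hfa Efa] := hdiff f a hf; have [hFa EFa] := hdiff F a hF.
  have intfa z : P.-integrable setT (fun y => (f (z - y + a *: e))%:E).
    by under eq_fun do rewrite addrAC; exact: intf.
  have := IH (diff f a) (diff F a) (M * `|a|) _ hfa hFa _ _ _ x.
  rewrite Efa EFa => -> //.
  - apply: measurable_funD; first exact: measurable_translation.
    exact: measurable_funM.
  - move=> z; under eq_fun do rewrite /diff EFinD mulN1r EFinN.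
    by apply: integrableD => //; apply: integrableN.
  - move=> z; rewrite /diff !FE mulN1r -RintegralB; [|exact: measurableT|exact: intf|exact: intf].
    by apply: eq_Rintegral => y _; rewrite mulN1r addrAC.
  - move=> z; rewrite -/(_ + _); exact: derivable_lipschitz.
pose u n : R := n.+1%:R^-1.
have u0 n : u n != 0 by rewrite invr_neq0.
have cF : (u n)^-1 * (partials r F (u n *: e + x) - partials r F x) @[n --> \oo] --> 'D_e (partials r F) x.
  exact: derivable_seq.
have mpr := measurable_partials r f mf hf.
have mG : measurable_fun setT (fun y : 'rV[R]_d => partials r f (x - y)) by exact: measurable_reflection.
have mGa a : measurable_fun setT (fun y : 'rV[R]_d => partials r f (a *: e + (x - y))).
  by under eq_fun do rewrite addrA; exact: measurable_reflection.
have mD : measurable_fun setT (partials (i :: r) f) by exact: measurable_partials.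
pose Q n (y : 'rV[R]_d) : R := (u n)^-1 * (partials r f (u n *: e + (x - y)) - partials r f (x - y)).
have mQ n : measurable_fun setT (Q n).
  by apply: measurable_funM => //; exact: measurable_funB.
(* The constant [M] dominates the quotients although [partials r f] itself may be unbounded. *)
have QM n y : `|Q n y| <= M.
  rewrite normrM normfV ler_pdivrMl ?normr_gt0// mulrC.
  exact: derivable_lipschitz.
have QE n : (u n)^-1 * (partials r F (u n *: e + x) - partials r F x) = \int[P]_y Q n y.
  rewrite step// RintegralZl//.
  apply: bounded_integrable; split; first exact: measurable_funB.
  by exists (M * `|u n|) => y; exact: derivable_lipschitz.
have bD : bounded_measurable (fun y : 'rV[R]_d => partial i (partials r f) (x - y)).
  by split; [exact: (measurable_reflection x (partials (i :: r) f))|exists M => y; exact: fM].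
have cQ : \int[P]_y Q n y @[n --> \oo] --> \int[P]_y partial i (partials r f) (x - y).
  have [] := @dominated_convergence _ _ R P setT measurableT (fun n y => (Q n y)%:E)
    (fun y => (partial i (partials r f) (x - y))%:E) (fun=> M%:E).
  - by move=> n; apply/measurable_EFinP.
  - by apply/measurable_EFinP; case: bD.
  - apply: aeW => y _; apply: cvg_EFin; first by near=> n.
    exact: derivable_seq.
  - exact: bounded_integrable (bounded_measurable_cst M).
  - by apply: aeW => y n _; rewrite lee_fin.
  move=> _ _; rewrite -(fineK (_ : (\int[P]_y _)%E \is a fin_num)).
    move/fine_cvg; exact.
  exact/integrable_fin_num/bounded_integrable.
have := cvg_lim (@Rhausdorff R) cF.
rewrite /partial -/e => <-.
by under eq_fun do rewrite QE; exact: cvg_lim cQ.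
Unshelve. all: by end_near. Qed.

End directional.

(** * Growth of balls and second moments *)

Section growth.
Context {R : realType}.

Lemma limf_esup_lty {T : choiceType} {X : filteredType T} (f : X -> \bar R)
    (F : set_system X) :
  (limf_esup f F < +oo)%E ->
  exists V, F V /\ exists M : R, forall x, V x -> (f x <= M%:E)%E.
Proof.
move=> /ereal_inf_lt[_ [V FV <-] Vlt]; exists V; split => //.
have fV x : V x -> (f x <= ereal_sup (f @` V))%E.
  by move=> Vx; apply: ereal_sup_ubound; exists x.
move: Vlt fV; case: (ereal_sup _) => [M _ fV|//|_ fV]; first by exists M.
by exists 0 => x /fV/le_trans; apply; exact: leNye.
Qed.

(** The finitely many terms before the limsup bound takes effect are covered by the sum of their
    absolute values. *)
Lemma limn_esup_range (u : nat -> R) :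
  (limn_esup (fun n => (u n)%:E) < +oo)%E -> has_ubound (range u).
Proof.
move=> /limf_esup_lty[V [[N _ NV] [M Mu]]].
exists (\sum_(i < N) `|u i| + `|M|) => _ [n _ <-].
have [nN|Nn] := ltnP n N.
  rewrite (bigD1 (Ordinal nN))//= -addrA (le_trans (ler_norm _))// lerDl.
  by rewrite addr_ge0// sumr_ge0.
have := Mu n (NV _ Nn); rewrite lee_fin => /le_trans; apply.
rewrite (le_trans (ler_norm _))// lerDr.
exact: sumr_ge0.
Qed.

Context {d : nat}.
Variables (P : probability 'rV[R]_d R) (X : set 'rV[R]_d).

(** The limsup controls only radii up to some [r0]; beyond it a probability is at most 1, which
    [(r0^p)^-1 * r^p] dominates. *)
Lemma ball_growth_bound (p : R) : 0 <= p -> (ball_growth P X p < +oo)%E ->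
  exists2 M, 0 <= M & forall x r, X x -> 0 < r -> (P (eball x r) <= (M * r `^ p)%:E)%E.
Proof.
move=> p0 /limf_esup_lty[V [FV [M MV]]].
move: FV => [e /= e0 eV].
pose r0 := e / 2.
have r0_gt0 : 0 < r0 by rewrite divr_gt0.
exists (Num.max M ((r0 `^ p)^-1)).
  by rewrite le_max invr_ge0 powR_ge0 orbT.
move=> x r Xx rgt0; have rp0 : 0 < r `^ p by exact: powR_gt0.
have [rr0|r0r] := leP r r0.
  have /MV : V r.
    apply: eV => //=; rewrite sub0r normrN gtr0_norm//.
    by apply: (le_lt_trans rr0); rewrite /r0; lra.
  move=> supM.
  have : (P (eball x r) * (r `^ p)^-1%:E <= M%:E)%E.
    by apply: le_trans supM; apply: ereal_sup_ubound; exists x.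
  rewrite -(@fineK _ (P (eball x r))) ?fin_num_measure//; last exact: measurable_eball.
  rewrite -EFinM !lee_fin ler_pdivrMr// => /le_trans; apply.
  by rewrite ler_wpM2r ?powR_ge0// le_max lexx.
apply: (@le_trans _ _ 1%E); first exact: probability_le1 (measurable_eball _ _).
rewrite lee_fin -ler_pdivrMr// mul1r le_max; apply/orP; right.
by rewrite lef_pV2 ?posrE ?powR_gt0// ge0_ler_powR// ?nnegrE ltW.
Qed.

(** For [r <= 1] a smaller exponent gives a larger power; for [r > 1] the trivial bound 1
    suffices. *)
Lemma ball_bound_le (p q M : R) : 0 <= q -> q <= p -> 0 <= M ->
  (forall x r, X x -> 0 < r -> (P (eball x r) <= (M * r `^ p)%:E)%E) ->
  forall x r, X x -> 0 < r -> (P (eball x r) <= (Num.max M 1 * r `^ q)%:E)%E.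
Proof.
move=> q0 qp M0 MP x r Xx r0.
have [r1|r1] := leP r 1.
  apply: le_trans (MP _ _ Xx r0) _; rewrite lee_fin ler_pM ?powR_ge0//.
    by rewrite le_max lexx.
  by rewrite /powR gt_eqF// ler_expR ler_wnM2r// ln_le0.
apply: (@le_trans _ _ 1%E); first exact: probability_le1 (measurable_eball _ _).
rewrite lee_fin -[leLHS]mul1r ler_pM//; first by rewrite le_max lexx orbT.
by rewrite -(powRr0 r) ler_powR// ltW.
Qed.

Lemma vol_dim_ge0 (dv : R) : vol_dim P X = dv%:E -> 0 <= dv.
Proof.
move=> dvE; have : (-oo < vol_dim P X)%E by rewrite dvE ltNyr.
move=> /ereal_sup_gt[_ [p [p0 pP] <-] _].
have : (p%:E <= vol_dim P X)%E by apply: ereal_sup_ubound; exists p.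
by rewrite dvE lee_fin; exact: le_trans.
Qed.

(** The supremum defining [vol_dim] need not be attained, so a positive [eps] is spent to find an
    admissible exponent above [dv - eps]. With [eps = 0] and [dv = 0] the bound is just that of a
    probability by 1. *)
Lemma vol_dim_ball_bound (dv eps : R) : vol_dim P X = dv%:E ->
  (0 < eps < dv) \/ (eps = 0 /\ (dv = 0 \/ (ball_growth P X dv < +oo)%E)) ->
  exists2 M, 0 <= M &
    forall x r, X x -> 0 < r -> (P (eball x r) <= (M * r `^ (dv - eps))%:E)%E.
Proof.
move=> dvE; have dv0 := vol_dim_ge0 _ dvE.
case=> [/andP[e0 edv]|[-> [->|]]].
- have : ((dv - eps)%:E < vol_dim P X)%E by rewrite dvE lte_fin; lra.
  move=> /ereal_sup_gt[_ [p [p0 pP] <-]]; rewrite lte_fin => ep.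
  have [M M0 MP] := ball_growth_bound _ p0 pP.
  exists (Num.max M 1); first by rewrite le_max M0.
  by apply: ball_bound_le MP => //; lra.
- exists 1 => // x r Xx r0; rewrite subr0 powRr0 mul1r.
  exact: probability_le1 (measurable_eball _ _).
- by move=> ?; rewrite subr0; exact: ball_growth_bound.
Qed.

End growth.

Section tail.
Context {R : realType}.

(** The absolute value in the exponent treats increasing and decreasing powers together, since
    [dv - 1] may be negative. *)
Lemma powR_dyadic_ge (q t T : R) : 0 < T -> T / 2 < t <= T ->
  2 `^ (- `|q|) * T `^ q <= t `^ q.
Proof.
move=> T0 /andP[Tt tT]; have t0 : 0 < t by lra.
rewrite /powR !gt_eqF// -expRD ler_expR.
have ln_le : ln t <= ln T by rewrite ler_ln.
have ln_ge : ln T - ln 2 <= ln t by rewrite -ln_div ?ler_ln ?posrE// ?ltW// divr_gt0.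
have ln20 : 0 < ln (2 : R) by rewrite ln_gt0// ltr1n.
have [q0|q0] := leP 0 q; [rewrite ger0_norm//|rewrite ltr0_norm//]; nra.
Qed.

(** A condensation argument: on each dyadic interval the nonincreasing [G] is at least its value at
    the right end. *)
Lemma dyadic_series_lty (p : R) (G : R -> R) : nonincreasing_fun G ->
  (forall t, 0 <= G t) ->
  (\int[lebesgue_measure]_(t in `]0%R, +oo[) (t `^ (p - 1) * G t)%:E < +oo)%E ->
  (\sum_(j <oo) (G (2 ^+ j) * (2 ^+ j) `^ p)%:E < +oo)%E.
Proof.
move=> Gni G0 Glt.
pose I (j : nat) : set R := [set` `]2 ^+ j / 2, 2 ^+ j]%R].
have mI j : measurable (I j) by exact: measurable_itv.
have mf : measurable_fun setT (fun t : R => (t `^ (p - 1) * G t)%:E).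
  apply/measurable_EFinP; apply: measurable_funM; first exact: measurable_powR.
  exact: nonincreasing_measurable.
have f0 t : (0 <= (t `^ (p - 1) * G t)%:E)%E by rewrite lee_fin mulr_ge0 ?powR_ge0.
have tI : trivIset setT I.
  apply: ltn_trivIset => i j ij; apply/seteqP; split => // t [].
  rewrite /I /= !in_itv/= => /andP[_ ti] /andP[tj _].
  suff : (2 : R) ^+ j * 2 <= 2 ^+ i by move: ti tj; set p2 := 2 ^+ i; lra.
  by rewrite -exprSr ler_weXn2l ?ler1n.
have IS : \bigcup_j I j `<=` `]0, +oo[%classic.
  move=> t [j _]; rewrite /I /= !in_itv/= andbT => /andP[+ _]; apply: lt_trans.
  by rewrite divr_gt0// exprn_gt0.
have mU : measurable (\bigcup_j I j) by exact: bigcupT_measurable.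
(* The factor 1/2 is the length of the interval relative to its right end; the power is the loss in
   [powR_dyadic_ge]. *)
pose k := 2 `^ (- `|p - 1|) / 2 : R.
have k0 : 0 < k by rewrite divr_gt0// powR_gt0.
have le j : (k%:E * (G (2 ^+ j) * (2 ^+ j) `^ p)%:E <=
    \int[lebesgue_measure]_(t in I j) (t `^ (p - 1) * G t)%:E)%E.
  have T0 : 0 < (2 : R) ^+ j by rewrite exprn_gt0.
  apply: (@le_trans _ _ (\int[lebesgue_measure]_(t in I j)
     (cst (2 `^ (- `|p - 1|) * (2 ^+ j) `^ (p - 1) * G (2 ^+ j))%:E) t)%E).
    rewrite integral_cst; last exact: mI.
    rewrite [X in (_ <= _ * X)%E](_ : _ = (2 ^+ j - 2 ^+ j / 2)%:E); last first.
      by rewrite [LHS]lebesgue_measure_itv/= lte_fin ifT//; move: T0; set T := 2 ^+ j; lra.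
    rewrite -!EFinM lee_fin powRB; last by apply/implyP => _; rewrite gt_eqF.
    rewrite powRr1 ?(ltW T0)// /k.
    move: (G _) (2 `^ _) ((2 ^+ j) `^ p) (lt0r_neq0 T0) => a b c Tn0.
    rewrite le_eqVlt; apply/orP; left; apply/eqP.
    by field.
  apply: ge0_le_integral => //.
  - exact: mI.
  - by move=> t _; rewrite lee_fin !mulr_ge0 ?powR_ge0.
  - exact: measurable_funTS.
  - move=> t; rewrite /I /= in_itv/= => tI'; rewrite lee_fin ler_pM ?mulr_ge0 ?powR_ge0//.
      exact: powR_dyadic_ge.
    by apply: Gni; case/andP: tI'.
have {}le : (k%:E * \sum_(j <oo) (G (2 ^+ j) * (2 ^+ j) `^ p)%:E < +oo)%E.
  rewrite -nneseriesZl; last by move=> j _; rewrite lee_fin mulr_ge0 ?powR_ge0.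
  apply: le_lt_trans Glt; apply: (@le_trans _ _ (\int[lebesgue_measure]_(t in
     \bigcup_j I j) (t `^ (p - 1) * G t)%:E)%E); last first.
    by apply: ge0_subset_integral => //; exact: measurable_funTS.
  rewrite ge0_integral_bigcup//; last exact: measurable_funTS.
  by apply: lee_nneseries => // j _ _; rewrite -EFinM lee_fin !mulr_ge0 ?powR_ge0 ?(ltW k0).
rewrite ltey; apply: contraTN le => /eqP ->.
by rewrite gt0_muley ?lte_fin// ltxx.
Qed.

Context {d : nat}.

(** Positive dimension makes every tail set nonempty; the supremum of the empty set would be
    [-oo]. *)
Lemma tail_sup_EFin (f : 'rV[R]_d -> R) (B : R) : (0 < d)%N ->
  (forall x, 0 <= f x <= B) ->
  exists G : R -> R, [/\ forall t, tail_sup f t = (G t)%:E, nonincreasing_fun G,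
    forall t, 0 <= G t & forall x t, t <= enorm x -> f x <= G t].
Proof.
move=> d0 fB.
have ex t : exists x : 'rV[R]_d, t <= enorm x.
  exists (`|t| *: delta_mx ord0 (Ordinal d0)); rewrite enormZ// /enorm.
  rewrite (bigD1 (Ordinal d0))//= mxE !eqxx expr1n big1 ?addr0 ?sqrtr1 ?mulr1 ?ler_norm//.
  by move=> i /negbTE ni; rewrite mxE ni expr0n.
have fin t : exists G : R, tail_sup f t = G%:E /\ 0 <= G.
  have [x tx] := ex t.
  have l : (0 <= tail_sup f t)%E.
    apply: (@le_trans _ _ (f x)%:E); first by rewrite lee_fin; case/andP: (fB x).
    by apply: ereal_sup_ubound; exists x.
  have u : (tail_sup f t <= B%:E)%E.
    by apply: ge_ereal_sup => _ [y _ <-]; rewrite lee_fin; case/andP: (fB y).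
  by move: (tail_sup f t) l u => [G|//|//] ? _; exists G.
have [G GE] := choice fin.
have Gle x t : t <= enorm x -> f x <= G t.
  move=> tx; rewrite -lee_fin -(GE t).1.
  by apply: ereal_sup_ubound; exists x.
exists G; split => //; [by move=> t; case: (GE t)| |by move=> t; case: (GE t)].
move=> s t st; rewrite -lee_fin -(GE s).1 -(GE t).1.
apply: ge_ereal_sup => _ [x /= tx <-]; rewrite (GE s).1 lee_fin.
by apply: Gle; exact: le_trans tx.
Qed.

Variables (P : probability 'rV[R]_d R) (X : set 'rV[R]_d).

(** After rescaling, points of the shell [2^j <= enorm u < 2^(j+1)] contribute at most [G (2^j)] and
    lie in the ball of radius [h * 2^(j+1)]; the integral condition sums the resulting series
    because [a <= dv]. *)
Lemma second_moment_exists (f : 'rV[R]_d -> R) (b a dv M : R) :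
  measurable_fun setT f -> (forall x, `|f x| <= b) -> 0 <= a <= dv -> 0 <= M ->
  (forall x r, X x -> 0 < r -> (P (eball x r) <= (M * r `^ a)%:E)%E) ->
  (\int[lebesgue_measure]_(t in `]0%R, +oo[)
     ((t `^ (dv - 1)%R)%:E * tail_sup (fun x => f x ^+ 2)%R t) < +oo)%E ->
  exists C : R, second_moment_bound P X f a C.
Proof.
move=> mf fb /andP[a0 adv] M0 PM flt.
have b0 : 0 <= b by exact: le_trans (fb 0).
have f2b x : 0 <= f x ^+ 2 <= b ^+ 2.
  by rewrite sqr_ge0/= -(real_normK (num_real (f x))) lerXn2r// nnegrE.
have mfu x h : measurable_fun setT (fun y : 'rV[R]_d => f (h^-1 *: (x - y))).
  apply: (measurableT_comp mf).
  exact: measurable_affine.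
have mfu2 x h : measurable_fun setT (fun y : 'rV[R]_d => (f (h^-1 *: (x - y)) ^+ 2)%:E).
  by apply/measurable_EFinP; exact: measurable_funX.
(* In dimension 0 the space is one point, so the ball of radius [h] has full mass and
   [1 <= M * h^a]. *)
have [d0|d0] := leqP d 0.
  exists (b ^+ 2 * M) => x h Xx h0.
  apply: (@le_trans _ _ (\int[P]_y (cst (b ^+ 2)%:E) y)%E).
    apply: ge0_le_integral => // y _; rewrite lee_fin ?sqr_ge0//.
    by case/andP: (f2b (h^-1 *: (x - y))).
  rewrite integral_cst// -mulrA (EFinM (b ^+ 2)) lee_wpmul2l ?lee_fin ?sqr_ge0//.
  apply: le_trans (PM _ _ Xx h0); rewrite le_measure ?inE//; first exact: measurable_eball.
  move=> y _; rewrite /eball /= /enorm big1 ?sqrtr0// => i _.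
  by have := leq_trans (ltn_ord i) d0.
have [G [GE Gni G0 Gf]] := tail_sup_EFin (fun x => f x ^+ 2) _ d0 f2b.
have Slt : (\sum_(j <oo) (G (2 ^+ j) * (2 ^+ j) `^ dv)%:E < +oo)%E.
  apply: dyadic_series_lty => //; apply: le_lt_trans flt.
  by rewrite le_eqVlt; apply/orP; left; apply/eqP/eq_integral => t _; rewrite GE EFinM.
move: Slt; set S := (\sum_(j <oo) _)%E => Slt.
have S0 : (0 <= S)%E by apply: nneseries_ge0 => j _ _; rewrite lee_fin mulr_ge0 ?powR_ge0.
have SE : S = (fine S)%:E by rewrite fineK// ge0_fin_numE.
(* The first term comes from the ball of radius [h], the second from the shells outside it. *)
exists (b ^+ 2 * M + M * 2 `^ a * fine S) => x h Xx h0.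
have mB (r : R) : measurable_fun setT (fun y : 'rV[R]_d => (\1_(eball x r) y)%:E : \bar R).
  by apply/measurable_EFinP; apply: measurable_indic; exact: measurable_eball.
have mg (c r : R) : measurable_fun setT (fun y : 'rV[R]_d => (c * \1_(eball x r) y)%:E : \bar R).
  apply/measurable_EFinP; apply: measurable_funM => //.
  by apply: measurable_indic; exact: measurable_eball.
have g0 (c r : R) y : 0 <= c -> (0 <= (c * \1_(eball x r) y)%:E :> \bar R)%E.
  by move=> c0; rewrite lee_fin mulr_ge0.
have ig (c r : R) : 0 <= c -> 0 < r ->
    (\int[P]_y (c * \1_(eball x r) y)%:E <= (c * (M * r `^ a))%:E)%E.
  move=> c0 r0; under eq_integral do rewrite EFinM.
  rewrite ge0_integralZl_EFin//.
  rewrite integral_indic//; last exact: measurable_eball.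
  by rewrite setIT EFinM lee_wpmul2l ?lee_fin// PM.
have rj j : 0 < h * 2 ^+ j.+1 by rewrite mulr_gt0// exprn_gt0.
apply: (@le_trans _ _ (\int[P]_y ((b ^+ 2 * \1_(eball x h) y)%:E +
    \sum_(j <oo) (G (2 ^+ j) * \1_(eball x (h * 2 ^+ j.+1)) y)%:E))%E).
  apply: ge0_le_integral => //.
  - by move=> y _; rewrite lee_fin sqr_ge0.
  - apply: emeasurable_funD; first exact: mg.
    by apply: ge0_emeasurable_sum => // j y _ _; exact: g0.
  move=> y _; set u := h^-1 *: (x - y).
  have uE : enorm (y - x) = h * enorm u.
    by rewrite -[LHS]enormN opprB /u enormZ ?invr_ge0 ?ltW// mulrA divff ?mul1r// gt_eqF.
  have ex : exists n, enorm u < 2 ^+ n.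
    exists (Num.bound (enorm u)); apply: (lt_trans (archi_boundP (enorm_ge0 u))).
    by rewrite -natrX ltr_nat ltn_expl.
  (* A minimal exponent 0 means the central ball, a minimal exponent [n + 1] the shell of index
     [n]. *)
  have [n un nmin] := ex_minnP ex.
  have ser0 : (0 <= \sum_(j <oo) (G (2 ^+ j) * \1_(eball x (h * 2 ^+ j.+1)) y)%:E)%E.
    by apply: nneseries_ge0 => j _ _; exact: g0.
  case: n => [|n] in un nmin *.
    rewrite -[leLHS]adde0 leeD// lee_fin -[leLHS]mulr1 ler_pM ?sqr_ge0//.
      by case/andP: (f2b u).
    rewrite indicE mem_set// /eball /= uE.
    by rewrite -[ltRHS]mulr1 ltr_pM2l.
  rewrite -[leLHS]add0e leeD//; first by apply: g0; exact: sqr_ge0.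
  apply: (le_trans _ (nneseries_lim_ge n.+1 _)) => [|j _ _]; last exact: g0.
  rewrite big_nat_recr//= -[leLHS]add0e leeD//.
    by apply: sume_ge0 => j _; exact: g0.
  rewrite indicE mem_set ?mulr1; last by rewrite /eball /= uE ltr_pM2l.
  rewrite lee_fin Gf// leNgt; apply/negP => /nmin; by rewrite ltnn.
rewrite ge0_integralD//; last 3 first.
- by move=> y _; apply: g0; exact: sqr_ge0.
- by move=> y _; apply: nneseries_ge0 => j _ _; exact: g0.
- by apply: ge0_emeasurable_sum => // j y _ _; exact: g0.
rewrite integral_nneseries//; last by move=> j y _; exact: g0.
rewrite mulrDl EFinD leeD//.
  by rewrite -mulrA ig// sqr_ge0.
apply: (@le_trans _ _ (\sum_(j <oo) ((M * 2 `^ a * h `^ a)%:E * (G (2 ^+ j) * (2 ^+ j) `^ dv)%:E))%E).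
  apply: lee_nneseries => [j _ _|j _].
    by apply: integral_ge0 => y _; exact: g0.
  apply: le_trans (ig _ _ (G0 _) (rj j)) _.
  rewrite -EFinM lee_fin powRM ?exprn_ge0 ?(ltW h0)// exprS powRM ?exprn_ge0//.
  have : (2 ^+ j) `^ a <= (2 ^+ j) `^ dv :> R.
    by rewrite ler_powR// -[leLHS](expr1n R j) lerXn2r ?nnegrE ?ler1n.
  have := G0 (2 ^+ j); have := powR_ge0 2 a; have := powR_ge0 h a.
  move: (G _) (_ `^ dv) ((2 ^+ j) `^ a) (2 `^ a) (h `^ a) => g v w p q q0 p0 g0' wv.
  have -> : g * (M * (q * (p * w))) = (M * p * q) * (g * w) by ring.
  by rewrite ler_wpM2l ?mulr_ge0// ler_wpM2l.
rewrite nneseriesZl; last by move=> j _; rewrite lee_fin mulr_ge0 ?powR_ge0.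
by rewrite -/S SE -EFinM lee_fin mulrAC.
Qed.

End tail.

(** * Covering numbers and kernel deviations *)

Section empirical_measure.
Context {disp} {T : measurableType disp} {R : realType}.

(** The uniform measure on the sample has mass 1 already; normalizing only packages it as a
    probability, with an arbitrary Dirac measure as fallback. *)
Lemma empirical_probability (N : nat) (z : 'I_N.+1 -> T) :
  exists Q : probability T R, forall f : T -> R,
    measurable_fun setT f -> (forall y, 0 <= f y) ->
    (\int[Q]_y (f y)%:E)%E = (N.+1%:R^-1 * \sum_i f (z i))%:E.
Proof.
have N0 : 0 <= N.+1%:R^-1 :> R by rewrite invr_ge0.
pose dm i : {measure set T -> \bar R} := \d_(z (inord i)).
pose m : {measure set T -> \bar R} := mscale (NngNum N0) (msum dm N.+1).
have intm (f : T -> R) : measurable_fun setT f -> (forall y, 0 <= f y) ->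
    (\int[m]_y (f y)%:E)%E = (N.+1%:R^-1 * \sum_i f (z i))%:E.
  move=> mf f0; have mEf : measurable_fun setT (EFin \o f) by exact/measurable_EFinP.
  rewrite ge0_integral_mscale//=; last by move=> y _; rewrite lee_fin.
  rewrite ge0_integral_measure_sum//; last by move=> y _; rewrite lee_fin.
  rewrite EFinM -sumEFin; congr (_ * _)%E; apply: eq_bigr => i _.
  by rewrite /dm integral_dirac// diracT mul1e inord_val.
have mT : m setT = 1%E.
  rewrite /m /= /mscale /= /msum /=.
  under eq_bigr do rewrite diracT.
  by rewrite sumEFin sumr_const card_ord -EFinM mulVf// pnatr_eq0.
pose Q : probability T R := mnormalize m \d_(z ord0).
exists Q => f mf f0; rewrite -intm//.
apply: eq_measure_integral => A _ _.
by rewrite /Q /= /mnormalize mT onee_eq0/= invr1 mule1.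
Qed.

End empirical_measure.

Section nets.
Context {R : realType} {d : nat}.

Lemma L2dist_empirical (N : nat) (z : 'I_N.+1 -> 'rV[R]_d) (Q : probability 'rV[R]_d R)
    (f g : 'rV[R]_d -> R) (eta : R) :
  (forall f : 'rV[R]_d -> R,
    measurable_fun setT f -> (forall y, 0 <= f y) ->
    (\int[Q]_y (f y)%:E)%E = (N.+1%:R^-1 * \sum_i f (z i))%:E) ->
  measurable_fun setT f -> measurable_fun setT g -> 0 <= eta ->
  (L2dist Q f g < eta%:E)%E ->
  N.+1%:R^-1 * \sum_i (f (z i) - g (z i)) ^+ 2 <= eta ^+ 2.
Proof.
move=> Qint mf mg eta0; rewrite /L2dist unlock /=.
under eq_integral => y _.
  rewrite /= (_ : `|f y - g y| `^ 2 = (f y - g y) ^+ 2)//; last first.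
    by rewrite (powR_mulrn 2)// real_normK// num_real.
  over.
rewrite Qint; last 2 first.
- by apply: measurable_funX; exact: measurable_funB.
- by move=> y; exact: sqr_ge0.
set v := _ * _.
have v0 : 0 <= v by rewrite mulr_ge0 ?invr_ge0// sumr_ge0// => i _; exact: sqr_ge0.
rewrite poweR_EFin lte_fin powR12_sqrt// => /ltW h.
by rewrite -(sqr_sqrtr v0) lerXn2r// nnegrE sqrtr_ge0.
Qed.

(** The extra 1 makes the bound strict, so that an actual cover can be extracted from the
    infimum. *)
Lemma VC_empirical_net (F : set ('rV[R]_d -> R)) (b A nu eta : R) (N : nat)
    (z : 'I_N.+1 -> 'rV[R]_d) :
  VC_class F b A nu -> (forall f, F f -> measurable_fun setT f) -> 0 < eta < b ->
  exists m (c : 'I_m -> 'rV[R]_d -> R),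
    [/\ m%:R <= (A * b / eta) `^ nu + 1, forall j, F (c j) &
     forall f, F f -> exists j,
       N.+1%:R^-1 * \sum_i (f (z i) - c j (z i)) ^+ 2 <= eta ^+ 2].
Proof.
move=> [A0 nu0 FN] mF eb.
have [Q Qint] := @empirical_probability _ _ R _ z.
have : (covering_number F Q eta < ((A * b / eta) `^ nu + 1)%:E)%E.
  by apply: le_lt_trans (FN Q eta eb) _; rewrite lte_fin ltrDl.
move=> /ereal_inf_lt[_ [m [c [Fc Fm]] <-]].
rewrite lte_fin => /ltW mle; exists m, c; split => // f Ff.
have [j fj] := Fm f Ff; exists j.
apply: (L2dist_empirical _ _ _ _ _ _ Qint) fj; [exact: mF|exact: mF|].
by case/andP: eb => /ltW.
Qed.

End nets.

Section scaled_net.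
Context {R : realType} {d : nat}.

(** Absorbs the number of grid points for the scaling factor into the polynomial bound, at the cost
    of 2 in the exponent. *)
Lemma count_bound (A nu x y : R) : 0 < A -> 0 < nu -> 0 <= x <= y -> 2 <= y ->
  ((A * x) `^ nu + 1) * y <= ((A + 1) * y) `^ (nu + 2).
Proof.
move=> A0 nu0 /andP[x0 xy] y2; set z := (A + 1) * y.
have zy : y <= z by rewrite /z; nra.
have z2 : 2 <= z by lra.
have le1 : (A * x) `^ nu <= z `^ nu.
  have z0 : 0 <= z by lra.
  have Axz : A * x <= z by rewrite /z; nra.
  by rewrite ge0_ler_powR// ?nnegrE ?mulr_ge0 ?(ltW A0) ?(ltW nu0).
have ge1 : 1 <= z `^ nu by rewrite -(powRr0 z) ler_powR ?(ltW nu0)//; lra.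
have -> : z `^ (nu + 2) = z `^ nu * (z * z).
  rewrite powRD; last by apply/implyP => _; rewrite gt_eqF//; lra.
  by rewrite (powR_mulrn 2)//; lra.
move: le1 ge1; set p := _ `^ nu; set q := _ `^ nu => le1 ge1.
apply: (@le_trans _ _ ((q * z) * z)); last by rewrite mulrA.
apply: ler_pM => //; [by have := powR_ge0 (A * x) nu; rewrite -/p; lra|lra|nra].
Qed.

(** The weights [(l / h)^m] range over [0, 1]. Multiplying a net by a grid of scalars covers all
    multiples [r * f], with error [rho / 2] allotted to [r] and [rho / 2] to [f]. *)
Lemma scaled_net (F : set ('rV[R]_d -> R)) (b A nu rho : R) (N : nat)
    (z : 'I_N.+1 -> 'rV[R]_d) :
  VC_class F b A nu -> (forall f, F f -> measurable_fun setT f) ->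
  (forall f y, F f -> `|f y| <= b) -> 0 < b -> 0 < rho ->
  exists m (c : 'I_m -> 'rV[R]_d -> R),
    [/\ m%:R <= ((A + 1) * (2 * b / rho + 2)) `^ (nu + 2), forall j y, `|c j y| <= b &
     forall f r, F f -> 0 <= r <= 1 -> exists j,
       N.+1%:R^-1 * \sum_i (r * f (z i) - c j (z i)) ^+ 2 <= rho ^+ 2].
Proof.
move=> VC mF Fb b0 rho0; have [A0 nu0 _] := VC.
(* The minimum with [b / 2] keeps [eta] in the range where the covering bound is assumed. *)
pose eta := Num.min (rho / 2) (b / 2).
have eta0 : 0 < eta by rewrite lt_min !divr_gt0.
have etab : 0 < eta < b by rewrite eta0 gt_min; apply/orP; right; lra.
have [m [c [mle Fc Fnet]]] := VC_empirical_net _ _ _ _ _ _ z VC mF etab.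
pose w := 2 * b / rho.
have w0 : 0 < w by rewrite !mulr_gt0 ?invr_gt0.
(* More than [2 * b / rho] grid steps, so that rounding [r] down moves [r * f] by at most
   [rho / 2]. *)
pose q := (Num.truncn w).+1.
have wq : w < q%:R by exact: truncnS_gt.
have qw : q%:R <= w + 1 by rewrite /q -natr1 lerD2r truncn_le// ltW.
have q0 : (0 : R) < q%:R by rewrite ltr0n.
pose T : finType := ('I_q.+1 * 'I_m)%type.
exists #|T|, (fun j y => ((enum_val j : T).1 : nat)%:R / q%:R * c (enum_val j : T).2 y); split.
- rewrite card_prod !card_ord natrM mulrC.
  apply: (@le_trans _ _ (((A * b / eta) `^ nu + 1) * (w + 2))).
    by rewrite ler_pM// -natr1; lra.
  rewrite -mulrA; apply: count_bound => //; last by lra.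
  rewrite divr_ge0 ?(ltW b0) ?(ltW eta0)//= ler_pdivrMr//.
  have -> : eta = Num.min (rho / 2) (b / 2) by [].
  have wr : w * rho = 2 * b by rewrite /w -mulrA mulVf ?mulr1// gt_eqF.
  by case: (leP (rho / 2) (b / 2)) => _; nra.
- move=> j y; rewrite normrM -[leRHS]mul1r ler_pM//; last exact: Fb.
  rewrite ger0_norm ?divr_ge0// ler_pdivrMr// mul1r ler_nat -ltnS.
  exact: ltn_ord.
move=> f r Ff /andP[r0 r1]; have [j fj] := Fnet f Ff.
have rq0 : 0 <= r * q%:R by rewrite mulr_ge0// ltW.
pose i := Num.truncn (r * q%:R).
have iq : (i < q.+1)%N.
  rewrite ltnS -(@ler_nat R); apply: (@le_trans _ _ (r * q%:R)); first by rewrite truncn_le.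
  by rewrite ler_piMl// ltW.
exists (enum_rank ((Ordinal iq, j) : T)); rewrite enum_rankK /=.
have il : i%:R <= r * q%:R by rewrite truncn_le.
have iu : r * q%:R < i%:R + 1 by rewrite natr1; exact: truncnS_gt.
set s := i%:R / q%:R.
have sq : s * q%:R = i%:R by rewrite /s -mulrA mulVf ?mulr1// gt_eqF.
have s0 : 0 <= s by rewrite divr_ge0.
have sr : s <= r by rewrite -(ler_pM2r q0) sq.
have rs : (r - s) * q%:R <= 1 by rewrite mulrBl sq; lra.
have bq : (r - s) * b <= rho / 2.
  have wr : w * rho = 2 * b by rewrite /w -mulrA mulVf ?mulr1// gt_eqF.
  have : (r - s) * w <= 1 by apply: le_trans rs; rewrite ler_wpM2l ?subr_ge0// ltW.
  by move: wr; set v := r - s => wr vw; nra.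
have pt k : (r * f (z k) - s * c j (z k)) ^+ 2 <=
    2 * (rho / 2) ^+ 2 + 2 * (f (z k) - c j (z k)) ^+ 2.
  have -> : r * f (z k) - s * c j (z k) = (r - s) * f (z k) + s * (f (z k) - c j (z k)) by ring.
  have h1 : ((r - s) * f (z k)) ^+ 2 <= (rho / 2) ^+ 2.
    rewrite -(real_normK (num_real (_ * f _))) lerXn2r ?nnegrE// ?divr_ge0 ?(ltW rho0)//.
    rewrite normrM ger0_norm ?subr_ge0//; apply: le_trans bq.
    by rewrite ler_wpM2l ?subr_ge0// Fb.
  have h2 : (s * (f (z k) - c j (z k))) ^+ 2 <= (f (z k) - c j (z k)) ^+ 2.
    rewrite exprMn ler_piMl ?sqr_ge0// expr_le1//; lra.
  move: h1 h2; set u := _ * f _; set v := s * _; set v' := f _ - _ => h1 h2.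
  have := sqr_ge0 (u - v); nra.
apply: (@le_trans _ _ (2 * (rho / 2) ^+ 2 + 2 * eta ^+ 2)); last first.
  have e1 : eta <= rho / 2 by rewrite ge_min lexx.
  have e2 : eta ^+ 2 <= (rho / 2) ^+ 2 by rewrite lerXn2r ?nnegrE ?(ltW eta0)// divr_ge0 ?(ltW rho0).
  have -> : rho ^+ 2 = 4 * (rho / 2) ^+ 2 by field.
  by move: e2; set v := eta ^+ 2; set v' := (rho / 2) ^+ 2; lra.
apply: (@le_trans _ _ (N.+1%:R^-1 * \sum_k (2 * (rho / 2) ^+ 2 + 2 * (f (z k) - c j (z k)) ^+ 2))).
  by rewrite ler_wpM2l ?invr_ge0// ler_sum.
rewrite big_split/= sumr_const card_ord -mulr_sumr mulrDr.
rewrite -[X in N.+1%:R^-1 * X + _]mulr_natl (mulrA _ N.+1%:R) mulVf ?pnatr_eq0// mul1r.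
by rewrite lerD2l mulrCA ler_wpM2l.
Qed.

(** The pairs are flattened to a sample of [2 * n] points; changing the divisor from [2 * n] to [n]
    doubles the bound. *)
Lemma paired_net (F : set ('rV[R]_d -> R)) (b A nu rho : R) (n : nat)
    (z : n.-tuple ('rV[R]_d * 'rV[R]_d)) : (0 < n)%N ->
  VC_class F b A nu -> (forall f, F f -> measurable_fun setT f) ->
  (forall f y, F f -> `|f y| <= b) -> 0 < b -> 0 < rho ->
  exists m (c : 'I_m -> 'rV[R]_d -> R),
    [/\ m%:R <= ((A + 1) * (2 * b / rho + 2)) `^ (nu + 2), forall j y, `|c j y| <= b &
     forall f r, F f -> 0 <= r <= 1 -> exists j,
       n%:R^-1 * \sum_(i < n) ((r * f (tnth z i).1 - c j (tnth z i).1) ^+ 2 +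
                              (r * f (tnth z i).2 - c j (tnth z i).2) ^+ 2) <= 2 * rho ^+ 2].
Proof.
case: n z => // n z _ VC mF Fb b0 rho0.
pose zz (i : 'I_(n.+1 + n.+1)) :=
  match fintype.split i with inl j => (tnth z j).1 | inr j => (tnth z j).2 end.
have [m [c [mle cb net]]] := scaled_net _ _ _ _ _ (n + n.+1) zz VC mF Fb b0 rho0.
exists m, c; split => // f r Ff r01; have [j] := net f r Ff r01.
exists j; move: p => {net}.
rewrite -[(n + n.+1).+1]/(n.+1 + n.+1)%N big_split_ord/= big_split/=.
under eq_bigr do rewrite /zz (unsplitK (inl _ _)).
under [X in _ * (_ + X)]eq_bigr do rewrite /zz (unsplitK (inr _ _)).
set S1 := \sum_(i < n.+1) _; set S2 := \sum_(i < n.+1) _.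
rewrite natrD; have : (0 : R) < n.+1%:R by rewrite ltr0n.
move: (n.+1%:R : R) => N N0.
have -> : (N + N)^-1 = N^-1 / 2 by field; lra.
by rewrite -mulrA mulrCA; set S := N^-1 * _; lra.
Qed.

End scaled_net.

Section kernel_deviation.
Context {R : realType} {d : nat}.

(** Bounds, per unit of [lam * (k + 1)], the logarithm of the cardinality of the level-[k] net;
    additive constants are absorbed through [1 <= 2 * lam]. *)
Definition entropy_const (A nu a : R) : R := (nu + 2) * (2 * A + 6 + a).

(** The three summands serve the second moments, the bound on [b / sigma] in [entropy_bound], and
    the hypothesis [n_large] of [deviation], where [L] enters. *)
Definition variance_const (A b nu a C L : R) : R :=
  `|C| + b ^+ 2 + 16 * b ^+ 2 * (5 * entropy_const A nu a + 4) * L.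

(** The factor [16 * 27] is that of [deviation]; the last root comes from [2 * cH * lam + 4 * lam +
    1 <= (2 * cH + 6) * lam], with [cH] the entropy constant. *)
Definition deviation_const (A b nu a C L : R) : R :=
  16 * 27 * Num.sqrt (variance_const A b nu a C L) *
  Num.sqrt (2 * entropy_const A nu a + 6).

Lemma entropy_bound (A nu a b l lam sigma : R) (k : nat) : 0 < A -> 0 < nu -> 0 <= a ->
  0 < b -> 0 < l -> Num.max (ln l^-1) 0 <= lam -> 1 <= 2 * lam ->
  0 < sigma -> b ^+ 2 * l `^ a <= sigma ^+ 2 ->
  ((A + 1) * (2 * b / (4 * sigma / 2 ^+ k) + 2)) `^ (nu + 2) <=
  expR (entropy_const A nu a * lam * k.+1%:R).
Proof.
move=> A0 nu0 a0 b0 l0 llam lam1 sigma0 bs.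
have q0 : 0 < l `^ a by exact: powR_gt0.
have e2 : 2 <= expR (1 : R) by have := expR_ge1Dx (1 : R); lra.
(* [(b / sigma)^2] is at most [l^(-a)], hence at most [expR (a * lam)]; as this is at least 1, it
   also bounds [b / sigma] itself. *)
have blt : b / sigma <= expR (a * lam).
  have : (b / sigma) ^+ 2 <= l `^ (- a).
    rewrite expr_div_n ler_pdivrMr ?exprn_gt0// powRN mulrC ler_pdivlMr//.
  have -> : l `^ (- a) = expR (a * ln l^-1) by rewrite /powR gt_eqF// lnV// mulrN mulNr.
  move=> h; have h2 : (b / sigma) ^+ 2 <= expR (a * lam).
    apply: (le_trans h); rewrite ler_expR ler_wpM2l//.
    by apply: le_trans llam; rewrite le_max lexx.
  have e1 : 1 <= expR (a * lam) by rewrite -expR0 ler_expR mulr_ge0//; lra.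
  have r0 : 0 < b / sigma by rewrite divr_gt0.
  move: h2 e1 r0; set r := b / sigma; set e := expR _ => h2 e1 r0.
  nra.
have bk : 2 * b / (4 * sigma / 2 ^+ k) + 2 <= expR (a * lam + k%:R + 2).
  have -> : 2 * b / (4 * sigma / 2 ^+ k) = b / sigma * 2 ^+ k / 2.
    by field; rewrite gt_eqF//= gt_eqF// exprn_gt0.
  rewrite !expRD.
  have p1 : 1 <= (2 : R) ^+ k by rewrite exprn_ege1// ler1n.
  have pk : (2 : R) ^+ k <= expR k%:R by rewrite -[k%:R]mulr1 expRM_natl lerXn2r// nnegrE ltW.
  have e1 : 1 <= expR (a * lam) by rewrite -expR0 ler_expR mulr_ge0//; lra.
  have e4 : 4 <= expR (1 : R) * expR 1 by nra.
  have r0 : 0 < b / sigma by rewrite divr_gt0.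
  move: blt p1 pk e1 e4 r0; set r := b / sigma; set e := expR (a * lam); set f := expR k%:R.
  set p := 2 ^+ k; set e' := expR 1 * expR 1 => blt p1 pk e1 e4 r0.
  have h1 : r * p <= e * f by apply: ler_pM => //; lra.
  have h2 : 1 <= e * f by nra.
  nra.
have A1 : A + 1 <= expR A by rewrite addrC expR_ge1Dx.
have b0' : 0 <= 2 * b / (4 * sigma / 2 ^+ k) + 2.
  have s4 : 0 <= 4 * sigma / 2 ^+ k by rewrite divr_ge0 ?exprn_ge0//; lra.
  by rewrite addr_ge0// divr_ge0//; lra.
apply: (@le_trans _ _ (expR (A + (a * lam + k%:R + 2)) `^ (nu + 2))).
  rewrite ge0_ler_powR// ?nnegrE ?mulr_ge0//; try lra.
  by rewrite expRD ler_pM//; lra.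
rewrite {1}/powR gt_eqF ?expR_gt0// expRK ler_expR /entropy_const -!mulrA ler_wpM2l//; first by lra.
have k0 : (0 : R) <= k%:R by [].
rewrite -[k.+1%:R]natr1; move: (k%:R : R) k0 => K K0.
have : 0 <= A * K * lam by rewrite !mulr_ge0//; lra.
have : 0 <= a * K * lam by rewrite !mulr_ge0//; lra.
nra.
Qed.

Lemma kernel_deviation {disp} {Omega : measurableType disp}
    (P : probability 'rV[R]_d R) (Pr : probability Omega R) (n : nat)
    (Xs : 'I_n -> Omega -> 'rV[R]_d) (X : set 'rV[R]_d) (f : 'rV[R]_d -> R)
    (A nu b a l lam C L : R) (m : nat) :
  (0 < n)%N -> iid Pr P Xs -> measurable X -> measurable_fun setT f -> 0 < b ->
  (forall x, `|f x| <= b) -> 0 < l -> VC_class (kernel_class f X l) b A nu ->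
  0 <= a <= 2 * m%:R -> second_moment_bound P X f a C ->
  Num.max (ln l^-1) 0 <= lam -> 1 <= 2 * lam -> 0 <= L -> lam <= L * (n%:R * l `^ a) ->
  exists E, [/\ measurable E,
    forall (w : Omega) (h : R) (x : 'rV[R]_d), X x -> l <= h ->
      deviation_const A b nu a C L * Num.sqrt (l `^ a * lam / n%:R) <
      (l / h) ^+ m * `|emp n (fun y : 'rV[R]_d => f (h^-1 *: (x - y))) (fun i => Xs i w)
                       - \int[P]_y f (h^-1 *: (x - y))| -> E w &
    (Pr E <= (4 * expR (- (4 * lam)))%:E)%E].
Proof.
move=> n0 [mXs Xmarg Xind] mX mf b0 fb l0 VC /andP[a0 am] C_mom llam lam1 L0 lamL.
have [A0 nu0 _] := VC.
have q0 : 0 < l `^ a by exact: powR_gt0.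
have lam0 : 0 < lam by lra.
set cH := entropy_const A nu a.
have cH0 : 12 <= cH.
  rewrite /cH /entropy_const; have : 0 <= nu * (2 * A + 6 + a) by rewrite mulr_ge0//; lra.
  lra.
set M := variance_const A b nu a C L.
have t0 : 0 <= 16 * b ^+ 2 * (5 * cH + 4) * L.
  by rewrite !mulr_ge0// ?sqr_ge0//; lra.
have b20 : 0 < b ^+ 2 by rewrite exprn_gt0.
have M0 : 0 < M by rewrite /M /variance_const -/cH; have := normr_ge0 C; lra.
pose sigma := Num.sqrt (M * l `^ a).
have s2 : sigma ^+ 2 = M * l `^ a by rewrite sqr_sqrtr// mulr_ge0// ltW.
have sigma0 : 0 < sigma by rewrite sqrtr_gt0 mulr_gt0.
(* The parameter [t] encodes the pair (1 / h, x); the factor l / h is clipped to [0, 1]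
   so that the bound by [b] holds for every [t], not only on [D]. *)
pose kt (t : 'rV[R]_d.+1) := t ord0 ord0.
pose xt (t : 'rV[R]_d.+1) : 'rV[R]_d := \row_i t ord0 (lift ord0 i).
pose ct (t : 'rV[R]_d.+1) := Num.min `|l * kt t| 1.
pose g (t : 'rV[R]_d.+1) (y : 'rV[R]_d) := ct t ^+ m * f (kt t *: (xt t - y)).
pose D := [set t | [/\ 0 < kt t, kt t <= l^-1 & X (xt t)]].
have mkt : measurable_fun setT kt by exact: measurable_coord.
have mxt : measurable_fun setT xt.
  apply: measurable_rV => i; under eq_fun do rewrite mxE.
  exact: measurable_coord.
have ct01 t : 0 <= ct t <= 1 by rewrite le_min ge_min normr_ge0 ler01 lexx orbT.
have ctm t : 0 <= ct t ^+ m <= 1.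
  by case/andP: (ct01 t) => c0 c1; rewrite exprn_ge0//= exprn_ile1.
have DE t : D t -> ct t = l * kt t.
  move=> [k0 kl _]; have lk0 : 0 <= l * kt t by rewrite mulr_ge0// ltW.
  rewrite /ct ger0_norm//; apply: min_idPl.
  by rewrite mulrC -ler_pdivlMr// div1r.
have gE t : D t -> exists2 F, kernel_class f X l F & forall y, g t y = ct t ^+ m * F y.
  move=> [k0 kl Xx]; exists (fun y => f (kt t *: (xt t - y))) => //.
  exists (xt t), (kt t)^-1; split => //; last by rewrite invrK.
  by rewrite -(invrK l) lef_pV2// posrE invr_gt0.
have mg : measurable_fun setT (fun ty : 'rV[R]_d.+1 * 'rV[R]_d => g ty.1 ty.2).
  apply: measurable_funM.
    apply: measurable_funX; apply: measurable_minr => //.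
    apply: measurableT_comp => //; apply: measurable_funM => //.
    exact: (measurableT_comp mkt).
  apply: (measurableT_comp mf); apply: measurable_affine => //.
    exact: (measurableT_comp mkt).
  exact: (measurableT_comp mxt).
have mD : measurable D.
  rewrite (_ : D = kt @^-1` [set` `]0, l^-1]%R] `&` xt @^-1` X); last first.
    apply/seteqP; split => t /=; rewrite in_itv/=; first by move=> [-> -> ?].
    by move=> [/andP[? ?] ?].
  by apply: measurableI; rewrite -[X in measurable X]setTI;
    [apply: mkt => //; exact: measurable_itv|exact: mxt].
have gb t y : `|g t y| <= b.
  rewrite normrM -[leRHS]mul1r ler_pM//.
  by case/andP: (ctm t) => c0 c1; rewrite ger0_norm.
have bm t : bounded_measurable (fun y : 'rV[R]_d => f (kt t *: (xt t - y))).
  split; last by exists b => y; exact: fb.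
  by apply: (measurableT_comp mf); exact: measurable_affine.
have gvar t : D t -> \int[P]_y (g t y ^+ 2) <= sigma ^+ 2.
  move=> Dt; have [k0 kl Xx] := Dt.
  have bm2 : bounded_measurable (fun y : 'rV[R]_d => f (kt t *: (xt t - y)) ^+ 2).
    exact: (bounded_measurableM _ _ (bm t) (bm t)).
  under eq_Rintegral do rewrite exprMn.
  rewrite RintegralZl//; last exact: bounded_integrable.
  have ki0 : 0 < (kt t)^-1 by rewrite invr_gt0.
  have := C_mom (xt t) (kt t)^-1 Xx ki0; rewrite invrK Rintegral_EFin// lee_fin.
  set I := \int[P]_y _ => IC.
  have I0 : 0 <= I by apply: Rintegral_ge0 => y _; exact: sqr_ge0.
  rewrite -exprM DE// s2.
  have lk0 : 0 < l * kt t by rewrite mulr_gt0.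
  have lk1 : l * kt t <= 1 by rewrite mulrC -ler_pdivlMr// div1r.
  (* Here [a <= 2 * m] is used, the base [l / h] being at most 1. The factor [h^a] of the second
     moment then cancels and leaves [l^a], uniformly in [h]. *)
  have h1 : (l * kt t) ^+ (m * 2) <= (l * kt t) `^ a.
    rewrite -powR_mulrn ?(ltW lk0)// /powR gt_eqF// ler_expR ler_wnM2r ?ln_le0//.
    by rewrite natrM mulrC.
  have h2 : I <= `|C| * (kt t)^-1 `^ a.
    by apply: le_trans IC _; rewrite ler_wpM2r ?powR_ge0// ler_norm.
  apply: (@le_trans _ _ ((l * kt t) `^ a * (`|C| * (kt t)^-1 `^ a))).
    by rewrite ler_pM// exprn_ge0// ltW.
  rewrite mulrCA -powRM ?(ltW lk0) ?(ltW ki0)// mulfK ?gt_eqF//.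
  rewrite ler_wpM2r ?(ltW q0)// /M /variance_const -/cH; lra.
have Fm F : kernel_class f X l F -> measurable_fun setT F.
  move=> [x [h [_ _ ->]]]; apply: (measurableT_comp mf).
  exact: measurable_affine.
have Fb F y : kernel_class f X l F -> `|F y| <= b by move=> [x [h [_ _ ->]]].
have bs : b ^+ 2 * l `^ a <= sigma ^+ 2.
  rewrite s2 ler_wpM2r ?(ltW q0)// /M /variance_const -/cH; have := normr_ge0 C; lra.
have gnet k (z : n.-tuple ('rV[R]_d * 'rV[R]_d)) : exists N (c : 'I_N -> 'rV[R]_d -> R),
  [/\ N%:R <= expR (cH * lam * k.+1%:R), forall j y, `|c j y| <= b &
      forall t, D t -> exists j, n%:R^-1 * \sum_(i < n)
        ((g t (tnth z i).1 - c j (tnth z i).1) ^+ 2 +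
         (g t (tnth z i).2 - c j (tnth z i).2) ^+ 2) <= 2 * (4 * sigma / 2 ^+ k) ^+ 2].
  have rho0 : 0 < 4 * sigma / 2 ^+ k by rewrite divr_gt0 ?mulr_gt0// exprn_gt0.
  have [N [c [Nle cb net]]] := paired_net _ _ _ _ _ _ z n0 VC Fm Fb b0 rho0.
  exists N, c; split => // [|t Dt].
    by apply: le_trans Nle _; exact: entropy_bound bs.
  have [F FF gF] := gE t Dt.
  have [j jle] := net F (ct t ^+ m) FF (ctm t); exists j.
  by under eq_bigr do rewrite !gF.
have H1 : 1 <= cH * lam by nra.
(* The confidence parameter is [4 * lam], which [expR_log_term] converts into failure probability at
   most [delta]. *)
have u0 : 0 <= 4 * lam by lra.
have nlarge : 16 * b ^+ 2 * (5 * (cH * lam) + 4 * lam) <= n%:R * sigma ^+ 2.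
  have -> : 16 * b ^+ 2 * (5 * (cH * lam) + 4 * lam) = 16 * b ^+ 2 * (5 * cH + 4) * lam by ring.
  apply: (@le_trans _ _ (16 * b ^+ 2 * (5 * cH + 4) * (L * (n%:R * l `^ a)))).
    have c0 : 0 <= 5 * cH + 4 by lra.
    by rewrite ler_wpM2l// mulr_ge0// mulr_ge0// ltW.
  rewrite s2 mulrA mulrCA ler_wpM2l// ler_wpM2r ?(ltW q0)//.
  rewrite /M /variance_const -/cH; have := normr_ge0 C; lra.
have iidX B : (forall i, measurable (B i)) ->
    Pr (\bigcap_i (Xs i @^-1` B i)) = (\prod_(i < n) P (B i))%E.
  by move=> mB; rewrite Xind//; apply: eq_bigr => i _; exact: Xmarg.
have [E [mE DevE PE]] := @deviation _ _ R _ _ _ P Pr n n0 Xs mXs iidX D g b sigma (cH * lam)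
  (4 * lam) mD mg b0 sigma0 H1 u0 gb gvar gnet nlarge.
exists E; split => // w h x Xx lh dev.
have h0 : 0 < h by exact: lt_le_trans lh.
pose t : 'rV[R]_d.+1 := \row_i (if unlift ord0 i is Some j then x ord0 j else h^-1).
have ktE : kt t = h^-1 by rewrite /kt mxE unlift_none.
have xtE : xt t = x by apply/rowP => i; rewrite !mxE liftK.
have Dt : D t by split; rewrite ?ktE ?xtE// ?invr_gt0// lef_pV2.
apply: (DevE w t Dt); apply: le_lt_trans (lt_le_trans dev _); last first.
  have gtE : g t = fun y => (l / h) ^+ m * f (h^-1 *: (x - y)).
    by apply/funext => y; rewrite /g DE// ktE xtE.
  rewrite gtE RintegralZl//; last first.
    by have := bounded_integrable P _ (bm t); rewrite ktE xtE.
  have -> : emp n (fun y : 'rV[R]_d => (l / h) ^+ m * f (h^-1 *: (x - y))) (Xs^~ w) =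
      (l / h) ^+ m * emp n (fun y : 'rV[R]_d => f (h^-1 *: (x - y))) (Xs^~ w).
    by rewrite /emp -mulr_sumr mulrCA.
  rewrite -mulrBr normrM ger0_norm// exprn_ge0// divr_ge0// ltW//.
suff key : sigma * Num.sqrt ((2 * (cH * lam) + 4 * lam + 1) / n%:R) <=
    Num.sqrt M * Num.sqrt (2 * cH + 6) * Num.sqrt (l `^ a * lam / n%:R).
  rewrite /deviation_const -/cH -/M -(mulrA (16 * 27)) -[leRHS]mulrA -[leRHS]mulrA.
  by rewrite ler_wpM2l// [leRHS]mulrA.
have cH6 : 0 <= 2 * cH + 6 by clear -cH0; lra.
have Mq : 0 <= M * l `^ a by rewrite mulr_ge0// ltW.
rewrite -[X in _ <= X * _]sqrtrM ?(ltW M0)// -sqrtrM; last by rewrite mulr_ge0// ltW.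
rewrite -sqrtrM// ler_wsqrtr//.
have -> : M * (2 * cH + 6) * (l `^ a * lam / n%:R) =
    M * l `^ a * ((2 * cH + 6) * lam / n%:R) by ring.
by rewrite ler_wpM2l// ler_wpM2r ?invr_ge0//; clear -lam1; lra.
Qed.

End kernel_deviation.

(** * Derivatives of the estimator and of its mean *)

Section kde_partials.
Context {R : realType} {d : nat}.
Variables (K : 'rV[R]_d -> R) (r : seq 'I_d).
Hypothesis hK : has_partials r K.

Lemma partials_kde (h : R) (n : nat) (z : 'I_n -> 'rV[R]_d) (x : 'rV[R]_d) : h != 0 ->
  partials r (kde K h z) x = (n%:R * h ^+ d)^-1 *
    \sum_(i < n) h^-1 ^+ size r * partials r K (h^-1 *: (x - z i)).
Proof.
move=> h0; have hi0 : h^-1 != 0 by rewrite invr_eq0.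
have [hs Es] := has_partials_scale r K h^-1 hi0 hK.
pose k (i : 'I_n) (y : 'rV[R]_d) := K (h^-1 *: (y + - z i)).
have hk i : has_partials r (k i) by have [] := has_partials_shift r _ (- z i) hs.
have [hS ES] := has_partials_sum _ (index_enum 'I_n) r k hk.
have [_ EZ] := has_partialsZ r _ (n%:R * h ^+ d)^-1 hS.
rewrite [LHS](congr1 (fun F => F x) EZ) ES; congr (_ * _); apply: eq_bigr => i _.
by have [_ ->] := has_partials_shift r _ (- z i) hs; rewrite Es.
Qed.

Context {disp : measure_display} {Omega : measurableType disp}.
Variables (P : probability 'rV[R]_d R) (Pr : probability Omega R) (n : nat).
Variable Xs : 'I_n -> Omega -> 'rV[R]_d.
Hypothesis n0 : (0 < n)%N.
Hypothesis iidXs : iid Pr P Xs.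
Hypothesis mK : measurable_fun setT K.

(** [K] is only assumed integrable after rescaling, so the change of variables goes through
    integrability under the law of each [Xs i] and not through boundedness. *)
Lemma mean_kdeE (h : R) (x : 'rV[R]_d) :
  P.-integrable setT (fun y : 'rV[R]_d => (K (h^-1 *: (x - y)))%:E) ->
  mean_kde Pr Xs K h x = \int[P]_y ((h ^+ d)^-1 * K (h^-1 *: (x - y))).
Proof.
move=> iK; have [mXs Xmarg Xind] := iidXs.
have iidX B : (forall i, measurable (B i)) ->
    Pr (\bigcap_i (Xs i @^-1` B i)) = (\prod_(i < n) P (B i))%E.
  by move=> mB; rewrite Xind//; apply: eq_bigr => i _; exact: Xmarg.
pose k (y : 'rV[R]_d) := K (h^-1 *: (x - y)).
have mk : measurable_fun setT k by apply: (measurableT_comp mK); exact: measurable_affine.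
have mEk : measurable_fun setT (EFin \o k) by exact/measurable_EFinP.
have ikX i : Pr.-integrable setT (fun w => (k (Xs i w))%:E).
  apply/integrableP; split; first exact: (measurableT_comp mEk).
  rewrite (@iid_integral_ge0 _ _ _ _ _ P Pr n Xs mXs iidX i (fun y => `|(k y)%:E|%E)).
  - by have /integrableP[] := iK.
  - exact: measurableT_comp.
  - by move=> y.
have EkX i : (\int[Pr]_w (k (Xs i w))%:E = \int[P]_y (k y)%:E)%E.
  have := @integral_pushforward _ _ _ _ _ _ (mXs i) Pr setT (EFin \o k) mEk.
  rewrite preimage_setT => <- //; last exact: ikX.
  by apply: eq_measure_integral => A mA _; rewrite /pushforward; exact: Xmarg.
have fk : (\int[P]_y (k y)%:E)%E \is a fin_num by exact: integrable_fin_num.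
rewrite RintegralZl// /mean_kde unlock /kde.
under eq_integral do rewrite EFinM -sumEFin.
rewrite integralZl//; last by apply: integrable_sum => // i _; exact: ikX.
rewrite integral_sum//.
rewrite (eq_bigr (fun=> (\int[P]_y (k y)%:E)%E)); last by move=> i _; exact: EkX.
rewrite /Rintegral -(fineK fk) sumEFin -EFinM /= sumr_const card_ord -[X in _ * X]mulr_natl.
by rewrite invfM mulrAC mulrA mulVf ?mul1r ?pnatr_eq0 -?lt0n// mulrC.
Qed.

(** Applies [partials_mean] to the kernel rescaled by [h], whose derivative along [r] is bounded by
    a multiple of [b]. *)
Lemma partials_mean_kde (b h : R) (x : 'rV[R]_d) : h != 0 ->
  (forall y, `|partials r K y| <= b) ->
  (forall x : 'rV[R]_d, P.-integrable setT (fun y : 'rV[R]_d => (K (h^-1 *: (x - y)))%:E)) ->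
  has_partials r (mean_kde Pr Xs K h) ->
  partials r (mean_kde Pr Xs K h) x =
    (h ^+ d)^-1 * h^-1 ^+ size r * \int[P]_y partials r K (h^-1 *: (x - y)).
Proof.
move=> h0 Kb iK hM; have hi0 : h^-1 != 0 by rewrite invr_eq0.
have [hs Es] := has_partials_scale r K h^-1 hi0 hK.
have [hZ EZ] := has_partialsZ r _ (h ^+ d)^-1 hs.
have mks (x0 : 'rV[R]_d) (f : 'rV[R]_d -> R) : measurable_fun setT f ->
    measurable_fun setT (fun y : 'rV[R]_d => f (h^-1 *: (x0 - y))).
  by move=> mf; apply: (measurableT_comp mf); exact: measurable_affine.
rewrite (@partials_mean _ _ P r _ _ (`|(h ^+ d)^-1 * h^-1 ^+ size r| * b) _ hZ hM).
- rewrite EZ Es; under eq_Rintegral do rewrite mulrA.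
  rewrite RintegralZl//; apply: bounded_integrable; split; last by exists b => y.
  by apply: mks; exact: measurable_partials.
- apply: measurable_funM => //.
  rewrite (_ : (fun y => K _) = (fun y => K (h^-1 *: (y - 0)))).
    by apply: (measurableT_comp mK); exact: measurable_affine.
  by apply/funext => y; rewrite subr0.
- move=> x0; under eq_fun do rewrite EFinM.
  exact: integrableZl.
- by move=> x0; exact: mean_kdeE.
- by move=> x0; rewrite EZ Es mulrA normrM ler_wpM2l.
Qed.

End kde_partials.

Lemma size_directions (d : nat) (s : 'I_d -> nat) : size (directions s) = morder s.
Proof.
rewrite /directions /morder size_flatten /shape -map_comp sumnE big_map big_enum /=.
by apply: eq_bigr => i _; rewrite size_nseq.
Qed.

Section deviation_identity.
Context {R : realType} {d : nat} {disp : measure_display} {Omega : measurableType disp}.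

Lemma Dmulti_kde_deviation (P : probability 'rV[R]_d R) (Pr : probability Omega R) (n : nat)
    (Xs : 'I_n -> Omega -> 'rV[R]_d) (s : 'I_d -> nat) (K : 'rV[R]_d -> R) (b h : R)
    (w : Omega) (x : 'rV[R]_d) :
  (0 < n)%N -> iid Pr P Xs -> measurable_fun setT K -> has_Dmulti s K -> h != 0 ->
  (forall y, `|Dmulti s K y| <= b) ->
  (forall x : 'rV[R]_d, P.-integrable setT (fun y : 'rV[R]_d => (K (h^-1 *: (x - y)))%:E)) ->
  has_Dmulti s (mean_kde Pr Xs K h) ->
  Dmulti s (kde K h (fun i => Xs i w)) x - Dmulti s (mean_kde Pr Xs K h) x =
  h^-1 ^+ (d + morder s) *
    (emp n (fun y : 'rV[R]_d => Dmulti s K (h^-1 *: (x - y))) (fun i => Xs i w)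
     - \int[P]_y Dmulti s K (h^-1 *: (x - y))).
Proof.
move=> n0 iidXs mK hK h0 Kb iK hM.
rewrite /Dmulti (partials_kde _ _ hK)// (partials_mean_kde _ _ hK _ _ _ _ n0 iidXs mK _ _ _ h0 Kb iK hM).
rewrite -mulr_sumr size_directions /emp exprD [h^-1 ^+ d]exprVn invfM.
ring.
Qed.

Lemma supnorm_le (f : 'rV[R]_d -> R) x : (supnorm f < +oo)%E -> `|f x| <= fine (supnorm f).
Proof.
move=> fin; have le y : (`|f y|%:E <= supnorm f)%E by apply: ereal_sup_ubound; exists y.
by rewrite -lee_fin fineK// ge0_fin_numE// (le_trans _ (le x))// lee_fin.
Qed.

End deviation_identity.

(** * Size of the logarithmic term *)

Section log_term.
Context {R : realType}.

(** Serves to bound [log_term] below by 1/2, so that additive constants can be absorbed into it. *)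
Lemma ln2_ge : 1 <= 2 * ln (2 : R).
Proof.
have e : expR (2^-1 : R) <= 2.
  have := expR_ge1Dx (- (2^-1) : R); rewrite expRN => h.
  have e0 := expR_gt0 (2^-1 : R).
  have : expR (2^-1 : R) * (expR 2^-1)^-1 = 1 by rewrite divff// gt_eqF.
  move: h e0; set E := expR _; set F := E^-1 => h e0 EF; nra.
have : 2^-1 <= ln (2 : R) by rewrite -ler_expR lnK// posrE.
lra.
Qed.

Lemma log_term_ge (l delta : R) : 0 < delta < 1 ->
  Num.max (ln l^-1) 0 <= log_term l delta /\ 1 <= 2 * log_term l delta.
Proof.
move=> /andP[d0 d1]; have l2 : ln 2 <= ln (2 / delta).
  by rewrite ler_ln ?posrE ?divr_gt0// ler_pdivlMr//; lra.
have := ln2_ge; rewrite /log_term.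
have : 0 <= Num.max (ln l^-1) 0 by rewrite le_max lexx orbT.
move: l2; set m := Num.max _ _; set x := ln (2 / delta); lra.
Qed.

(** [expR (- log_term l delta)] is at most [delta / 2], and [4 * (delta / 2)^4 = delta^4 / 4]. *)
Lemma expR_log_term (l delta : R) : 0 < delta < 1 -> 4 * expR (- (4 * log_term l delta)) <= delta.
Proof.
move=> /andP[d0 d1]; have [_ lam1] := log_term_ge l delta (introT andP (conj d0 d1)).
have d20 : 0 < 2 / delta by rewrite divr_gt0.
have : expR (- log_term l delta) <= delta / 2.
  rewrite -[leRHS]lnK ?posrE ?divr_gt0// ler_expR.
  have -> : delta / 2 = (2 / delta)^-1 by rewrite invf_div.
  rewrite lnV ?posrE// lerN2 /log_term lerDr le_max lexx orbT//.
rewrite -mulrN (expRM_natl 4); set e := expR _ => h.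
have e0 : 0 <= e by exact: expR_ge0.
apply: (@le_trans _ _ (4 * (delta / 2) ^+ 4)); first by rewrite ler_wpM2l// lerXn2r// nnegrE divr_ge0// ltW.
have -> : 4 * (delta / 2) ^+ 4 = delta ^+ 4 / 4 by field.
have : delta ^+ 4 <= delta ^+ 1 by rewrite ler_wiXn2l// ltW.
by rewrite expr1; set q := delta ^+ 4; lra.
Qed.

End log_term.

Theorem corollary21 (R : realType) :
  (* C' A |D^sK|_oo d nu d_vol C_{s,P,K,eps} eps (sup_n of the limsup ratio) *)
  exists C' : R -> R -> nat -> R -> R -> R -> R -> R -> R,
  forall (d : nat) (X : set 'rV[R]_d) (s : 'I_d -> nat)
    (P : probability 'rV[R]_d R) (dv : R) (l : nat -> R) (delta : R)
    (K : 'rV[R]_d -> R) (A nu eps : R),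
  measurable X ->
  vol_dim P X = dv%:E ->
  (forall n, (0 < n)%N -> 0 < l n) ->
  0 < delta < 1 ->
  measurable_fun [set: 'rV[R]_d] K ->
  (* (i) *)
  has_Dmulti s K ->
  (supnorm (Dmulti s K) < +oo)%E ->
  (* (ii) *)
  (\int[lebesgue_measure]_(t in `]0%R, +oo[)
     ((t `^ (dv - 1)%R)%:E * tail_sup (fun x => Dmulti s K x ^+ 2)%R t)
   < +oo)%E ->
  (* (iii) *)
  (L2norm (Dmulti s K) < +oo)%E ->
  (forall n, (0 < n)%N ->
     VC_class (kernel_class (Dmulti s K) X (l n))
       (fine (supnorm (Dmulti s K))) A nu) ->
  (* range of eps, including the cases where eps = 0 is allowed *)
  (0 < eps < dv) \/
    (eps = 0 /\ (dv = 0 \/ (ball_growth P X dv < +oo)%E)) ->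
  dv - eps <= 2 * d%:R + 2 * (morder s)%:R ->
  (limn_esup (fun n => (rate_seq l delta (dv - eps) n)%:E) < +oo)%E ->
  (exists C : R, second_moment_bound P X (Dmulti s K) (dv - eps) C) /\
  forall C : R, second_moment_bound P X (Dmulti s K) (dv - eps) C ->
  forall (n : nat) (disp : measure_display) (Omega : measurableType disp)
    (Pr : probability Omega R) (Xs : 'I_n -> Omega -> 'rV[R]_d),
  (0 < n)%N ->
  iid Pr P Xs ->
  (* p_h and D^s p_h are well defined *)
  (forall h, l n <= h ->
     (forall x, P.-integrable [set: 'rV[R]_d]
                  (fun y => (K (h^-1 *: (x - y)))%:E)) /\
     has_Dmulti s (mean_kde Pr Xs K h)) ->
  prob_ge Pr
    [set w | (sup_deviation s K X (l n) Pr Xs w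
     <= (C' A (fine (supnorm (Dmulti s K))) d nu dv C eps
           (sup (range (rate_seq l delta (dv - eps))))
         * Num.sqrt (log_term (l n) delta /
             (n%:R * l n `^ (2 * d%:R + 2 * (morder s)%:R - dv + eps)))
        )%:E)%E]
    (1 - delta).
Proof.
exists (fun A b d nu dv C eps L => deviation_const A b nu (dv - eps) C L).
move=> d X s P dv l delta K A nu eps mX dvE l0 delta01 mK hK fsup tail _ VC epsr am rate.
have dv0 := vol_dim_ge0 _ _ _ dvE.
have a0 : 0 <= dv - eps by case: epsr => [/andP[]|[->]]; lra.
have adv : dv - eps <= dv by case: epsr => [/andP[]|[->]]; lra.
set f := Dmulti s K in fsup tail VC *; set b := fine (supnorm f) in VC *.
set a := dv - eps in a0 adv rate am *.
have mf : measurable_fun setT f by exact: measurable_partials.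
have fb x : `|f x| <= b by exact: supnorm_le.
split.
  have [M M0 PM] := vol_dim_ball_bound _ _ _ _ dvE epsr.
  by apply: second_moment_exists mf fb _ M0 PM tail; rewrite a0.
move=> C C_mom n disp Omega Pr Xs n0 iidXs wd.
have ln0 := l0 n n0.
set lam := log_term (l n) delta.
have [llam lam1] := log_term_ge (l n) delta delta01; rewrite -/lam in llam lam1.
set L := sup (range (rate_seq l delta a)).
have rate_le k : rate_seq l delta a k <= L.
  by apply: ub_le_sup; [exact: limn_esup_range|exists k].
(* At index 0 the denominator vanishes and division by zero returns 0, so 0 belongs to the range. *)
have L0 : 0 <= L by have := rate_le 0; rewrite /rate_seq mul0r invr0 mulr0.
have q0 : 0 < l n `^ a by exact: powR_gt0.
have nq0 : 0 < n%:R * l n `^ a by rewrite mulr_gt0// ltr0n.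
have lamL : lam <= L * (n%:R * l n `^ a) by rewrite -ler_pdivrMr//; exact: rate_le.
pose m := (d + morder s)%N.
have dc0 : 0 <= deviation_const A b nu a C L by rewrite /deviation_const !mulr_ge0 ?sqrtr_ge0.
have devE h x w : l n <= h ->
    Dmulti s (kde K h (fun i => Xs i w)) x - Dmulti s (mean_kde Pr Xs K h) x =
    h^-1 ^+ m * (emp n (fun y : 'rV[R]_d => f (h^-1 *: (x - y))) (fun i => Xs i w)
                 - \int[P]_y f (h^-1 *: (x - y))).
  move=> lh; have h0 : 0 < h by exact: lt_le_trans lh.
  have [iK hM] := wd h lh.
  by apply: Dmulti_kde_deviation n0 iidXs mK hK _ fb iK hM; rewrite gt_eqF.
(* If [b] is 0 the derivative vanishes identically and so does the deviation; the covering bound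
   says nothing then, as it concerns only [eta] below [b]. *)
have [b0|b_gt0] := leP b 0.
  have f0 : f = cst 0.
    by apply/funext => x; apply/eqP; rewrite -normr_le0 (le_trans (fb x)).
  exists setT; split => //; last by rewrite probability_setT lee_fin; case/andP: delta01; lra.
  move=> w _ /=; apply: ge_ereal_sup => _ [h [x [lh Xx ->]]].
  rewrite devE// f0 /emp big1// mulr0 Rintegral_cst_probability subrr mulr0 normr0.
  by rewrite lee_fin mulr_ge0 ?sqrtr_ge0.
have am2 : 0 <= a <= 2 * m%:R by rewrite a0 /= /m natrD mulrDr.
have [E [mE DevE PE]] := kernel_deviation _ _ _ _ _ _ _ _ _ _ _ _ _ L m n0 iidXs mX mf b_gt0
  fb ln0 (VC n n0) am2 C_mom llam lam1 L0 lamL.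
exists (~` E); split; first exact: measurableC.
  move=> w nEw /=; apply: ge_ereal_sup => _ [h [x [lh Xx ->]]].
  have h0 : 0 < h by exact: lt_le_trans lh.
  have lm0 : 0 < l n ^+ m by rewrite exprn_gt0.
  have : ~ (deviation_const A b nu a C L * Num.sqrt (l n `^ a * lam / n%:R) <
      (l n / h) ^+ m * `|emp n (fun y : 'rV[R]_d => f (h^-1 *: (x - y))) (fun i => Xs i w)
                 - \int[P]_y f (h^-1 *: (x - y))|).
    by move=> dev; apply: nEw; exact: DevE dev.
  move=> /negP; rewrite -leNgt => devle.
  rewrite devE// normrM ger0_norm; last by rewrite exprn_ge0// invr_ge0 ltW.
  rewrite lee_fin; set D := `|_| in devle *.
  have -> : h^-1 ^+ m * D = (l n ^+ m)^-1 * ((l n / h) ^+ m * D).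
    by rewrite exprMn !mulrA mulVf ?mul1r// gt_eqF.
  (* The exponent in the denominator is [2 * m - a]; its part [2 * m] leaves the root as [l^(-m)],
     matching the normalization by [(l / h)^m]. *)
  have -> : Num.sqrt (lam / (n%:R * l n `^ (2 * d%:R + 2 * (morder s)%:R - dv + eps))) =
      (l n ^+ m)^-1 * Num.sqrt (l n `^ a * lam / n%:R).
    have -> : 2 * d%:R + 2 * (morder s)%:R - dv + eps = (m * 2)%:R - a.
      by rewrite /m /a natrM natrD; ring.
    rewrite powRB; last by apply/implyP => _; rewrite gt_eqF.
    rewrite powR_mulrn ?(ltW ln0)// exprM.
    rewrite -[(l n ^+ m)^-1]ger0_norm ?invr_ge0 ?(ltW lm0)// -sqrtr_sqr -sqrtrM ?sqr_ge0//.
    congr Num.sqrt.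
    have nn : n%:R != 0 :> R by rewrite pnatr_eq0 -lt0n.
    move: (l n ^+ m) (l n `^ a) lm0 q0 => u v u0 v0.
    by field; rewrite nn !gt_eqF.
  by rewrite [leRHS]mulrCA ler_wpM2l// invr_ge0 ltW.
rewrite probability_setC//.
apply: (@le_trans _ _ (1 - (4 * expR (- (4 * lam)))%:E)%E); last by rewrite leeB.
by rewrite -EFinB lee_fin lerB// expR_log_term.
Qed.
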